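(* Let $\beta<\hat\beta_c$. There exist $\theta<1$ and two positive constants $\nu_8,\nu_9$ such that the following inequalities hold uniformly in $t\in\partial\mathbf K_\xi$, $t$-irreducible clusters $\gamma$, (finite, nonempty) strings of $t$-irreducible clusters $\underline\gamma,\underline\lambda$, $t$-backward irreducible clusters $\gamma^{\mathsf b}$ and pairs of $t$-forward irreducible clusters $\gamma^{\mathsf f},\tilde\gamma^{\mathsf f}$: $$\nu_8\le g(\underline\gamma\mid\gamma^{\mathsf b},\gamma^{\mathsf f})\le\frac1{\nu_8},$$ $$\bigl|g(\gamma,\underline\gamma\mid\gamma^{\mathsf b},\gamma^{\mathsf f})-g(\gamma,\underline\lambda\mid\gamma^{\mathsf b},\tilde\gamma^{\mathsf f})\bigr|\le\nu_9\,\theta^{\,\mathrm i(\underline\gamma,\underline\lambda)},$$ $$\bigl|\psi_t(\gamma,\underline\gamma\mid\gamma^{\mathsf f})-\psi_t(\gamma,\underline\lambda\mid\tilde\gamma^{\mathsf f})\bigr|\le\nu_9\,\theta^{\,\mathrm i(\underline\gamma,\underline\lambda)}.$$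
   Context: Random cluster model. $d\ge 1$; $|\cdot|$ is the Euclidean norm, $(\cdot,\cdot)_d$ the scalar product. $\mathbf J=(J_x)_{x\in\mathbb Z^d}$ are nonnegative reals with $J_x=J_{-x}$, $J_x=0$ whenever $|x|>R$ (some fixed $R>0$), and $J_x>0$ when $|x|=1$. Bonds: $\mathcal E_{\mathbf J}$ is the set of unordered pairs $(x,y)$ with $J_{y-x}>0$; $J_e=J_{y-x}$. In $\omega\in\{0,1\}^{\mathcal E_{\mathbf J}}$ a bond is open if $\omega(e)=1$, closed otherwise; open clusters are the maximal connected components of the graph of open bonds on $\mathbb Z^d$; $A\leftrightarrow B$ means some cluster meets both $A$ and $B$. Fix $q\ge1$, $\beta\ge0$, $p_e=1-e^{-2\beta J_e}$. For finite $\Lambda$, $\mathbb P^\eta_\Lambda$ is the measure on configurations agreeing with $\eta$ on bonds not inside $\Lambda$, with weights proportional to $\prod_{e\subset\Lambda}p_e^{\omega(e)}(1-p_e)^{1-\omega(e)}q^{\#\text{clusters meeting }\Lambda}$; $\mathbb P^{\rm w}_\Lambda$ is the case $\eta\equiv1$. For a finite subgraph $\gamma$ of $(\mathbb Z^d,\mathcal E_{\mathbf J})$, $\mathbb P^{\rm f}_\gamma$ is the probability measure on $\{0,1\}^{\text{edges of }\gamma}$ with weights proportional to $\prod_e p_e^{\omega(e)}(1-p_e)^{1-\omega(e)}q^{\#\text{clusters in }\gamma}$. With $\Lambda_N=\{-N,\dots,N\}^d$, $\hat\beta_c$ is the supremum of all $\beta$ for which there are $\nu_0,\nu_1>0$ with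 $\mathbb P^{\rm w}_{\Lambda_N}(0\leftrightarrow\mathbb Z^d\setminus\Lambda_N)\le\nu_0e^{-\nu_1N}$ for all $N$. For $\beta<\hat\beta_c$ there is a unique infinite-volume (DLR) random cluster measure $\mathbb P$. $\xi(x)=-\lim_k\frac1k\log\mathbb P(0\leftrightarrow[kx])$ (a norm), $\mathbf K_\xi=\bigcap_{\vec n\in\mathbb S^{d-1}}\{t:(t,\vec n)_d\le\xi(\vec n)\}$. Irreducible clusters. Fix $\delta\in(0,\frac13)$ such that for every $t\in\partial\mathbf K_\xi$ some $\vec e_i$ or $-\vec e_i$ lies in the interior of $Y=Y^>_{3\delta}(t)=\{y\in\mathbb Z^d:\xi(y)-(t,y)_d<3\delta\xi(y)\}$; the apex $0$ is added to $Y$ in confinement conditions. For a finite connected subgraph $\gamma$ of $(\mathbb Z^d,\mathcal E_{\mathbf J})$ a vertex $y\in\gamma$ is a cone point if $\gamma\subset(y-Y)\cup(y+Y)$. $\gamma$ is $t$-backward irreducible if there is $\mathsf b=\mathsf b(\gamma)\in\gamma$ with $\gamma\subset\mathsf b-Y$ and $\mathsf b$ is the only cone point of $\gamma$; $t$-forward irreducible if there is $\mathsf f=\mathsf f(\gamma)\in\gamma$ with $\gamma\subset\mathsf f+Y$ and $\mathsf f$ is the only cone point; $t$-irreducible if there are $\mathsf f\ne\mathsf b$ in $\gamma$ with $\gamma\subset(\mathsf f+Y)\cap(\mathsf b-Y)$ and $\mathsf f,\mathsf b$ are the only cone points. $V(\gamma)=\mathsf b(\gamma)-\mathsf f(\gamma)$.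 Clusters are considered modulo lattice translations; a string $\gamma^{\mathsf b},\gamma_1,\dots,\gamma_n,\gamma^{\mathsf f}$ is always placed so that consecutive clusters satisfy $\mathsf b(\text{previous})=\mathsf f(\text{next})$. Events. For $t$-irreducible $\gamma$ with edge set $\mathcal E_W(\gamma)$, $\mathcal W$ is the event that all edges of $\mathcal E_W(\gamma)$ are open, and $\mathcal N$ the event that all edges of $\mathcal E_N(\gamma)=\{(u,v)\in\mathcal E_{\mathbf J}:u\in\gamma\}\setminus(\mathcal E_W(\gamma)\cup\mathcal E^-(\mathsf f)\cup\mathcal E^+(\mathsf b))$ are closed, where $\mathcal E^-(\mathsf f)=\{(u,\mathsf f):u\in\mathsf f-Y\}$, $\mathcal E^+(\mathsf b)=\{(\mathsf b,v):v\in\mathsf b+Y\}$. For backward irreducible $\gamma^{\mathsf b}$ (resp. forward irreducible $\gamma^{\mathsf f}$) the events $\mathcal W^{\mathsf b},\mathcal N^{\mathsf b}$ (resp. $\mathcal W^{\mathsf f},\mathcal N^{\mathsf f}$) are defined in the same way, removing only $\mathcal E^+(\mathsf b)$ (resp. only $\mathcal E^-(\mathsf f)$). Juxtaposition of events denotes intersection; $\mathcal W_k,\mathcal N_k$ correspond to $\gamma_k$. Functions. For a string $(\gamma_1,\dots,\gamma_n)$, $n\ge1$, of $t$-irreducible clusters, $$g(\gamma_1,\dots,\gamma_n\mid\gamma^{\mathsf b},\gamma^{\mathsf f})=\frac{\mathbb P(\mathcal N^{\mathsf b}\mid\mathcal N_1\cdots\mathcal N_n\mathcal N^{\mathsf f})}{\mathbb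 P(\mathcal N^{\mathsf b})},$$ $$e^{\psi_t(\gamma_1,\dots,\gamma_n\mid\gamma^{\mathsf f})}=e^{(t,V(\gamma_1))_d}\,\mathbb P^{\rm f}_{\gamma_1}(\mathcal W_1)\,\mathbb P(\mathcal N_1\mid\mathcal N_2\cdots\mathcal N_n\mathcal N^{\mathsf f}).$$ $(\gamma,\underline\gamma)$ denotes the string $\underline\gamma$ with $\gamma$ put in front. For $\underline\gamma=(\gamma_1,\dots,\gamma_n)$ and $\underline\lambda=(\lambda_1,\dots,\lambda_m)$, $\mathrm i(\underline\gamma,\underline\lambda)=\min\{i:\lambda_i\ne\gamma_i\}\wedge n\wedge m$. *)

(* Defs.v *)
From HB Require Import structures.
From mathcomp Require Import all_boot all_order all_algebra finmap.
From mathcomp Require Import all_classical all_reals all_analysis.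

Set Implicit Arguments.
Unset Strict Implicit.
Unset Printing Implicit Defensive.

Import Order.TTheory GRing.Theory Num.Theory.
Import numFieldNormedType.Exports.

Local Open Scope classical_set_scope.
Local Open Scope ring_scope.

Notation site d := 'rV[int]_d.

(* An edge is a set of sites; it is a bond when it is a pair of distinct sites
   at a displacement with positive coupling, so J 0 plays no role. *)
Notation edge d := {fset 'rV[int]_d}.

Section Lattice.
Context {R : realType} {d : nat}.

Definition embed (x : site d) : 'rV[R]_d := map_mx intr x.

Definition dot (x y : 'rV[R]_d) : R := \sum_(i < d) x 0 i * y 0 i.

Definition enorm (x : 'rV[R]_d) : R := Num.sqrt (dot x x).

Definition int_part (x : 'rV[R]_d) : site d := map_mx Num.floor x.

Definition box_site (N : nat) (v : {ffun 'I_d -> 'I_(N.*2).+1}) : site d :=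
  \row_i ((v i)%:Z - N%:Z).

Definition box (N : nat) : {fset site d} :=
  [fset box_site v | v : {ffun 'I_d -> 'I_(N.*2).+1}]%fset.

(* J_{y - x} for e = {x, y}: the order in which the two elements are enumerated
   is irrelevant as soon as J is even. *)
Definition edge_coupling (J : site d -> R) (e : edge d) : R :=
  J (nth 0 (enum_fset e) 1 - nth 0 (enum_fset e) 0).

Definition is_bond (J : site d -> R) (e : edge d) : bool :=
  (#|` e| == 2)%N && (0 < edge_coupling J e).

Definition bond (J : site d -> R) : Type := {e : edge d | is_bond J e}.

Definition config (J : site d -> R) : Type := bond J -> bool.

HB.instance Definition _ J := Pointed.on (config J).

Definition linked (o : edge d -> bool) (x y : site d) : Prop :=
  exists2 s, path (fun u v => o [fset u; v]%fset) x s & last x s = y.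

(* The clusters meeting V are in bijection with their traces on V. *)
Definition num_clusters (o : edge d -> bool) (V : {fset site d}) : nat :=
  #|` [fset [fset y in V | `[< linked o x y >]] | x in V]%fset |.

End Lattice.

Section RandomCluster.
Context {R : realType} {d : nat} (J : site d -> R).
Implicit Types (q beta : R) (L V : {fset site d}) (A E : {fset edge d}).

Definition is_open (w : config J) (e : edge d) : bool :=
  oapp w false (insub e : option (bond J)).

Definition connects (X Y : set (site d)) : set (config J) :=
  [set w | exists x y, [/\ X x, Y y & linked (is_open w) x y]].

Definition p_open beta (e : edge d) : R :=
  1 - expR (- (2 * beta * edge_coupling J e)).

Definition rc_weight q beta E A (n : nat) : R :=
  (\prod_(e <- E) (if e \in A then p_open beta e else 1 - p_open beta e))
  * q ^+ n.

Definition inner_bonds L : {fset edge d} :=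
  [fset e in fpowerset L | is_bond J e]%fset.

(* Open inside L exactly on A, equal to eta on the other bonds. *)
Definition glue_config L (eta : config J) A : config J :=
  fun e => if val e \in inner_bonds L then val e \in A else eta e.

Definition rc_finite_weight q beta L (eta : config J) A : R :=
  rc_weight q beta (inner_bonds L) A
    (num_clusters (is_open (glue_config L eta A)) L).

Definition rc_finite q beta L (eta : config J) (F : set (config J)) : R :=
  (\sum_(A <- fpowerset (inner_bonds L))
      rc_finite_weight q beta L eta A * \1_F (glue_config L eta A))
  / \sum_(A <- fpowerset (inner_bonds L)) rc_finite_weight q beta L eta A.

(* Extended-real valued: beta_hat is +oo when d = 1. *)
Definition beta_hat q : \bar R :=
  ereal_sup [set b%:E | b in [set b : R | 0 <= b /\
    exists nu0 nu1 : R, [/\ 0 < nu0, 0 < nu1 & forall N : nat,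
      rc_finite q b (box N) (fun=> true)
        (connects [set 0] (~` [set x | x \in box N]))
      <= nu0 * expR (- (nu1 * N%:R))]]].

Definition cylinders (B : set (bond J)) : set (set (config J)) :=
  [set [set w : config J | w e] | e in B].

Definition rc_space : Type := g_sigma_algebraType (cylinders setT).

HB.instance Definition _ := Measurable.on rc_space.

(* For every finite L, the finite-volume kernel is a version of the conditional
   probability P( . | bonds not inside L). *)
Definition is_DLR q beta (P : probability rc_space R) : Prop :=
  forall L (F G : set rc_space), measurable F ->
    <<s cylinders [set e | val e \notin inner_bonds L] >> G ->
    P (F `&` G) = (\int[P]_(eta in G) (rc_finite q beta L eta F)%:E)%E.

End RandomCluster.

Section InverseCorrelationLength.
Context {R : realType} {d : nat} {J : site d -> R}.
Variable P : probability (rc_space J) R.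

Definition prob (F : set (rc_space J)) : R := fine (P F).

Definition cond_prob (F G : set (rc_space J)) : R :=
  prob (F `&` G) / prob G.

Definition xi (x : 'rV[R]_d) : R :=
  - limn (fun k : nat =>
      k%:R^-1 * ln (prob (connects [set 0] [set int_part (k%:R *: x)]))).

Definition K_xi : set 'rV[R]_d :=
  [set t | forall n, enorm n = 1 -> dot t n <= xi n].

Definition boundary (A : set 'rV[R]_d) : set 'rV[R]_d := closure A `\` A°.

Definition real_cone (a : R) (t : 'rV[R]_d) : set 'rV[R]_d :=
  [set y | xi y - dot t y < a * xi y].

Definition cone (a : R) (t : 'rV[R]_d) : set (site d) :=
  [set y | real_cone a t (embed y)].

(* The interior is that of the cone in R^d whose lattice points form Y. *)
Definition admissible (delta : R) : Prop :=
  forall t, boundary K_xi t -> exists i : 'I_d,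
    (real_cone (3 * delta) t)° (delta_mx 0 i) \/
    (real_cone (3 * delta) t)° (- delta_mx 0 i).

End InverseCorrelationLength.

Record subgraph (d : nat) := Subgraph {
  gV : {fset site d};
  gE : {fset edge d}
}.

Section IrreducibleClusters.
Context {R : realType} {d : nat} (J : site d -> R) (Y : set (site d)).
Implicit Types (g : subgraph d) (a b f x y : site d).

Definition shift_set a (V : {fset site d}) : {fset site d} :=
  [fset (x + a)%R | x in V]%fset.

Definition shift a g : subgraph d :=
  Subgraph (shift_set a (gV g)) [fset shift_set a e | e in gE g]%fset.

Definition translates (g h : subgraph d) : Prop := exists a, shift a g = h.

Definition connected_subgraph g : Prop :=
  (forall e, e \in gE g -> is_bond J e /\ (e `<=` gV g)%fset) /\
  (forall x y, x \in gV g -> y \in gV g ->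
     linked (fun e => e \in gE g) x y).

Definition with_apex : set (site d) := Y `|` [set 0].

Definition cone_point g y : Prop :=
  y \in gV g /\
  forall x, x \in gV g -> with_apex (y - x) \/ with_apex (x - y).

Definition backward_at g b : Prop :=
  [/\ b \in gV g, forall x, x \in gV g -> with_apex (b - x)
    & forall y, cone_point g y <-> y = b].

Definition forward_at g f : Prop :=
  [/\ f \in gV g, forall x, x \in gV g -> with_apex (x - f)
    & forall y, cone_point g y <-> y = f].

Definition irreducible_at g (fb : site d * site d) : Prop :=
  [/\ fb.1 != fb.2, fb.1 \in gV g, fb.2 \in gV g,
      forall x, x \in gV g -> with_apex (x - fb.1) /\ with_apex (fb.2 - x)
    & forall y, cone_point g y <-> y = fb.1 \/ y = fb.2].

Definition backward_irreducible g : Prop :=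
  connected_subgraph g /\ exists b, backward_at g b.

Definition forward_irreducible g : Prop :=
  connected_subgraph g /\ exists f, forward_at g f.

Definition irreducible g : Prop :=
  connected_subgraph g /\ exists fb, irreducible_at g fb.

(* The marked points f and b: of an irreducible cluster (ends), of a backward
   irreducible one (b_only), of a forward irreducible one (f_only). *)
Definition ends g : site d * site d := xget (0, 0) (irreducible_at g).
Definition b_only g : site d := xget 0 (backward_at g).
Definition f_only g : site d := xget 0 (forward_at g).

Definition displacement g : site d := (ends g).2 - (ends g).1.

Definition edges_minus f : set (edge d) :=
  [set [fset u; f]%fset | u in [set u | Y (f - u)]].

Definition edges_plus b : set (edge d) :=
  [set [fset b; v]%fset | v in [set v | Y (v - b)]].

Definition closed_around g (X : set (edge d)) : set (rc_space J) :=
  [set w | forall e : bond J, (exists2 u, u \in gV g & u \in val e) ->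
     val e \notin gE g -> ~ X (val e) -> w e = false].

Definition event_N g : set (rc_space J) :=
  closed_around g (edges_minus (ends g).1 `|` edges_plus (ends g).2).
Definition event_Nb g : set (rc_space J) :=
  closed_around g (edges_plus (b_only g)).
Definition event_Nf g : set (rc_space J) :=
  closed_around g (edges_minus (f_only g)).

(* N_1 ... N_n N^f for the string s followed by gf, translated so that the
   first cluster starts at a and each next one at the end of the previous. *)
Fixpoint string_N a (s : seq (subgraph d)) (gf : subgraph d) :
    set (rc_space J) :=
  if s is g :: s' then
    event_N (shift (a - (ends g).1) g) `&` string_N (a + displacement g) s' gf
  else event_Nf (shift (a - f_only gf) gf).

End IrreducibleClusters.

Section FreeMeasure.
Context {R : realType} {d : nat} (J : site d -> R) (q beta : R).

Definition rc_free_weight (g : subgraph d) (A : {fset edge d}) : R :=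
  rc_weight J q beta (gE g) A (num_clusters (fun e => e \in A) (gV g)).

(* Configurations on the edges of g are identified with sets of open edges. *)
Definition rc_free (g : subgraph d) (F : set {fset edge d}) : R :=
  (\sum_(A <- fpowerset (gE g)) rc_free_weight g A * \1_F A)
  / \sum_(A <- fpowerset (gE g)) rc_free_weight g A.

Definition event_W (g : subgraph d) : set {fset edge d} :=
  [set A | (gE g `<=` A)%fset].

End FreeMeasure.

Section Functions.
Context {R : realType} {d : nat} {J : site d -> R}.
Variables (P : probability (rc_space J) R) (Y : set (site d)).

Definition g_fun (s : seq (subgraph d)) (gb gf : subgraph d) : R :=
  cond_prob P (event_Nb Y gb) (string_N Y (b_only Y gb) s gf)
  / prob P (event_Nb Y gb).

(* psi_t on the nonempty string with head g and tail s. *)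
Definition psi (q beta : R) (t : 'rV[R]_d) (g : subgraph d)
    (s : seq (subgraph d)) (gf : subgraph d) : R :=
  ln (expR (dot t (embed (displacement Y g)))
      * rc_free J q beta g (event_W g)
      * cond_prob P (event_N Y g) (string_N Y (ends Y g).2 s gf)).

End Functions.

(* min {i : l_i <> s_i} /\ n /\ m with positions counted from 1 and clusters
   compared modulo translations. *)
Definition first_disagreement (d : nat) (s l : seq (subgraph d)) : nat :=
  minn (find (fun p => ~~ `[< translates p.1 p.2 >]) (zip s l)).+1
       (minn (size s) (size l)).

(* Main.v *)
Require Import Defs.
From mathcomp Require Import all_boot all_order all_algebra finmap.
From mathcomp Require Import all_classical all_reals all_analysis.
From mathcomp Require Import ring lra zify.
Import Order.TTheory GRing.Theory Num.Theory.
Import numFieldNormedType.Exports.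
Set Implicit Arguments.
Unset Strict Implicit.
Unset Printing Implicit Defensive.
Local Open Scope classical_set_scope.
Local Open Scope ring_scope.

(** A random cluster measure with q >= 1 is monotone in its boundary condition,
    and remains a random cluster measure when some bonds are conditioned to be
    closed. In a box of radius N around x, the probability that a bond at x is
    open differs between wired and free boundary conditions by at most the
    wired probability that x is joined to the complement of the box: explore
    the clusters coming from outside, then what is left carries a free measure.
    By the DLR equations, the conditional probability that a bond at x is
    closed, given that other bonds are closed, is therefore insensitive to the
    bonds at distance more than N, up to an error exponentially small in N.

    All the events N in the theorem say that certain bonds are closed, so
    telescoping over the bonds around one cluster turns this into a bound, by
    the sum over these bonds of exp(-c dist), on the influence of the clusters
    that are far down the string on ln P(N | ...). The form (t, .) grows
    linearly along a string and separates the cones b - Y and b + v + Y, which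
    makes that distance at least a multiple of |b - u| + i for a bond at u, and
    the sum of order theta^i.

    The separation of cones needs xi to dominate a norm on the lattice. The
    comparison with free boundary conditions shows that P is translation
    invariant and that x -> P(0 <-> x) is supermultiplicative, so the limit
    defining xi exists and is bounded below by the decay rate. When beta = 0,
    xi vanishes and there are no irreducible clusters. *)

(** * Sums over sets of edges *)

Section PowersetSums.
Local Open Scope fset_scope.
Local Open Scope ring_scope.
Context {K : choiceType}.
Implicit Types (A B E : {fset K}) (e : K).

(** The probabilities of the events N are exponentially small in the size of the clusters, so errors
    have to be multiplicative. Hence the work is done on ln P(closed), one bond at a time: given any
    other closed bonds, a bond is closed with probability at least exp(-2 beta sum J), so an
    absolute error on this probability is a relative one.

    Closing bonds only lowers the probability of escaping from a box, so the wired decay survives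
    every conditioning that occurs. For this reason all finite-volume sums carry a set [B] of closed
    bonds.

    The exploration is written without quotients, as identities and inequalities between products of
    sums of weights. The free measure on the unexplored region is realised in [L] by closing the
    remaining bonds, and monotonicity in the closed set then compares it with the free measure on
    [L].

    Uniformity in t holds because the form (t, .) enters only through a lower slope (1 - 3 delta)
    nu1 on the cones and a Lipschitz constant D, the latter from the boundedness of K_xi. Two
    strings are compared by cutting both after their common prefix, whence the factors 2. *)

Lemma big_fpowersetU1 (M : nmodType) e E (f : {fset K} -> M) : e \notin E ->
  \sum_(A <- fpowerset (e |` E)) f A =
  \sum_(A <- fpowerset E) (f A + f (e |` A)).
Proof.
move=> eE; have inj : {in fpowerset E &, injective (fun A => e |` A)}.
  move=> A B; rewrite !fpowersetE => /fsubsetP AE /fsubsetP BE /fsetP AB.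
  apply/fsetP => x; have := AB x; rewrite !inE; case: eqVneq => //= -> _.
  by apply/idP/idP => [/AE|/BE]; rewrite (negPf eE).
rewrite big_split /= (big_fsetID _ (fun A => e \notin A)) /=.
have -> : \sum_(A <- fpowerset E) f (e |` A) =
          \sum_(A <- [fset (e |` A) | A in fpowerset E]) f A.
  by rewrite [RHS]big_imfset.
congr (_ + _).
  apply: eq_fbigl => A; rewrite !inE /= !fpowersetE.
  apply/andP/idP => [[/fsubsetP AE eA]|/fsubsetP AE].
    apply/fsubsetP => x xA; have := AE _ xA; rewrite !inE.
    by case: eqVneq => // xe; rewrite xe (negPf eA) in xA.
  split; first by apply/fsubsetP => x /AE; rewrite !inE orbC => ->.
  by apply: contra eE => /AE.
apply: eq_fbigl => A; apply/idP/imfsetP => [|[B]].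
  rewrite !inE /= fpowersetE negbK => /andP[AE eA].
  exists (A `\ e); last by rewrite fsetD1K.
  rewrite /= fpowersetE; apply/fsubsetP => x; rewrite !inE => /andP[xe xA].
  by move/fsubsetP/(_ _ xA): AE; rewrite !inE (negPf xe).
rewrite /= fpowersetE => BE ->; rewrite !inE /= fpowersetE eqxx /= andbT.
exact: fsetUS.
Qed.

Lemma big_fpowersetU (M : nmodType) E1 E2 (f : {fset K} -> M) :
  [disjoint E1 & E2]%fset ->
  \sum_(A <- fpowerset (E1 `|` E2)) f A =
  \sum_(A1 <- fpowerset E1) \sum_(A2 <- fpowerset E2) f (A1 `|` A2).
Proof.
elim/fset1U_rect: E1 f => [|e E1 eE1 IH] f dE.
  by rewrite fpowerset0 big_seq_fset1 fset0U; apply: eq_bigr => A _; rewrite fset0U.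
have [eE2 d12] : e \notin E2 /\ [disjoint E1 & E2]%fset.
  move: dE; rewrite -!fsetI_eq0 fsetIUl => /eqP/fsetP dE; split.
    by apply/negP => eE2; have := dE e; rewrite !inE eqxx eE2.
  by apply/eqP/fsetP => x; have := dE x; rewrite !inE; case: (x \in E1); case: (x \in E2); rewrite //= orbT.
rewrite -fsetUA big_fpowersetU1; last by rewrite !inE negb_or eE1.
rewrite IH // big_fpowersetU1 //; apply: eq_bigr => A1 _.
by rewrite -big_split /=; apply: eq_bigr => A2 _; rewrite fsetUA.
Qed.

(** The case of a one-element set. With M = c1 d0 and m = c0 d1, the mixed products x and y are at
    most M and satisfy xy <= Mm, so (M - x)(M - y) >= 0 gives x + y <= M + m. *)
Lemma four_numbers (R : realFieldType) (a0 a1 b0 b1 c0 c1 d0 d1 : R) :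
  0 <= a0 -> 0 <= a1 -> 0 <= b0 -> 0 <= b1 ->
  0 <= c0 -> 0 <= c1 -> 0 <= d0 -> 0 <= d1 ->
  a0 * b0 <= c0 * d0 -> a0 * b1 <= c1 * d0 -> a1 * b0 <= c1 * d0 ->
  a1 * b1 <= c1 * d1 -> (a0 + a1) * (b0 + b1) <= (c0 + c1) * (d0 + d1).
Proof.
move=> a0P a1P b0P b1P c0P c1P d0P d1P h00 h01 h10 h11.
have cd : 0 <= c1 * d0 by rewrite mulr_ge0.
have mixed : a0 * b1 + a1 * b0 <= c1 * d0 + c0 * d1.
  have [z|nz] := eqVneq (c1 * d0) 0.
    have c0d1 : 0 <= c0 * d1 by rewrite mulr_ge0.
    by lra.
  have pos : 0 < c1 * d0 by rewrite lt_neqAle eq_sym nz.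
  have prod : (a0 * b1) * (a1 * b0) <= (c1 * d0) * (c0 * d1).
    rewrite (_ : a0 * b1 * _ = (a0 * b0) * (a1 * b1)); last ring.
    rewrite (_ : c1 * d0 * _ = (c0 * d0) * (c1 * d1)); last ring.
    by rewrite ler_pM ?mulr_ge0.
  have slack : 0 <= (c1 * d0 - a0 * b1) * (c1 * d0 - a1 * b0).
    by rewrite mulr_ge0 ?subr_ge0.
  by rewrite -(ler_pM2l pos); nra.
nra.
Qed.

(* The Ahlswede-Daykin inequality. *)
Lemma four_functions (R : realFieldType) E (f1 f2 f3 f4 : {fset K} -> R) :
  (forall A, 0 <= f1 A) -> (forall A, 0 <= f2 A) ->
  (forall A, 0 <= f3 A) -> (forall A, 0 <= f4 A) ->
  (forall A B, A `<=` E -> B `<=` E ->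
     f1 A * f2 B <= f3 (A `|` B) * f4 (A `&` B)) ->
  (\sum_(A <- fpowerset E) f1 A) * (\sum_(A <- fpowerset E) f2 A) <=
  (\sum_(A <- fpowerset E) f3 A) * (\sum_(A <- fpowerset E) f4 A).
Proof.
elim/fset1U_rect: E f1 f2 f3 f4 => [|e E eE IH] f1 f2 f3 f4 p1 p2 p3 p4 H.
  rewrite fpowerset0 !big_seq_fset1.
  by have := H fset0 fset0 (fsubset_refl _) (fsubset_refl _); rewrite fset0U fset0I.
rewrite !big_fpowersetU1 //; apply: IH => [A|A|A|A|A B AE BE]; rewrite ?addr_ge0 //.
have eA : e \notin A by apply: contra eE; move/fsubsetP: AE; apply.
have eB : e \notin B by apply: contra eE; move/fsubsetP: BE; apply.
have A0 : A `<=` e |` E by apply: fsubset_trans AE (fsubsetU1 _ _).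
have B0 : B `<=` e |` E by apply: fsubset_trans BE (fsubsetU1 _ _).
have A1 : e |` A `<=` e |` E by apply: fsetUS.
have B1 : e |` B `<=` e |` E by apply: fsetUS.
apply: four_numbers => //; first exact: H.
- have := H _ _ A0 B1; congr (_ <= f3 _ * f4 _); apply/fsetP => x; rewrite !inE;
    by case: eqVneq => // ->; rewrite ?(negPf eA) ?(negPf eB).
- have := H _ _ A1 B0; congr (_ <= f3 _ * f4 _); apply/fsetP => x; rewrite !inE;
    by case: eqVneq => // ->; rewrite ?(negPf eA) ?(negPf eB).
- have := H _ _ A1 B1; congr (_ <= f3 _ * f4 _); apply/fsetP => x; rewrite !inE;
    by case: eqVneq => // ->; rewrite ?(negPf eA) ?(negPf eB).
Qed.

End PowersetSums.

Section PowersetImage.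
Local Open Scope fset_scope.
Local Open Scope ring_scope.

Lemma big_fpowerset_imfset (K K' : choiceType) (M : nmodType) (h : K -> K') (E : {fset K})
    (f : {fset K'} -> M) : injective h ->
  \sum_(A <- fpowerset (h @` E)) f A = \sum_(A <- fpowerset E) f (h @` A).
Proof.
move=> hI; elim/fset1U_rect: E f => [|e E eE IH] f.
  by rewrite imfset0 !fpowerset0 !big_seq_fset1 imfset0.
rewrite imfsetU1 [RHS]big_fpowersetU1 // [LHS]big_fpowersetU1 ?IH; last by rewrite mem_imfset.
by apply: eq_bigr => A _; rewrite imfsetU1.
Qed.

End PowersetImage.

(** * Numbers of clusters *)

Section Clusters.
Context {d : nat}.
Implicit Types (o : edge d -> bool) (x y z u v : site d) (e : edge d).
Implicit Types (V : {fset site d}) (A : {fset edge d}).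

Lemma fset2C u v : [fset u; v]%fset = [fset v; u]%fset.
Proof. exact: fsetUC. Qed.

Lemma fset2_inj x y u v : [fset x; y]%fset = [fset u; v]%fset ->
  (x = u /\ y = v) \/ (x = v /\ y = u).
Proof.
move=> E.
have : x \in [fset u; v]%fset by rewrite -E fset21.
have : y \in [fset u; v]%fset by rewrite -E fset22.
have : u \in [fset x; y]%fset by rewrite E fset21.
have : v \in [fset x; y]%fset by rewrite E fset22.
rewrite !inE => /orP[]/eqP-> /orP[]/eqP; auto; move=> ux /orP[]/eqP yu /orP[]/eqP xu;
  by subst; auto.
Qed.

Lemma cardfs2_ex (e : edge d) : #|` e| = 2%N ->
  exists u v, u != v /\ e = [fset u; v]%fset.
Proof.
move=> e2; have /fset0Pn[u ue] : e != fset0 by rewrite -cardfs_gt0 e2.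
have e1 : #|` (e `\ u)%fset| = 1%N by apply: succn_inj; rewrite -e2 (cardfsD1 u e) ue.
have /fset0Pn[v vE] : (e `\ u)%fset != fset0 by rewrite -cardfs_gt0 e1.
exists u, v; have := vE; rewrite !inE => /andP[vu ve]; split; first by rewrite eq_sym.
move: e1; rewrite (cardfsD1 v) vE add1n => /succn_inj/cardfs0_eq E0.
by rewrite -(fsetD1K ue) -(fsetD1K vE) E0 fsetU0.
Qed.

Lemma linked_refl o x : linked o x x.
Proof. by exists [::]. Qed.

Lemma linked1 o u v : o [fset u; v]%fset -> linked o u v.
Proof. by move=> ouv; exists [:: v]; rewrite //= ouv. Qed.

Lemma linked_trans o y x z : linked o x y -> linked o y z -> linked o x z.
Proof.
move=> [s ps ls] [s' ps' ls']; exists (s ++ s').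
  by rewrite cat_path ps ls.
by rewrite last_cat ls.
Qed.

Lemma linked_ind o x (Q : site d -> Prop) : Q x ->
  (forall u v, linked o x u -> Q u -> o [fset u; v]%fset -> Q v) ->
  forall y, linked o x y -> Q y.
Proof.
move=> Qx H y [s + <-]; elim/last_ind: s => [//|s z IH].
rewrite rcons_path last_rcons => /andP[ps oz].
by apply: H oz; [exists s | exact: IH].
Qed.

Lemma linked_sym o x y : linked o x y -> linked o y x.
Proof.
move: y; apply: linked_ind => [|u v _ ux ouv]; first exact: linked_refl.
by apply: linked_trans ux; apply: linked1; rewrite fset2C.
Qed.

Lemma linked_mono o o' x y : (forall e, o e -> o' e) ->
  linked o x y -> linked o' x y.
Proof. by move=> H [s ps ls]; exists s => //; apply: sub_path ps => u v /H. Qed.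

Definition add_edges o A : edge d -> bool := fun e => o e || (e \in A).

Lemma add_edges0 o : add_edges o fset0 = o.
Proof. by apply/funext => e; rewrite /add_edges inE orbF. Qed.

Lemma add_edgesU o A A' :
  add_edges o (A `|` A')%fset = add_edges (add_edges o A) A'.
Proof. by apply/funext => e; rewrite /add_edges inE orbA. Qed.

Lemma linked_add_edge o u v x y :
  linked (add_edges o [fset [fset u; v]]%fset) x y <->
  linked o x y \/ (linked o x u /\ linked o v y) \/
  (linked o x v /\ linked o u y).
Proof.
set o' := add_edges _ _.
have oo' a b : linked o a b -> linked o' a b.
  by apply: linked_mono => e; rewrite /o' /add_edges => ->.
have uv : linked o' u v by apply: linked1; rewrite /o' /add_edges !inE eqxx orbT.
split; last first.
  case=> [/oo'//|[[/oo' xu /oo' vy]|[/oo' xv /oo' uy]]].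
    exact: (linked_trans (linked_trans xu uv) vy).
  exact: (linked_trans (linked_trans xv (linked_sym uv)) uy).
move: y; apply: linked_ind => [|a b _ IH]; first by left; exact: linked_refl.
rewrite /o' /add_edges inE => /orP[/linked1 ab|/eqP/fset2_inj].
  case: IH => [xa|[[xu va]|[xv ua]]]; first by left; exact: linked_trans ab.
    by right; left; split => //; exact: linked_trans ab.
  by right; right; split => //; exact: linked_trans ab.
have rf := linked_refl o; case=> [[au bv]|[av bu]]; subst a b.
  by case: IH => [xu|[[xu vu]|[xv uu]]]; [right; left|right; left|left].
by case: IH => [xv|[[xu vv]|[xv uv']]]; [right; right|left|right; right].
Qed.

(** An edge between two sites of [V] merges two traces if its endpoints were not linked, and changes
    nothing otherwise. The two comparisons below follow by adding edges one at a time. *)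
Lemma num_clusters_add_edge o V u v : u \in V -> v \in V ->
  num_clusters o V = (num_clusters (add_edges o [fset [fset u; v]]%fset) V
    + ~~ `[< linked o u v >])%N.
Proof.
move=> uV vV; have [uv|nuv] := asboolP (linked o u v).
  rewrite addn0; rewrite /num_clusters.
  suff -> : linked (add_edges o [fset [fset u; v]]%fset) = linked o by [].
  apply/funext => x; apply/funext => y; apply/propext; rewrite linked_add_edge.
  split; last by left.
  case=> [//|[[xu vy]|[xv uy]]]; first exact: (linked_trans (linked_trans xu uv)).
  exact: (linked_trans (linked_trans xv (linked_sym uv))).
rewrite /num_clusters /=; set o' := add_edges _ _.
pose tr o x := [fset y in V | `[< linked o x y >]]%fset.
have trP o1 x y : (y \in tr o1 x) = (y \in V) && `[< linked o1 x y >] by rewrite !inE.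
have trE o1 x y : linked o1 x y -> tr o1 x = tr o1 y.
  move=> xy; apply/fsetP => z; rewrite !trP; congr (_ && _); apply/asboolP/asboolP.
    exact/linked_trans/linked_sym.
  exact/linked_trans.
set C := (X in #|` X| = _); set C' := (X in _ = (#|` X| + _)%N).
have memC X : reflect (exists2 x, x \in V & X = tr o x) (X \in C) by exact: imfsetP.
have memC' X : reflect (exists2 x, x \in V & X = tr o' x) (X \in C') by exact: imfsetP.
have trC' x : ~ linked o x u -> ~ linked o x v -> tr o' x = tr o x.
  move=> xu xv; apply/fsetP => y; rewrite !trP; congr (_ && _).
  apply/asboolP/asboolP; rewrite linked_add_edge; last by left.
  by case=> [//|[[]|[]]].
have truv x : linked o x u \/ linked o x v -> tr o' x = (tr o u `|` tr o v)%fset.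
  move=> xuv; apply/fsetP => y; rewrite inE !trP -andb_orr; congr (_ && _).
  have tr1 := @linked_trans o; have sy := @linked_sym o; have rf := linked_refl o.
  apply/asboolP/orP.
    rewrite linked_add_edge => -[xy|[[_ vy]|[_ uy]]].
    - by case: xuv => [xu|xv]; [left|right]; apply/asboolP; apply: tr1 xy; apply: sy.
    - by right; apply/asboolP.
    - by left; apply/asboolP.
  rewrite linked_add_edge; case=> /asboolP h; case: xuv => xw.
  - by left; exact: tr1 h.
  - by right; right.
  - by right; left.
  - by left; exact: tr1 h.
have uu x : x \in V -> x \in tr o x by move=> xV; rewrite trP xV; apply/asboolP/linked_refl.
(* The traces of [u] and [v] are replaced by their union, the other traces stay. *)
have C'E : C' = ((tr o u `|` tr o v) |` (C `\ tr o u `\ tr o v))%fset.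
  apply/fsetP => X; rewrite !inE; apply/memC'/orP.
    move=> [x xV ->]; have [xu|xu] := pselect (linked o x u).
      by left; apply/eqP; apply: truv; left.
    have [xv|xv] := pselect (linked o x v).
      by left; apply/eqP; apply: truv; right.
    right; rewrite trC' //; apply/and3P; split; last by apply/memC; exists x.
      apply/eqP => E; have := uu _ vV; rewrite -E trP => /andP[_ /asboolP]; exact: xv.
    apply/eqP => E; have := uu _ uV; rewrite -E trP => /andP[_ /asboolP]; exact: xu.
  case=> [/eqP->|/and3P[/eqP Xv /eqP Xu /memC[x xV XE]]].
    by exists u => //; rewrite truv //; left; exact: linked_refl.
  exists x => //; rewrite trC' // => xw; [apply: Xu|apply: Xv];
    by rewrite XE; exact: trE.
have uvC : (tr o u `|` tr o v)%fset \notin (C `\ tr o u `\ tr o v)%fset.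
  rewrite !inE !negb_and !negbK; apply/orP; right; apply/orP; right.
  apply/memC => -[x xV E]; apply: nuv.
  have: u \in tr o x by rewrite -E inE uu.
  have: v \in tr o x by rewrite -E inE (uu v) // orbT.
  rewrite !trP => /andP[_ /asboolP xv] /andP[_ /asboolP xu].
  by apply: linked_trans xv; apply: linked_sym.
rewrite C'E cardfsU1 uvC.
have uC : tr o u \in C by apply/memC; exists u.
have vC : tr o v \in (C `\ tr o u)%fset.
  rewrite !inE; apply/andP; split; last by apply/memC; exists v.
  apply/eqP => E; have := uu _ vV; rewrite E trP => /andP[_ /asboolP]; exact: nuv.
by rewrite (cardfsD1 (tr o u)) uC (cardfsD1 (tr o v) (C `\ _)%fset) vC addnC.
Qed.

Definition inner_pairs V A := forall e, e \in A ->
  exists u v, [/\ u \in V, v \in V & e = [fset u; v]%fset].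

Lemma inner_pairsS V A A' : (A' `<=` A)%fset -> inner_pairs V A -> inner_pairs V A'.
Proof. by move=> /fsubsetP s h e /s /h. Qed.

(** An edge that merges two clusters of the larger configuration also merges two clusters of the
    smaller one: the number of clusters is supermodular. With q >= 1 this yields the lattice
    condition for the weights. *)
Lemma num_clusters_submod o1 o2 V A : (forall e, o1 e -> o2 e) ->
  inner_pairs V A ->
  (num_clusters o2 V + num_clusters (add_edges o1 A) V <=
   num_clusters o1 V + num_clusters (add_edges o2 A) V)%N.
Proof.
move=> o12; elim/fset1U_rect: A => [|e A eA IH] inA.
  by rewrite !add_edges0 addnC.
have {IH} := IH (inner_pairsS (fsubsetU1 _ _) inA).
have [u [v [uV vV ->]]] := inA e (fset1U1 _ _).
rewrite ![([fset [fset u; v]] `|` A)%fset]fsetUC !add_edgesU.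
rewrite (num_clusters_add_edge (add_edges o1 A) uV vV).
rewrite (num_clusters_add_edge (add_edges o2 A) uV vV).
have : `[< linked (add_edges o1 A) u v >] ==> `[< linked (add_edges o2 A) u v >].
  apply/implyP => /asboolP l1; apply/asboolP; apply: linked_mono l1 => f.
  by rewrite /add_edges => /orP[/o12->//|->]; rewrite orbT.
by case: (`[< _ >]); case: (`[< _ >]) => //= _; rewrite ?addn0 ?addn1; lia.
Qed.

(** At each added edge the two configurations lose the same number of clusters, as they agree on
    whether its endpoints are linked. It is meant for explored bonds, which do not help to link
    unexplored sites. *)
Lemma num_clusters_eq_incr o1 o2 V A : inner_pairs V A ->
  (forall A' u v, (A' `<=` A)%fset -> [fset u; v]%fset \in A ->
     linked (add_edges o1 A') u v <-> linked (add_edges o2 A') u v) ->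
  (num_clusters o2 V + num_clusters (add_edges o1 A) V =
   num_clusters o1 V + num_clusters (add_edges o2 A) V)%N.
Proof.
elim/fset1U_rect: A => [|e A eA IH] inA H.
  by rewrite !add_edges0 addnC.
have AeA : (A `<=` e |` A)%fset := fsubsetU1 _ _.
have {IH} := IH (inner_pairsS AeA inA).
have [u [v [uV vV E]]] := inA e (fset1U1 _ _).
have luv : `[< linked (add_edges o1 A) u v >] = `[< linked (add_edges o2 A) u v >].
  by apply/asbool_equiv_eq/H => //; rewrite -E fset1U1.
rewrite E ![([fset [fset u; v]] `|` A)%fset]fsetUC !add_edgesU.
rewrite (num_clusters_add_edge (add_edges o1 A) uV vV).
rewrite (num_clusters_add_edge (add_edges o2 A) uV vV) luv => IH.
suff {}/IH : forall A' u v, (A' `<=` A)%fset -> [fset u; v]%fset \in A ->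
     linked (add_edges o1 A') u v <-> linked (add_edges o2 A') u v by lia.
move=> A' a b A'A abA; apply: H; first exact: fsubset_trans AeA.
by rewrite inE abA orbT.
Qed.

End Clusters.

(** * Random cluster weights *)

Section FiniteRC.
Context {R : realType} {d : nat} {J : site d -> R} {q : R}.
Hypotheses (J_ge0 : forall x, 0 <= J x) (q_ge1 : 1 <= q).
Implicit Types (b : R) (o : edge d -> bool) (L : {fset site d}).
Implicit Types (A B E : {fset edge d}) (f g : {fset edge d} -> R) (e : edge d).

Lemma p_open_ge0 b e : 0 <= b -> 0 <= p_open J b e.
Proof.
move=> b0; rewrite /p_open subr_ge0 -expR0 ler_expR oppr_le0.
by rewrite !mulr_ge0 // /edge_coupling.
Qed.

Lemma p_open_lt1 b e : 0 < 1 - p_open J b e.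
Proof. by rewrite /p_open opprB addrC subrK expR_gt0. Qed.

Lemma p_open_le b b' e : b <= b' -> p_open J b e <= p_open J b' e.
Proof.
move=> bb; rewrite /p_open lerD2l lerN2 ler_expR lerN2.
by rewrite ler_wpM2r // ?ler_wpM2l // /edge_coupling.
Qed.

Definition edge_weight b E A : R :=
  \prod_(e <- E) (if e \in A then p_open J b e else 1 - p_open J b e).

Lemma edge_weight_ge0 b E A : 0 <= b -> 0 <= edge_weight b E A.
Proof.
move=> b0; apply: prodr_ge0 => e _; case: ifP => _; first exact: p_open_ge0.
exact/ltW/p_open_lt1.
Qed.

Lemma edge_weight0_gt0 b E : 0 < edge_weight b E fset0.
Proof. by apply: prodr_gt0 => e _; rewrite ?in_fset0 p_open_lt1. Qed.

Lemma edge_weight_lattice b b' E A B : 0 <= b -> b <= b' ->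
  edge_weight b E A * edge_weight b' E B <=
  edge_weight b' E (A `|` B)%fset * edge_weight b E (A `&` B)%fset.
Proof.
move=> b0 bb; rewrite -!big_split /=; apply: ler_prod => e _.
have p0 := p_open_ge0 e b0; have p1 := p_open_lt1 b e.
have p0' := p_open_ge0 e (le_trans b0 bb); have p1' := p_open_lt1 b' e.
have pp := p_open_le e bb.
rewrite !inE; case: (e \in A); case: (e \in B) => /=; apply/andP; split; nra.
Qed.

Lemma edge_weight_disjoint b E A B : [disjoint A & B]%fset ->
  edge_weight b E (A `|` B)%fset * edge_weight b E fset0 =
  edge_weight b E A * edge_weight b E B.
Proof.
move=> dAB; rewrite -!big_split /=; apply: eq_bigr => e _.
move: dAB; rewrite -fsetI_eq0 => /eqP/fsetP/(_ e).
by rewrite !inE; case: (e \in A); case: (e \in B) => //= _; rewrite mulrC.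
Qed.

Lemma inner_bondsP L e : e \in inner_bonds J L -> exists u v,
  [/\ u \in L, v \in L & e = [fset u; v]%fset].
Proof.
rewrite !inE /= fpowersetE => /andP[/fsubsetP eL /andP[/eqP/cardfs2_ex[u [v [_ E]]] _]].
by exists u, v; split => //; apply: eL; rewrite E ?fset21 ?fset22.
Qed.

Lemma inner_pairs_bonds L A : (A `<=` inner_bonds J L)%fset -> inner_pairs L A.
Proof. by move=> /fsubsetP AL e /AL/inner_bondsP. Qed.

(** Here [o] is the set of open edges outside [L]. Conditioning on the bonds of [B] being closed is
    kept as a factor of the weight, so that conditioned measures are handled like unconditioned
    ones. *)
Definition conf_weight b L o B A : R :=
  rc_weight J q b (inner_bonds J L) A (num_clusters (add_edges o A) L)
  * ([disjoint A & B]%fset)%:R.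

Definition rc_sum b L o B f : R :=
  \sum_(A <- fpowerset (inner_bonds J L)) conf_weight b L o B A * f A.

Let q_gt0 : 0 < q. Proof. exact: lt_le_trans q_ge1. Qed.

Lemma conf_weightE b L o B A : conf_weight b L o B A =
  edge_weight b (inner_bonds J L) A * q ^+ num_clusters (add_edges o A) L
  * ([disjoint A & B]%fset)%:R.
Proof. by []. Qed.

Lemma conf_weight_ge0 b L o B A : 0 <= b -> 0 <= conf_weight b L o B A.
Proof.
move=> b0; rewrite conf_weightE !mulr_ge0 ?edge_weight_ge0 //.
by rewrite exprn_ge0 // ltW.
Qed.

Lemma conf_weight0_gt0 b L o B : 0 < conf_weight b L o B fset0.
Proof.
rewrite conf_weightE fdisjoint0X mulr1 mulr_gt0 ?exprn_gt0 //.
exact: edge_weight0_gt0.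
Qed.

Lemma rc_sum_ge0 b L o B f : 0 <= b -> (forall A, 0 <= f A) -> 0 <= rc_sum b L o B f.
Proof. by move=> b0 f0; apply: sumr_ge0 => A _; rewrite mulr_ge0 ?conf_weight_ge0. Qed.

Lemma ler_rc_sum b L o B f g : 0 <= b ->
  (forall A, (A `<=` inner_bonds J L)%fset -> f A <= g A) ->
  rc_sum b L o B f <= rc_sum b L o B g.
Proof.
move=> b0 fg; rewrite /rc_sum big_seq [leRHS]big_seq; apply: ler_sum => A.
by rewrite fpowersetE => AL; rewrite ler_wpM2l ?conf_weight_ge0 ?fg.
Qed.

Lemma rc_sum1_gt0 b L o B : 0 <= b -> 0 < rc_sum b L o B (fun=> 1).
Proof.
move=> b0; rewrite /rc_sum (big_fsetD1 fset0) ?fpowersetE ?fsub0set //=.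
rewrite mulr1 ltr_wpDr ?conf_weight0_gt0 //.
by apply: sumr_ge0 => A _; rewrite mulr1 conf_weight_ge0.
Qed.

(** The same bonds, those of [A] outside [A'], lead from the intersection to [A] and from [A'] to
    the union, so supermodularity applies. Inverse temperature, exterior and closed set vary
    together: a single inequality covers all the comparisons between measures. *)
Lemma conf_weight_lattice b b' L o o' B B' A A' : 0 <= b -> b <= b' ->
  (forall e, o e -> o' e) -> (B' `<=` B)%fset ->
  (A `<=` inner_bonds J L)%fset ->
  conf_weight b L o B A * conf_weight b' L o' B' A' <=
  conf_weight b' L o' B' (A `|` A')%fset * conf_weight b L o B (A `&` A')%fset.
Proof.
move=> b0 bb oo BB AL; have b0' := le_trans b0 bb.
have [dA|ndA] := boolP [disjoint A & B]%fset; last first.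
  by rewrite {1}/conf_weight (negPf ndA) mulr0 mul0r mulr_ge0 ?conf_weight_ge0.
have [dA'|ndA'] := boolP [disjoint A' & B']%fset; last first.
  by rewrite {2}/conf_weight (negPf ndA') !mulr0 mulr_ge0 ?conf_weight_ge0.
have dU : [disjoint A `|` A' & B']%fset.
  by rewrite fdisjointUX dA' andbT; apply: fdisjointWr dA.
have dI : [disjoint A `&` A' & B]%fset by apply: fdisjointWl dA; exact: fsubsetIl.
rewrite !conf_weightE dA dA' dU dI !mulr1 mulrACA [leRHS]mulrACA.
apply: ler_pM; rewrite ?mulr_ge0 ?edge_weight_ge0 ?exprn_ge0 ?(ltW q_gt0) //.
  exact: edge_weight_lattice.
rewrite -!exprD ler_weXn2l //.
have AE : add_edges o A = add_edges (add_edges o (A `&` A')%fset) (A `\` A')%fset.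
  by rewrite -add_edgesU fsetID.
have A'E : add_edges o' (A `|` A')%fset = add_edges (add_edges o' A') (A `\` A')%fset.
  rewrite -add_edgesU; congr (add_edges _ _); apply/fsetP => e; rewrite !inE.
  by case: (e \in A); case: (e \in A').
rewrite AE A'E addnC [leqRHS]addnC; apply: num_clusters_submod.
  by move=> e; rewrite /add_edges !inE => /orP[/oo->//|/andP[_ ->]]; rewrite orbT.
by apply: inner_pairs_bonds; apply: fsubset_trans AL; exact: fsubsetDl.
Qed.

Lemma rc_four_functions b b' L o o' B B' f1 f2 f3 f4 : 0 <= b -> b <= b' ->
  (forall e, o e -> o' e) -> (B' `<=` B)%fset ->
  (forall A, 0 <= f1 A) -> (forall A, 0 <= f2 A) ->
  (forall A, 0 <= f3 A) -> (forall A, 0 <= f4 A) ->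
  (forall A A', (A `<=` inner_bonds J L)%fset -> (A' `<=` inner_bonds J L)%fset ->
     f1 A * f2 A' <= f3 (A `|` A')%fset * f4 (A `&` A')%fset) ->
  rc_sum b L o B f1 * rc_sum b' L o' B' f2 <=
  rc_sum b' L o' B' f3 * rc_sum b L o B f4.
Proof.
move=> b0 bb oo BB p1 p2 p3 p4 H; have b0' := le_trans b0 bb.
have w0 := conf_weight_ge0; apply: four_functions => [A|A|A|A|A A' AL AL'];
  try by apply: mulr_ge0; rewrite ?w0 //.
rewrite mulrACA [leRHS]mulrACA ler_pM //; try by apply: mulr_ge0; rewrite ?w0 //.
  exact: conf_weight_lattice.
exact: H.
Qed.

Lemma mulr_rearrange (w12 w0 w1 w2 q12 q0 q1 q2 a1 a2 : R) :
  w12 * w0 = w1 * w2 -> q12 * q0 = q2 * q1 ->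
  w12 * q12 * (a1 * a2) * (w0 * q0) = w2 * q2 * a2 * (w1 * q1 * a1).
Proof.
move=> wE qE; transitivity ((w12 * w0) * (q12 * q0) * (a1 * a2)); first by ring.
by rewrite wE qE; ring.
Qed.

(** * Exploration of the clusters coming from outside [L] *)

Section Exploration.
Context (b : R) (L : {fset site d}) (o : edge d -> bool) (B : {fset edge d}).
Hypothesis b0 : 0 <= b.
Hypothesis o_out : forall e, o e -> exists2 z, z \in e & z \notin L.

Let E := inner_bonds J L.
Let none : edge d -> bool := fun=> false.

Definition outward A v := exists2 z, z \notin L & linked (add_edges o A) v z.

Definition unexplored A : {fset site d} := [fset v in L | ~~ `[< outward A v >]]%fset.

Lemma unexploredP A v : reflect (v \in L /\ ~ outward A v) (v \in unexplored A).
Proof.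
rewrite !inE; apply: (iffP andP) => -[vL h]; split => //; first by move/asboolPn: h.
exact/asboolPn.
Qed.

Definition inside U : {fset edge d} := [fset e in E | (e `<=` U)%fset]%fset.

Lemma in_inside U e : (e \in inside U) = (e \in E) && (e `<=` U)%fset.
Proof. by rewrite !inE. Qed.

Lemma in_outside U e : (e \in E `\` inside U)%fset = (e \in E) && ~~ (e `<=` U)%fset.
Proof. by rewrite in_fsetD in_inside; case: (e \in E); rewrite ?andbT ?andbF. Qed.

(** A bond leaving [U] would link a site of [U] to an explored site or to the complement of [L], so
    a path started in [U] can only use the bonds of [A']. *)
Lemma linked_unexplored A2 A' U u w : (A2 `<=` E `\` inside U)%fset ->
  (A' `<=` inside U)%fset -> unexplored A2 = U -> u \in U ->
  linked (add_edges (add_edges o A2) A') u w -> w \in U /\ linked (add_edges none A') u w.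
Proof.
move=> /fsubsetP A2E /fsubsetP A'E UE uU; move: w.
apply: linked_ind => [|v w _ [vU uv]]; first by split=> //; exact: linked_refl.
have [vL vno] : v \in L /\ ~ outward A2 v by apply/unexploredP; rewrite UE.
rewrite {1}/add_edges => /orP[|vw].
  move=> vw; exfalso; apply: vno; case/orP: (vw) => [/o_out[z]|/A2E].
    rewrite !inE => /orP[]/eqP->; first by rewrite vL.
    by move=> wL; exists w => //; exact: linked1.
  rewrite in_outside => /andP[vwE /fsubsetP vwU].
  have wU : w \notin U.
    by apply/negP => wU; apply: vwU => y; rewrite !inE => /orP[]/eqP->.
  have /inner_bondsP[y [y' [yL y'L /fset2_inj yy]]] := vwE.
  have wL : w \in L by case: yy => -[_ ->].
  move: wU; rewrite -UE !inE wL /= negbK => /asboolP[z zL wz].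
  by exists z => //; apply: linked_trans wz; exact: linked1.
have := A'E _ vw; rewrite in_inside => /andP[_ /fsubsetP vwU]; split; first exact/vwU/fset22.
by apply: linked_trans uv _; apply: linked1.
Qed.

(** The unexplored set is a stopping set: bonds inside it join only sites that are not linked
    outward, so they have no effect on which sites are. *)
Lemma unexploredU A1 A2 U : (A1 `<=` inside U)%fset ->
  (A2 `<=` E `\` inside U)%fset ->
  (unexplored (A1 `|` A2)%fset == U) = (unexplored A2 == U).
Proof.
move=> A1E A2E.
have mono v : outward A2 v -> outward (A1 `|` A2)%fset v.
  move=> [z zL vz]; exists z => //; apply: linked_mono vz => e.
  by rewrite /add_edges inE => /orP[->//|->]; rewrite !orbT.
have swap : add_edges o (A1 `|` A2)%fset = add_edges (add_edges o A2) A1.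
  by rewrite -add_edgesU fsetUC.
suff H : unexplored (A1 `|` A2)%fset = U \/ unexplored A2 = U ->
    unexplored (A1 `|` A2)%fset = unexplored A2.
  by apply/eqP/eqP => h; [rewrite -(H (or_introl h))|rewrite (H (or_intror h))].
move=> h; apply/fsetP => v; apply/unexploredP/unexploredP => -[vL vno]; split => //.
  by move=> /mono.
move=> vo; apply: vno; case: h => UE.
  case: vo => z zL vz; exists z => //; apply: linked_sym.
  move: (linked_sym vz); move: v vL vz => v _ _; move: v.
  apply: linked_ind => [|u w zu zu2]; first exact: linked_refl.
  rewrite {1}swap {1}/add_edges => /orP[uw|uw].
    by apply: linked_trans zu2 _; exact: linked1.
  have /fsubsetP/(_ _ uw) := A1E; rewrite in_inside => /andP[_ /fsubsetP uwU].
  have : u \in U by apply/uwU/fset21.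
  rewrite -UE => /unexploredP[_ []]; exists z => //; exact: linked_sym.
have [//|vno] := pselect (outward A2 v).
have vU : v \in U by rewrite -UE; apply/unexploredP.
case: vo => z zL; rewrite swap => /(linked_unexplored A2E A1E UE vU)[zU _].
by move: zU zL; rewrite -UE => /unexploredP[->].
Qed.

(** Spatial Markov property in multiplied form: given the explored part [A2], the bonds inside [U]
    carry the free weight. The constant on the left is the free weight of the empty
    configuration. *)
Lemma conf_weight_unexplored A1 A2 U : (A1 `<=` inside U)%fset ->
  (A2 `<=` E `\` inside U)%fset -> unexplored A2 = U ->
  conf_weight b L o B (A1 `|` A2)%fset * conf_weight b L none fset0 fset0 =
  conf_weight b L o B A2 * conf_weight b L none B A1.
Proof.
move=> A1E A2E UE.
have A1L : (A1 `<=` E)%fset by apply: fsubset_trans A1E (fset_sub _ _).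
have d12 : [disjoint A1 & A2]%fset.
  rewrite fdisjoint_sym; apply: fdisjointWl A2E _; apply: fdisjointWr A1E _.
  by apply/fdisjointP => e; rewrite in_outside in_inside => /andP[_ /negPf->]; rewrite andbF.
have nE := num_clusters_eq_incr (o1 := none) (o2 := add_edges o A2)
  (inner_pairs_bonds A1L).
have {}nE := nE _; rewrite !conf_weightE fdisjointUX fdisjoint0X add_edges0 mulr1.
set dA1 := ([disjoint A1 & B]%fset); set dA2 := ([disjoint A2 & B]%fset).
rewrite (_ : (dA1 && dA2)%:R = dA1%:R * dA2%:R :> R); last by rewrite -natrM mulnb.
have qE : q ^+ num_clusters (add_edges o (A1 `|` A2)%fset) L * q ^+ num_clusters none L
   = q ^+ num_clusters (add_edges o A2) L * q ^+ num_clusters (add_edges none A1) L.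
  rewrite -!exprD nE; last first.
    move=> A' u v A'A uvA; have uU : u \in U.
      have /fsubsetP/(_ _ uvA) := A1E; rewrite in_inside => /andP[_ /fsubsetP uvU].
      by apply: uvU; rewrite fset21.
    split; first by apply: linked_mono => e; rewrite /add_edges /= => ->; rewrite orbT.
    by move=> /(linked_unexplored A2E (fsubset_trans A'A A1E) UE uU)[].
  by rewrite -add_edgesU fsetUC addnC.
have := edge_weight_disjoint b E d12; rewrite -/E => wE.
exact: mulr_rearrange.
Qed.

(** Realises the free model on [U] as the free model on [L] with the other bonds closed, so that all
    values of [U] are compared within one set of bonds. *)
Lemma rc_sum_inside U f : rc_sum b L none (B `|` (E `\` inside U))%fset f =
  \sum_(A <- fpowerset (inside U)) conf_weight b L none B A * f A.
Proof.
rewrite /rc_sum -/E; apply/esym.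
have sub : (fpowerset (inside U) `<=` fpowerset E)%fset by rewrite fpowersetS fset_sub.
rewrite -[RHS](big_fset_incl _ sub) => [|A]; last rewrite !fpowersetE; last first.
  move=> /fsubsetP AE /fsubsetPn[e eA eU]; rewrite conf_weightE fdisjointXU.
  rewrite [X in _ && X](_ : _ = false) ?andbF ?mulr0 ?mul0r //.
  by apply/negP => /fdisjointP/(_ _ eA); move: eU; rewrite in_outside in_inside AE //= => ->.
apply: eq_fbigr => A; rewrite fpowersetE => /fsubsetP AU _.
rewrite !conf_weightE fdisjointXU [X in _ && X](_ : _ = true) ?andbT //.
by apply/fdisjointP => e /AU; rewrite in_outside in_inside => /andP[-> ->].
Qed.

(** The sum is split according to the unexplored set [U]. When [x] is not linked outward, [f] is
    bounded by its value on the bonds inside [U], whose law is free; restoring the bonds outside [U]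
    can only raise the mean of the increasing [f]. *)
Lemma rc_sum_unexplored x f : (forall A, 0 <= f A) ->
  (forall A A', (A `<=` A')%fset -> f A <= f A') ->
  (forall A, (A `<=` E)%fset -> ~ outward A x ->
     f A <= f (A `&` inside (unexplored A))%fset) ->
  rc_sum b L o B (fun A => f A * (~~ `[< outward A x >])%:R)
    * rc_sum b L none B (fun=> 1)
  <= rc_sum b L o B (fun=> 1) * rc_sum b L none B f.
Proof.
move=> f0 fmono floc.
have part g : rc_sum b L o B g = \sum_(U <- fpowerset L)
    rc_sum b L o B (fun A => g A * (unexplored A == U)%:R).
  rewrite /rc_sum exchange_big /=; apply: eq_bigr => A _.
  rewrite (big_fsetD1 (unexplored A)) ?fpowersetE ?fset_sub //=.
  rewrite eqxx mulr1 big1_fset ?addr0 // => U; rewrite !inE => /andP[+ _] _.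
  by rewrite eq_sym => /negPf->; rewrite !mulr0.
rewrite part [X in _ <= X * _]part !mulr_suml; apply: ler_sum => U _.
set S2 := \sum_(A2 <- fpowerset (E `\` inside U)%fset)
   (unexplored A2 == U)%:R * conf_weight b L o B A2.
have S2_ge0 : 0 <= S2.
  by apply: sumr_ge0 => A _; rewrite mulr_ge0 ?ler0n ?conf_weight_ge0.
pose c := conf_weight b L none fset0 fset0.
have c_gt0 : 0 < c := conf_weight0_gt0 _ _ _ _.
have EU : (inside U `|` (E `\` inside U))%fset = E.
  by apply/fsetP => e; rewrite in_fsetU in_outside in_inside -andb_orr orbN andbT.
have dEU : [disjoint inside U & (E `\` inside U)]%fset.
  by apply/fdisjointP => e; rewrite in_outside in_inside => /andP[-> ->].
have split2 g : c * rc_sum b L o B g = \sum_(A1 <- fpowerset (inside U))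
    \sum_(A2 <- fpowerset (E `\` inside U)%fset)
      c * (conf_weight b L o B (A1 `|` A2)%fset * g (A1 `|` A2)%fset).
  by rewrite /rc_sum -/E -[in LHS]EU big_fpowersetU // mulr_sumr; apply: eq_bigr => A1 _; rewrite mulr_sumr.
have S1S2 g : rc_sum b L none (B `|` (E `\` inside U))%fset g * S2 =
   \sum_(A1 <- fpowerset (inside U)) \sum_(A2 <- fpowerset (E `\` inside U)%fset)
     (unexplored A2 == U)%:R * (conf_weight b L o B A2 * conf_weight b L none B A1 * g A1).
  rewrite rc_sum_inside mulr_suml; apply: eq_bigr => A1 _.
  by rewrite mulr_sumr; apply: eq_bigr => A2 _; ring.
rewrite -(ler_pM2l c_gt0) mulrA [leRHS]mulrA.
have -> : c * rc_sum b L o B (fun A => 1 * (unexplored A == U)%:R) =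
    rc_sum b L none (B `|` (E `\` inside U))%fset (fun=> 1) * S2.
  rewrite split2 S1S2; apply: eq_fbigr => A1; rewrite fpowersetE => A1E _.
  apply: eq_fbigr => A2; rewrite fpowersetE => A2E _; rewrite unexploredU //.
  case: eqP => [UE|_]; last by rewrite !(mulr0, mul0r).
  by rewrite -(conf_weight_unexplored A1E A2E UE) /c; ring.
have le1 : c * rc_sum b L o B (fun A => f A * (~~ `[< outward A x >])%:R * (unexplored A == U)%:R)
   <= rc_sum b L none (B `|` (E `\` inside U))%fset f * S2.
  rewrite split2 S1S2 big_seq [leRHS]big_seq; apply: ler_sum => A1.
  rewrite fpowersetE => A1E; rewrite big_seq [leRHS]big_seq; apply: ler_sum => A2.
  rewrite fpowersetE => A2E; rewrite unexploredU //.
  case: eqP => [UE|_]; last by rewrite !(mulr0, mul0r).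
  rewrite mul1r -(conf_weight_unexplored A1E A2E UE) -/c !mulr1.
  rewrite mulrA [c * _]mulrC; apply: ler_wpM2l.
    by apply: mulr_ge0; rewrite ?conf_weight_ge0 // ltW.
  have [xo|xno] := asboolP (outward _ x); first by rewrite mulr0 f0.
  have A12 : (A1 `|` A2 `<=` E)%fset by rewrite -EU fsetUSS.
  rewrite mulr1 (le_trans (floc _ A12 xno)) // fmono //.
  have /eqP-> : unexplored (A1 `|` A2)%fset == U by rewrite unexploredU //; exact/eqP.
  apply/fsubsetP => e; rewrite in_fsetI in_fsetU => /andP[/orP[//|eA2] eU].
  have /fsubsetP/(_ _ eA2) := A2E; move: eU; rewrite in_outside in_inside.
  by move=> /andP[-> ->].
apply: (le_trans (ler_wpM2r _ le1)); first by rewrite rc_sum_ge0.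
rewrite mulrAC [leRHS]mulrAC ler_wpM2r // [leRHS]mulrC.
(* The same model on both sides, except that one has the bonds not inside [U] closed. *)
apply: rc_four_functions => // [|A A' _ _]; first exact: fsubsetUl.
by rewrite !mulr1 fmono // fsubsetUl.
Qed.

End Exploration.

End FiniteRC.

(** * Finite-volume measures *)

Section FiniteVolume.
Context {R : realType} {d : nat} {J : site d -> R} {q : R}.
Hypotheses (J_ge0 : forall x, 0 <= J x) (q_ge1 : 1 <= q).
Implicit Types (b : R) (L : {fset site d}) (eta : config J).
Implicit Types (A B : {fset edge d}) (e : edge d) (F G : set (config J)).
Implicit Types (S : set (edge d)) (x y z : site d).

Definition increasing F := forall w w' : config J,
  (forall e : bond J, w e -> w' e) -> F w -> F w'.

Definition closed_on S : set (config J) :=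
  [set w | forall e : bond J, S (val e) -> w e = false].

Definition edge_open e : set (config J) := [set w | is_open w e].

Lemma is_openP (w : config J) (e : bond J) : is_open w (val e) = w e.
Proof. by rewrite /is_open valK. Qed.

Lemma is_open_bond (w : config J) e : is_open w e -> is_bond J e.
Proof. by rewrite /is_open; case: insubP. Qed.

Lemma is_open_mono (w w' : config J) : (forall e : bond J, w e -> w' e) ->
  forall e, is_open w e -> is_open w' e.
Proof. by move=> ww e; rewrite /is_open; case: insubP => //= e' _ _; exact: ww. Qed.

Lemma edge_open_increasing e : increasing (edge_open e).
Proof. by move=> w w' ww; exact: is_open_mono. Qed.

Lemma connects_increasing (X Y : set (site d)) : increasing (connects X Y).
Proof.
move=> w w' ww [x [y [Xx Yy xy]]]; exists x, y; split => //.
by apply: linked_mono xy; exact: is_open_mono.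
Qed.

Lemma edge_closedE (e : bond J) : closed_on [set val e] = ~` edge_open (val e).
Proof.
apply/seteqP; split=> w /=; rewrite /edge_open /= is_openP => h; first by rewrite h.
by move=> e' /val_inj ->; apply/negbTE/negP.
Qed.

Lemma closed_onU S S' : closed_on (S `|` S') = closed_on S `&` closed_on S'.
Proof.
apply/seteqP; split=> w /=.
  by move=> h; split=> e Se; apply: h; [left|right].
by move=> [h h'] e [/h|/h'].
Qed.

Lemma inner_bond L e : e \in inner_bonds J L -> is_bond J e.
Proof. by rewrite !inE => /andP[]. Qed.

Lemma mem_inner_bonds L e : (e \in inner_bonds J L) = (e `<=` L)%fset && is_bond J e.
Proof. by rewrite !inE /= fpowersetE. Qed.

Definition outer_open L eta : edge d -> bool := is_open (glue_config L eta fset0).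

Lemma is_open_glue L eta A : (A `<=` inner_bonds J L)%fset ->
  is_open (glue_config L eta A) = add_edges (outer_open L eta) A.
Proof.
move=> /fsubsetP AL; apply/funext => e; rewrite /outer_open /is_open /add_edges.
case: insubP => [e' _ <-|ne] /=.
  by rewrite /glue_config; case: ifP => // /negP h; rewrite (_ : _ \in A = false) ?orbF //; apply/negP => /AL.
by apply/esym/negP => /AL/inner_bond; rewrite (negPf ne).
Qed.

Lemma outer_open_out L eta e : outer_open L eta e -> exists2 z, z \in e & z \notin L.
Proof.
rewrite /outer_open => h; have be := is_open_bond h; move: h.
rewrite /is_open insubT /= /glue_config; case: ifP => //=.
by rewrite mem_inner_bonds be andbT => /negbT/fsubsetPn[z ze zL] _; exists z.
Qed.

Lemma outer_open_mono L eta eta' : (forall e : bond J, eta e -> eta' e) ->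
  forall e, outer_open L eta e -> outer_open L eta' e.
Proof.
move=> ee; apply: is_open_mono => e; rewrite /glue_config.
by case: ifP => // _; exact: ee.
Qed.

Lemma outer_open_false L : outer_open L (fun=> false) = fun=> false.
Proof.
apply/funext => e; rewrite /outer_open /is_open; case: insubP => //= e' _ _.
by rewrite /glue_config; case: ifP.
Qed.

Lemma glue_config_mono L eta eta' A A' : (forall e : bond J, eta e -> eta' e) ->
  (A `<=` A')%fset ->
  forall e : bond J, glue_config L eta A e -> glue_config L eta' A' e.
Proof.
by move=> ee /fsubsetP AA e; rewrite /glue_config; case: ifP => _; [exact: AA|exact: ee].
Qed.

Definition ind L eta F A : R := \1_F (glue_config L eta A).

Lemma ind_ge0 L eta F A : 0 <= ind L eta F A.
Proof. by rewrite /ind indicE ler0n. Qed.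

Lemma ler_ind L eta eta' F G A A' :
  (F (glue_config L eta A) -> G (glue_config L eta' A')) ->
  ind L eta F A <= ind L eta' G A'.
Proof.
move=> FG; rewrite /ind !indicE; case: (boolP (_ \in F)) => [/set_mem/FG h|_].
  by rewrite (mem_set h).
exact: ler0n.
Qed.

Lemma ind_mono L eta eta' F A A' : increasing F -> (forall e : bond J, eta e -> eta' e) ->
  (A `<=` A')%fset -> ind L eta F A <= ind L eta' F A'.
Proof.
by move=> Fi ee AA; apply: ler_ind; apply: Fi; exact: glue_config_mono.
Qed.

(* The measure in L with boundary condition eta, given that B is closed. *)
Definition rc_closed b L eta B F : R :=
  rc_sum (J := J) (q := q) b L (outer_open L eta) B (ind L eta F)
  / rc_sum (J := J) (q := q) b L (outer_open L eta) B (fun=> 1).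

Lemma rc_finiteE b L eta F : rc_finite q b L eta F = rc_closed b L eta fset0 F.
Proof.
have W A : A \in fpowerset (inner_bonds J L) ->
    rc_finite_weight q b L eta A = conf_weight (J := J) (q := q) b L (outer_open L eta) fset0 A.
  rewrite fpowersetE => AL; rewrite /rc_finite_weight /conf_weight is_open_glue //.
  by rewrite fdisjointX0 mulr1.
rewrite /rc_finite /rc_closed /rc_sum; congr (_ / _).
  by apply: eq_fbigr => A AL _; rewrite W.
by apply: eq_fbigr => A AL _; rewrite W // mulr1.
Qed.

Section Fixed.
Context (b : R) (L : {fset site d}).
Hypothesis b0 : 0 <= b.

Lemma rc_part_gt0 eta B :
  0 < rc_sum (J := J) (q := q) b L (outer_open L eta) B (fun=> 1).
Proof. exact: rc_sum1_gt0. Qed.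

Lemma rc_closed_ge0 eta B F : 0 <= rc_closed b L eta B F.
Proof.
apply: divr_ge0; last exact/ltW/rc_part_gt0.
by apply: rc_sum_ge0 => // A; exact: ind_ge0.
Qed.

Lemma rc_closed_le eta B F G : (forall w, F w -> G w) ->
  rc_closed b L eta B F <= rc_closed b L eta B G.
Proof.
move=> FG; rewrite ler_pdivrMr ?rc_part_gt0 // divfK ?gt_eqF ?rc_part_gt0 //.
by apply: ler_rc_sum => // A _; apply: ler_ind => /FG.
Qed.

Lemma rc_closed_setT eta B : rc_closed b L eta B setT = 1.
Proof.
rewrite /rc_closed (_ : ind L eta setT = fun=> 1) ?divff ?gt_eqF ?rc_part_gt0 //.
by apply/funext => A; rewrite /ind indicT.
Qed.

Lemma rc_closed_setU eta B F G :
  rc_closed b L eta B (F `|` G) <= rc_closed b L eta B F + rc_closed b L eta B G.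
Proof.
rewrite -mulrDl ler_wpM2r ?invr_ge0 ?(ltW (rc_part_gt0 _ _)) // -big_split /=.
apply: ler_sum => A _; rewrite -mulrDr ler_wpM2l ?conf_weight_ge0 //.
by rewrite /ind !indicE in_setU; do 2!case: (_ \in _); rewrite ?(addr0, add0r) // lerDl.
Qed.

Lemma rc_closed_setC eta B F :
  rc_closed b L eta B (~` F) = 1 - rc_closed b L eta B F.
Proof.
rewrite -(rc_closed_setT eta B) -mulrBl; congr (_ / _).
rewrite -sumrB; apply: eq_bigr => A _; rewrite -mulrBr; congr (_ * _).
by rewrite /ind !indicE in_setC in_setT; case: (_ \in _); rewrite ?subrr ?subr0.
Qed.

End Fixed.

(** Holley's comparison: after cross-multiplication, it is the four functions inequality for the
    indicator of [F] and the constant 1. *)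
Lemma rc_closed_mono b b' L eta eta' B B' F : 0 <= b -> b <= b' ->
  (forall e : bond J, eta e -> eta' e) -> (B' `<=` B)%fset -> increasing F ->
  rc_closed b L eta B F <= rc_closed b' L eta' B' F.
Proof.
move=> b0 bb ee BB Fi; have b0' := le_trans b0 bb.
rewrite ler_pdivrMr ?rc_part_gt0 // mulrAC ler_pdivlMr ?rc_part_gt0 //.
apply: rc_four_functions => //; first exact: outer_open_mono.
by move=> A A' _ _; rewrite !mulr1; apply: ind_mono => //; exact: fsubsetUl.
Qed.

Lemma rc_finite_FKG b L eta F G : 0 <= b -> increasing F -> increasing G ->
  rc_finite q b L eta F * rc_finite q b L eta G <= rc_finite q b L eta (F `&` G).
Proof.
move=> b0 Fi Gi; rewrite !rc_finiteE /rc_closed.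
have Z0 := rc_part_gt0 L b0 eta fset0.
rewrite mulrACA -invfM ler_pdivrMr ?mulr_gt0 // mulrA mulfVK ?gt_eqF //.
apply: rc_four_functions => //; try by move=> A; exact: ind_ge0.
move=> A A' _ _; rewrite mulr1.
have -> : ind L eta (F `&` G) (A `|` A')%fset =
   ind L eta F (A `|` A')%fset * ind L eta G (A `|` A')%fset.
  by rewrite /ind !indicE in_setI -natrM mulnb.
by apply: ler_pM; rewrite ?ind_ge0 // ind_mono // ?fsubsetUl ?fsubsetUr.
Qed.

Definition closed_inside L S : {fset edge d} :=
  [fset e in inner_bonds J L | `[< S e >]]%fset.

Lemma in_closed_inside L S e :
  (e \in closed_inside L S) = (e \in inner_bonds J L) && `[< S e >].
Proof. by rewrite !inE. Qed.

Lemma ind_closed_on L eta F S A : (A `<=` inner_bonds J L)%fset ->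
  ind L eta (F `&` closed_on (S `&` [set e | e \in inner_bonds J L])) A =
  ind L eta F A * ([disjoint A & closed_inside L S]%fset)%:R.
Proof.
move=> /fsubsetP AL; rewrite /ind !indicE in_setI -natrM mulnb; congr (nat_of_bool (_ && _))%:R.
apply/idP/fdisjointP => [/set_mem h e eA|h].
  apply/negP; rewrite in_closed_inside => /andP[eL /asboolP Se].
  have be := inner_bond (AL _ eA); have := h (exist _ e be) (conj Se (AL _ eA)).
  by rewrite /glue_config /= (AL _ eA) eA.
apply/mem_set => e [Se eL]; rewrite /glue_config ifT //; apply/negbTE/negP => eA.
by have /negP := h _ eA; apply; rewrite in_closed_inside; apply/andP; split=> //; exact/asboolP.
Qed.

(** The closed-set factor of the weights is the indicator of the conditioning event, so [rc_closed]
    is the conditional measure. *)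
Lemma rc_finite_closed_on b L eta F S : 0 <= b ->
  rc_finite q b L eta (F `&` closed_on (S `&` [set e | e \in inner_bonds J L])) =
  rc_closed b L eta (closed_inside L S) F *
  rc_finite q b L eta (closed_on (S `&` [set e | e \in inner_bonds J L])).
Proof.
move=> b0; rewrite !rc_finiteE /rc_closed.
have E G : rc_sum (J := J) (q := q) b L (outer_open L eta) fset0
    (ind L eta (G `&` closed_on (S `&` [set e | e \in inner_bonds J L]))) =
    rc_sum (J := J) (q := q) b L (outer_open L eta) (closed_inside L S) (ind L eta G).
  apply: eq_fbigr => A; rewrite fpowersetE => AL _; rewrite ind_closed_on //.
  by rewrite [ind L eta G A * _]mulrC mulrA; congr (_ * _); rewrite /conf_weight fdisjointX0 mulr1.
have := E setT; rewrite setTI => ->; rewrite E.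
rewrite (_ : ind L eta setT = fun=> 1); last first.
  by apply/funext => A; rewrite /ind indicT.
by rewrite mulrA mulfVK ?gt_eqF ?rc_part_gt0.
Qed.

End FiniteVolume.

(** * Influence of the boundary condition *)

Section Influence.
Context {R : realType} {d : nat} {J : site d -> R} {q : R}.
Hypotheses (J_ge0 : forall x, 0 <= J x) (q_ge1 : 1 <= q).
Implicit Types (b : R) (L : {fset site d}) (eta : config J).
Implicit Types (A B : {fset edge d}) (e : edge d) (F G : set (config J)).
Implicit Types (x y z : site d).

Local Notation rc_closed := (rc_closed (J := J) (q := q)).

(** [A] is split into the bonds inside its own unexplored set and the others. By [unexploredU] the
    others alone leave the same set unexplored, which puts the path in the situation of
    [linked_unexplored]. *)
Lemma linked_unexplored_self L (o : edge d -> bool) A x w :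
  (forall e, o e -> exists2 z, z \in e & z \notin L) ->
  (A `<=` inner_bonds J L)%fset -> x \in L -> ~ outward L o A x ->
  linked (add_edges o A) x w ->
  w \in unexplored L o A /\
  linked (add_edges (fun=> false) (A `&` inside (J := J) L (unexplored L o A))%fset) x w.
Proof.
move=> o_out AE xL xno; set U := unexplored L o A; set I := inside L U.
have A1I : (A `&` I `<=` I)%fset by exact: fsubsetIr.
have A2I : (A `\` I `<=` inner_bonds J L `\` I)%fset by exact: fsetSD.
have UE : unexplored L o (A `\` I)%fset = U.
  by apply/eqP; rewrite -(unexploredU o_out A1I A2I) fsetID.
have xU : x \in U by apply/unexploredP.
rewrite -[A in linked (_ A)](fsetID I) fsetUC add_edgesU.
exact: (linked_unexplored o_out A2I A1I UE xU).
Qed.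

Definition escapes L x : set (config J) := connects [set x] (~` [set y | y \in L]).

Lemma escapesP L eta A x : (A `<=` inner_bonds J L)%fset ->
  escapes L x (glue_config L eta A) <-> outward L (outer_open L eta) A x.
Proof.
move=> AL; rewrite /escapes /connects /= is_open_glue //; split.
  by move=> [_ [z [-> /negP zL xz]]]; exists z.
by move=> [z /negP zL xz]; exists x, z.
Qed.

Section Gap.
Context (b : R) (L : {fset site d}) (eta : config J) (B : {fset edge d}).
Context (F : set (config J)) (x : site d).
Hypotheses (b0 : 0 <= b) (F_incr : increasing F).
Hypothesis F_local : forall A, (A `<=` inner_bonds J L)%fset ->
  F (glue_config L eta A) -> ~ outward L (outer_open L eta) A x ->
  F (glue_config L (fun=> false)
       (A `&` inside (J := J) L (unexplored L (outer_open L eta) A))%fset).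

(* Given the clusters coming from outside L, the rest of L carries a free measure. *)
Lemma rc_closed_not_escapes :
  rc_closed b L eta B (F `&` ~` escapes L x) <= rc_closed b L (fun=> false) B F.
Proof.
rewrite ler_pdivrMr ?rc_part_gt0 // mulrAC ler_pdivlMr ?rc_part_gt0 //.
rewrite outer_open_false.
pose f := ind L (fun=> false) F.
have sub A : (A `&` inside (J := J) L (unexplored L (outer_open L eta) A) `<=` A)%fset.
  exact: fsubsetIl.
have key : rc_sum (J := J) (q := q) b L (outer_open L eta) B
     (fun A => f A * (~~ `[< outward L (outer_open L eta) A x >])%:R) *
   rc_sum (J := J) (q := q) b L (fun=> false) B (fun=> 1) <=
   rc_sum (J := J) (q := q) b L (outer_open L eta) B (fun=> 1) *
   rc_sum (J := J) (q := q) b L (fun=> false) B f.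
  apply: rc_sum_unexplored => //.
  - exact: outer_open_out.
  - by move=> A A' AA; apply: ind_mono.
  - move=> A AL xe; apply: ler_ind => FA; apply: (F_local AL _ xe).
    by apply: F_incr FA; exact: glue_config_mono.
rewrite [leRHS]mulrC; apply: le_trans key.
apply: ler_wpM2r; first exact/ltW/rc_sum1_gt0.
apply: ler_rc_sum => // A AL; rewrite /f /ind !indicE in_setI in_setC.
have [Fe|_] := boolP (glue_config L eta A \in F); last first.
  by rewrite mulr_ge0 ?ler0n.
have [ne|/asboolPn xe] := boolP (`[< outward L (outer_open L eta) A x >]).
  by rewrite (mem_set ((escapesP eta x AL).2 (asboolW ne))) ?mulr0.
have Ff := F_local AL (set_mem Fe) xe.
have h (e : bond J) : false -> false by [].
by rewrite (mem_set (F_incr (glue_config_mono h (sub A)) Ff)) //= mul1r; case: (_ \in _).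
Qed.

Lemma rc_closed_gap :
  rc_closed b L eta B F <=
  rc_closed b L (fun=> false) B F + rc_closed b L eta B (escapes L x).
Proof.
apply: (le_trans _ (lerD rc_closed_not_escapes (lexx _))).
apply: (le_trans _ (rc_closed_setU J_ge0 q_ge1 L b0 eta B _ _)).
apply: rc_closed_le => // w Fw; have [|] := pselect (escapes L x w); first by right.
by left.
Qed.

End Gap.

Lemma edge_open_glue L eta A e : e \in inner_bonds J L ->
  edge_open e (glue_config L eta A) = (e \in A) :> Prop.
Proof.
move=> eL; rewrite /edge_open /= /is_open insubT ?(inner_bond eL) //= => be.
by rewrite /glue_config /= eL.
Qed.

(** An open bond at [x] has both endpoints in the cluster of [x], which is unexplored unless [x] is
    linked outward. This is the locality required of the event. *)
Lemma rc_closed_gap_edge b L eta B e x : 0 <= b -> e \in inner_bonds J L -> x \in e ->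
  rc_closed b L eta B (edge_open e) <=
  rc_closed b L (fun=> false) B (edge_open e) + rc_closed b L eta B (escapes L x).
Proof.
move=> b0 eL xe; apply: rc_closed_gap => //; first exact: edge_open_increasing.
move=> A AL; rewrite !edge_open_glue // => eA xno; rewrite in_fsetI eA /=.
rewrite in_inside eL /=; have [u [v [uL vL eE]]] := inner_bondsP eL.
have lxy y : y \in e -> linked (add_edges (outer_open L eta) A) x y.
  move: xe eA; rewrite eE !inE => /orP[]/eqP-> eA /orP[]/eqP->;
    try exact: linked_refl; apply: linked1; rewrite /add_edges ?eA ?orbT //.
  by rewrite fset2C eA orbT.
have xL : x \in L by move: xe; rewrite eE !inE => /orP[]/eqP->.
apply/fsubsetP => y /lxy xy.
by have [] := linked_unexplored_self (@outer_open_out _ _ _ L eta) AL xL xno xy.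
Qed.

Lemma rc_closed_gap_connects b L eta B x y : 0 <= b -> x \in L ->
  rc_closed b L eta B (connects [set x] [set y] `&` ~` escapes L x) <=
  rc_closed b L (fun=> false) B (connects [set x] [set y]).
Proof.
move=> b0 xL; apply: rc_closed_not_escapes => //; first exact: connects_increasing.
move=> A AL [_ [_ [-> ->]]]; rewrite is_open_glue // => xy xno; exists x, y; split => //.
rewrite is_open_glue; last by apply: fsubset_trans AL; exact: fsubsetIl.
rewrite outer_open_false.
by have [] := linked_unexplored_self (@outer_open_out _ _ _ L eta) AL xL xno xy.
Qed.

Lemma edge_weightU1 b E A e : e \in E -> e \notin A ->
  edge_weight (J := J) b E (e |` A)%fset * (1 - p_open J b e) =
  p_open J b e * edge_weight (J := J) b E A.
Proof.
move=> eE eA; rewrite /edge_weight !(big_fsetD1 e eE) /= fset1U1 (negPf eA).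
rewrite -mulrA [X in _ * X]mulrC; congr (_ * (_ * _)).
by apply: eq_fbigr => f; rewrite !inE => /andP[/negPf-> _] _.
Qed.

(** Configurations are paired according to the state of [e]. Opening [e] does not increase the
    number of clusters, so with q >= 1 the odds of being open are at most p_e / (1 - p_e). *)
Lemma rc_closed_edge_open b L eta B e : 0 <= b -> e \in inner_bonds J L ->
  rc_closed b L eta B (edge_open e) <= p_open J b e.
Proof.
move=> b0 eL; rewrite ler_pdivrMr ?rc_part_gt0 //.
have eN : e \notin (inner_bonds J L `\ e)%fset by rewrite in_fsetD1 eqxx.
have split1 g := big_fpowersetU1
  (fun A => conf_weight (J := J) (q := q) b L (outer_open L eta) B A * g A) eN.
rewrite /rc_sum; move: split1; rewrite (fsetD1K eL) => split1.
rewrite !split1 mulr_sumr.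
rewrite big_seq [leRHS]big_seq; apply: ler_sum => A; rewrite fpowersetE => AE.
have eA : e \notin A by apply/negP => /(fsubsetP AE); rewrite !inE eqxx.
have indE A' : ind L eta (edge_open e) A' = (e \in A')%:R.
  rewrite /ind indicE; congr (nat_of_bool _)%:R.
  by apply/idP/idP => [/set_mem|h]; rewrite ?edge_open_glue //; apply/mem_set; rewrite edge_open_glue.
rewrite !indE (negPf eA) fset1U1 mulr0 add0r !mulr1 mulrDr.
set p := p_open J b e; have p0 : 0 <= p by exact: p_open_ge0.
suff : (1 - p) * conf_weight (J := J) (q := q) b L (outer_open L eta) B (e |` A)%fset <=
    p * conf_weight (J := J) (q := q) b L (outer_open L eta) B A.
  by rewrite mulrBl mul1r; lra.
rewrite !conf_weightE fdisjointU1X.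
have [eB|_] /= := boolP (e \in B).
  by rewrite !mulr0 !mulr_ge0 ?edge_weight_ge0 ?exprn_ge0 ?ler0n // (le_trans ler01).
rewrite !mulrA ler_wpM2r ?ler0n // [(1 - p) * _]mulrC edge_weightU1 //.
apply: ler_wpM2l; first by rewrite mulr_ge0 ?edge_weight_ge0.
rewrite ler_weXn2l //; have [u [v [uL vL ->]]] := inner_bondsP eL.
by rewrite fsetUC add_edgesU [leqRHS](num_clusters_add_edge _ uL vL) leq_addr.
Qed.

Lemma rc_closed_edge_open_gt0 b L eta e : 0 < b -> e \in inner_bonds J L ->
  0 < rc_closed b L eta fset0 (edge_open e).
Proof.
move=> b0 eL; rewrite divr_gt0 ?rc_part_gt0 ?(ltW b0) // /rc_sum.
rewrite (big_fsetD1 [fset e]%fset) ?fpowersetE ?fsub1set //=.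
have p_gt0 : 0 < p_open J b e.
  have /andP[_ je] := inner_bond eL.
  by rewrite /p_open subr_gt0 -expR0 ltr_expR oppr_lt0 !mulr_gt0.
rewrite ltr_wpDr //.
  apply: sumr_ge0 => A _; apply: mulr_ge0; last exact: ind_ge0.
  by apply: conf_weight_ge0 => //; exact: ltW.
apply: mulr_gt0; last by rewrite /ind indicE mem_set ?ltr01 // edge_open_glue // inE.
rewrite conf_weightE fdisjointX0 mulr1; apply: mulr_gt0.
  by apply: prodr_gt0 => f _; rewrite inE; case: eqP => [->//|_]; exact: p_open_lt1.
by rewrite exprn_gt0 // (lt_le_trans ltr01).
Qed.

End Influence.

(** * Translations *)

Section Translation.
Context {R : realType} {d : nat} {J : site d -> R} {q : R}.
Hypothesis (J_even : forall x, J (- x) = J x).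
Implicit Types (b : R) (L V : {fset site d}) (o : edge d -> bool).
Implicit Types (A E : {fset edge d}) (e : edge d) (a x y z u v : site d).

Lemma shift_inj a : injective (fun x : site d => x + a).
Proof. exact: addIr. Qed.

Lemma mem_shift_set a V x : (x + a \in shift_set a V) = (x \in V).
Proof. exact: (mem_imfset _ _ (@shift_inj a)). Qed.

Lemma mem_shift_setB a V x : (x \in shift_set a V) = (x - a \in V).
Proof. by rewrite -{1}(subrK a x) mem_shift_set. Qed.

Lemma shift_set_inj a : injective (@shift_set d a).
Proof.
by move=> V V' /fsetP E; apply/fsetP => x; have := E (x + a); rewrite !mem_shift_set.
Qed.

Lemma shift_setK a V : shift_set (- a) (shift_set a V) = V.
Proof. by apply/fsetP => x; rewrite !mem_shift_setB opprK addrK. Qed.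

Lemma shift_set2 a u v : shift_set a [fset u; v]%fset = [fset (u + a)%R; (v + a)%R]%fset.
Proof. exact: imfset_fset2. Qed.

Lemma shift_setS a V V' : (shift_set a V `<=` shift_set a V')%fset = (V `<=` V')%fset.
Proof.
apply/fsubsetP/fsubsetP => h x; last by rewrite !mem_shift_setB => /h.
by have := h (x + a); rewrite !mem_shift_set.
Qed.

Lemma card_shift_set a V : #|` shift_set a V| = #|` V|.
Proof. by rewrite /shift_set card_imfset //; exact: shift_inj. Qed.

Lemma edge_coupling2 u v : u != v -> edge_coupling J [fset u; v]%fset = J (v - u).
Proof.
move=> uv; rewrite /edge_coupling.
set s := enum_fset _; have sz : size s = 2 by rewrite -/(#|` [fset u; v]%fset|) cardfs2 uv.
have us : uniq s by exact: fset_uniq.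
have ms x : (x \in s) = (x == u) || (x == v) by rewrite -[LHS]/(x \in [fset u; v]%fset) !inE.
case: s sz us ms => [//|x [//|y [|//]]] _ /=; rewrite inE andbT => xy ms.
have := ms x; have := ms y; rewrite !inE !eqxx orbT /=.
move=> /esym/orP[]/eqP yE /esym/orP[]/eqP xE; subst; rewrite ?eqxx // in xy *.
by rewrite -opprB J_even.
Qed.

Lemma edge_coupling_shift a e : #|` e| = 2%N ->
  edge_coupling J (shift_set a e) = edge_coupling J e.
Proof.
move=> /cardfs2_ex[u [v [uv ->]]]; rewrite shift_set2 !edge_coupling2 //.
  by rewrite opprD addrACA subrr addr0.
by rewrite (inj_eq (@shift_inj a)).
Qed.

Lemma is_bond_shift a e : is_bond J (shift_set a e) = is_bond J e.
Proof.
rewrite /is_bond card_shift_set; case: eqP => //= e2.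
by rewrite edge_coupling_shift.
Qed.

Lemma inner_bonds_shift a L : inner_bonds J (shift_set a L) =
  [fset shift_set a e | e in inner_bonds J L]%fset.
Proof.
have sub L' c : forall e, e \in inner_bonds J L' ->
    shift_set c e \in inner_bonds J (shift_set c L').
  by move=> e; rewrite !mem_inner_bonds is_bond_shift shift_setS.
apply/fsetP => e; apply/idP/imfsetP => /= [he|[e' he' ->]]; last exact: sub.
exists (shift_set (- a) e); last by rewrite -{1}(opprK a) shift_setK.
by have := sub _ (- a) _ he; rewrite shift_setK.
Qed.

Lemma linked_shift o a x y :
  linked o (x + a) (y + a) <-> linked (o \o shift_set a) x y.
Proof.
split.
  pose Q z := linked (o \o shift_set a) x (z - a).
  rewrite -{2}(addrK a y); apply: (@linked_ind _ o (x + a) Q).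
    by rewrite /Q addrK; exact: linked_refl.
  move=> u v _ xu ouv; apply: linked_trans xu _; apply: linked1.
  by rewrite /= shift_set2 !subrK.
move: y; apply: linked_ind => [|u v _ xu /= ouv]; first exact: linked_refl.
by apply: linked_trans xu _; apply: linked1; rewrite -shift_set2.
Qed.

Lemma num_clusters_shift o a V :
  num_clusters o (shift_set a V) = num_clusters (o \o shift_set a) V.
Proof.
rewrite /num_clusters.
transitivity #|` [fset shift_set a X | X in
   [fset [fset y in V | `[< linked (o \o shift_set a) x y >]] | x in V]]%fset |;
  last by rewrite card_imfset //; exact: shift_set_inj.
congr #|` _|; apply/fsetP => X.
have tr z x : z = x + a -> [fset y in shift_set a V | `[< linked o z y >]]%fset =
    shift_set a [fset y in V | `[< linked (o \o shift_set a) x y >]]%fset.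
  move=> ->; apply/fsetP => y; rewrite mem_shift_setB !inE /= mem_shift_setB; congr (_ && _).
  by apply: asbool_equiv_eq; rewrite -{1}(subrK a y) linked_shift.
apply/imfsetP/imfsetP => /= [[x]|[Y /imfsetP[/= x xV ->] ->]].
  rewrite mem_shift_setB => xV ->; rewrite (tr _ (x - a)) ?subrK //.
  by eexists; [|reflexivity]; apply/imfsetP; exists (x - a).
by exists (x + a); rewrite ?mem_shift_set // (tr _ x).
Qed.

Lemma is_open_glue_const L (c : bool) A e :
  is_open (glue_config (J := J) L (fun=> c) A) e =
  is_bond J e && (if e \in inner_bonds J L then e \in A else c).
Proof. by rewrite /is_open; case: insubP => [e' -> <-//|/negPf->]. Qed.

(** Constant boundary conditions are translation invariant. The wired one carries the decay to boxes
    around any site, the free one gives the translation invariance of [P]. *)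
Lemma rc_finite_shift b L (c : bool) a (X Y X' Y' : set (site d)) :
  (forall x, X' (x + a) <-> X x) -> (forall x, Y' (x + a) <-> Y x) ->
  rc_finite (J := J) q b (shift_set a L) (fun=> c) (connects X' Y') =
  rc_finite (J := J) q b L (fun=> c) (connects X Y).
Proof.
move=> XX YY.
have oE A : is_open (glue_config (J := J) (shift_set a L) (fun=> c)
      [fset shift_set a e | e in A]%fset) \o shift_set a =
    is_open (glue_config (J := J) L (fun=> c) A).
  apply/funext => e; rewrite /= !is_open_glue_const is_bond_shift inner_bonds_shift.
  by rewrite !mem_imfset //; exact: shift_set_inj.
have conn A : connects X' Y' (glue_config (J := J) (shift_set a L) (fun=> c)
      [fset shift_set a e | e in A]%fset) <->
    connects X Y (glue_config (J := J) L (fun=> c) A).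
  rewrite /connects /=; split => -[x [y [hx hy]]].
    rewrite -(subrK a x) -(subrK a y) linked_shift oE => xy.
    by exists (x - a), (y - a); split => //; [apply/XX|apply/YY]; rewrite subrK.
  rewrite -oE -linked_shift => xy.
  by exists (x + a), (y + a); split => //; [apply/XX|apply/YY].
have ind A : \1_(connects X' Y') (glue_config (J := J) (shift_set a L) (fun=> c)
      [fset shift_set a e | e in A]%fset) =
    \1_(connects X Y) (glue_config (J := J) L (fun=> c) A) :> R.
  by rewrite !indicE; congr (nat_of_bool _)%:R; apply/idP/idP => /set_mem/conn/mem_set.
have wE A : rc_finite_weight (J := J) q b (shift_set a L) (fun=> c)
      [fset shift_set a e | e in A]%fset = rc_finite_weight (J := J) q b L (fun=> c) A.
  rewrite /rc_finite_weight /rc_weight num_clusters_shift oE; congr (_ * _).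
  rewrite inner_bonds_shift big_imfset /=; last by move=> ? ? _ _; exact: shift_set_inj.
  apply: eq_fbigr => e eL _; rewrite mem_imfset /=; last exact: shift_set_inj.
  rewrite /p_open edge_coupling_shift //.
  by have /andP[/eqP] := inner_bond eL.
rewrite /rc_finite inner_bonds_shift.
have si := @shift_set_inj a.
congr (_ / _); rewrite [LHS](big_fpowerset_imfset _ _ si).
  by apply: eq_bigr => A _; rewrite ind wE.
by apply: eq_bigr => A _; rewrite wE.
Qed.

End Translation.

(** * Integrals and measurability *)

Section IntegralScale.
Import HBNNSimple.

(* No measurability is needed: the integral of a nonnegative function is a
   supremum over the simple functions below it. *)
Lemma ge0_integral_le_scale d (T : measurableType d) (R : realType)
    (mu : {measure set T -> \bar R}) (D : set T) (f g : T -> R) (u : R) :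
  0 < u -> (forall x, 0 <= f x) -> (forall x, 0 <= g x) ->
  (forall x, f x <= u * g x) ->
  (\int[mu]_(x in D) (f x)%:E <= u%:E * \int[mu]_(x in D) (g x)%:E)%E.
Proof.
move=> u0 f0 g0 fg; have ui0 : 0 <= u^-1 by rewrite invr_ge0 ltW.
rewrite !ge0_integralE; try by move=> x _; rewrite lee_fin.
apply: ub_ereal_sup => _ [h hf <-].
have hE : (sintegral mu h = u%:E * sintegral mu (scale_nnsfun h ui0))%E.
  rewrite -sintegralrM; apply: eq_sintegral => x /=.
  by rewrite mulVKf ?gt_eqF.
rewrite hE lee_pmul2l // ?lte_fin //; apply: ereal_sup_ubound.
exists (scale_nnsfun h ui0) => // x; have := hf x.
rewrite !patchE; case: ifP => _ /=; rewrite !lee_fin => hx.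
  by rewrite mulrC ler_pdivrMr // mulrC (le_trans hx).
by rewrite pmulr_rle0 ?invr_gt0.
Qed.

End IntegralScale.

Section Measurability.
Context {R : realType} {d : nat} {J : site d -> R}.
Implicit Types (S : set (edge d)) (e : edge d) (x y : site d).

(** Bonds are countable, so the event is a countable intersection of cylinders even for infinite
    [S]. The set [D] keeps track of the bonds involved, since the DLR equations ask for events
    decided outside [L]. *)
Lemma measurable_closed_on_gen (D : set (bond J)) S :
  (forall e : bond J, S (val e) -> D e) -> <<s cylinders D >> (closed_on (J := J) S).
Proof.
move=> SD.
pose F n : set (g_sigma_algebraType (cylinders D)) :=
  if (choice.unpickle n : option (bond J)) is Some b then
    if `[< S (val b) >] then ~` [set w | w b] else setT
  else setT.
have -> : closed_on (J := J) S = \bigcap_(n in setT) F n.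
  apply/seteqP; split=> w /= h.
    move=> n _; rewrite /F; case: choice.unpickle => // b; case: asboolP => // Se /=.
    by rewrite h.
  move=> e Se; have := h (choice.pickle e) I; rewrite /F choice.pickleK.
  by case: asboolP => // _ /= we; apply/negbTE/negP.
have : measurable (\bigcap_(n in setT) F n).
  apply: bigcap_measurableType => n _; rewrite /F; case: choice.unpickle => [b|].
    case: asboolP => [Se|_]; last exact: measurableT.
    by apply: measurableC; apply: sub_sigma_algebra; exists b => //; exact: SD.
  exact: measurableT.
by [].
Qed.

Lemma measurable_closed_on S : measurable (closed_on (J := J) S : set (rc_space J)).
Proof. exact: measurable_closed_on_gen. Qed.

Lemma measurable_edge_open e : measurable (edge_open (J := J) e : set (rc_space J)).
Proof.
have [be|ne] := boolP (is_bond J e); last first.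
  rewrite (_ : edge_open e = set0); first exact: measurable0.
  by apply/seteqP; split=> w //=; rewrite /edge_open /= => /is_open_bond; rewrite (negPf ne).
apply: sub_sigma_algebra; exists (exist _ e be) => //.
by apply/seteqP; split=> w /=; rewrite /edge_open /= /is_open insubT.
Qed.

(** A countable union over the finite paths from [X] to [Y]. *)
Lemma measurable_connects (X Y : set (site d)) :
  measurable (connects X Y : set (rc_space J)).
Proof.
have mp x s : measurable ([set w | path (fun u v => is_open w [fset u; v]%fset) x s] :
    set (rc_space J)).
  elim: s x => [|y s IH] x /=.
    by rewrite (_ : [set w | _] = setT); [exact: measurableT|apply/seteqP; split].
  have -> : [set w : rc_space J | is_open w [fset x; y]%fset &&
      path (fun u v => is_open w [fset u; v]%fset) y s] =
    edge_open [fset x; y]%fset `&` [set w | path (fun u v => is_open w [fset u; v]%fset) y s].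
    by apply/seteqP; split=> w /=; [move=> /andP[]|move=> [? ?]; apply/andP].
  by apply: measurableI; [exact: measurable_edge_open|exact: IH].
pose F n : set (rc_space J) :=
  if (choice.unpickle n : option (site d * seq (site d))) is Some (x, s) then
    if `[< X x /\ Y (last x s) >]
    then [set w | path (fun u v => is_open w [fset u; v]%fset) x s] else set0
  else set0.
have -> : connects X Y = \bigcup_(n in setT) F n.
  apply/seteqP; split=> w /=.
    move=> [x [y [Xx Yy [s ps ls]]]]; exists (choice.pickle (x, s)) => //.
    by rewrite /F choice.pickleK; case: asboolP => // -[]; rewrite ls.
  move=> [n _]; rewrite /F; case: choice.unpickle => // -[x s]; case: asboolP => // -[Xx Yy] ps.
  by exists x, (last x s); split => //; exists s.
apply: bigcupT_measurable => n; rewrite /F; case: choice.unpickle => [[x s]|].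
  by case: asboolP => _; [exact: mp|exact: measurable0].
exact: measurable0.
Qed.

End Measurability.

(** * The infinite-volume measure *)

Section Box.
Context {d : nat}.
Implicit Types (x y : site d) (N : nat).

Lemma mem_box N x : (x \in box (d := d) N) <-> forall i, (`|x 0 i| <= N%:Z)%R.
Proof.
split=> [/imfsetP[/= v _ ->] i|h].
  by rewrite mxE; have := ltn_ord (v i); move: (nat_of_ord (v i)) => k; rewrite -muln2; lia.
have lt i : (`|(x 0%R i + N%:Z)%R| < (N.*2).+1)%N by have := h i; rewrite -muln2; lia.
apply/imfsetP; exists [ffun i => Ordinal (lt i)] => //=.
apply/rowP => i; rewrite mxE ffunE /=; have := h i; lia.
Qed.

Definition box_at x N : {fset site d} := shift_set x (box N).

Lemma mem_box_at x N y : (y \in box_at x N) <-> forall i, (`|y 0 i - x 0 i| <= N%:Z)%R.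
Proof.
by rewrite mem_shift_setB mem_box; split => h i; have := h i; rewrite !mxE.
Qed.

Lemma box_at_center x N : x \in box_at x N.
Proof. by apply/mem_box_at => i; rewrite subrr normr0. Qed.

Lemma box_at_mono x N N' : (N <= N')%N -> (box_at x N `<=` box_at x N')%fset.
Proof.
move=> NN; apply/fsubsetP => y /mem_box_at h; apply/mem_box_at => i; have := h i; lia.
Qed.

Lemma box_at0 N : box_at 0 N = box N.
Proof. by apply/fsetP => y; rewrite mem_shift_setB subr0. Qed.

Definition sup_norm x : nat := \max_(i < d) `|x 0%R i|%N.

Lemma mem_box_sup x N : (x \in box (d := d) N) = (sup_norm x <= N)%N.
Proof.
apply/idP/bigmax_leqP => [/mem_box h i _|h]; first by have := h i; lia.
by apply/mem_box => i; have := h i isT; lia.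
Qed.

End Box.

Section InfiniteVolume.
Context {R : realType} {d : nat} {J : site d -> R} {q beta nu0 nu1 : R}.
Context {P : probability (rc_space J) R}.
Hypotheses (J_ge0 : forall x, 0 <= J x) (J_even : forall x, J (- x) = J x).
Hypotheses (q_ge1 : 1 <= q) (beta_ge0 : 0 <= beta).
Hypothesis P_DLR : is_DLR q beta P.
Hypotheses (nu0_gt0 : 0 < nu0) (nu1_gt0 : 0 < nu1).
Hypothesis decay : forall N,
  rc_finite q beta (box N) (fun=> true) (escapes (J := J) (box N) 0)
  <= nu0 * expR (- (nu1 * N%:R)).
Local Notation rc_finite := (rc_finite (J := J)).
Local Notation rc_closed := (rc_closed (J := J) (q := q)).
Implicit Types (F G : set (rc_space J)) (L : {fset site d}) (x y z : site d).
Implicit Types (e : edge d) (S : set (edge d)).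

Lemma generated_setT (T : Type) (C : set (set T)) : <<s C >> setT.
Proof. by have := @sigma_algebraCD T setT C _ (@sigma_algebra0 T setT C); rewrite setD0. Qed.

Lemma prob_EFin F : measurable F -> P F = (prob P F)%:E.
Proof. by move=> mF; rewrite /prob fineK // fin_num_measure. Qed.

Lemma prob_ge0 F : 0 <= prob P F.
Proof. exact: fine_ge0. Qed.

Lemma prob_setT : prob P setT = 1.
Proof. by rewrite /prob probability_setT. Qed.

Lemma prob_le F G : measurable F -> measurable G -> F `<=` G -> prob P F <= prob P G.
Proof. by move=> mF mG FG; rewrite -lee_fin -!prob_EFin // le_measure ?inE. Qed.

Lemma prob_le1 F : measurable F -> prob P F <= 1.
Proof. by move=> mF; rewrite -prob_setT; apply: prob_le => //; exact: measurableT. Qed.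

Lemma prob_setU F G : measurable F -> measurable G ->
  prob P (F `|` G) <= prob P F + prob P G.
Proof. by move=> mF mG; rewrite -lee_fin EFinD -!prob_EFin ?measureU2 //; exact: measurableU. Qed.

(** The only place where the DLR equations are unfolded: an inequality between kernels that holds
    for every boundary condition passes to [P], also on an event decided outside [L]. *)
Lemma prob_DLR_le L F F' G u : measurable F -> measurable F' ->
  <<s cylinders [set e : bond J | val e \notin inner_bonds J L] >> G -> 0 < u ->
  (forall eta, rc_finite q beta L eta F <= u * rc_finite q beta L eta F') ->
  prob P (F `&` G) <= u * prob P (F' `&` G).
Proof.
move=> mF mF' mG u0 FF.
have mG' : measurable G.
  apply: sub_sigma_algebra2 mG => _ [e _ <-]; by exists e.
rewrite -lee_fin EFinM -!prob_EFin; try exact: measurableI.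
rewrite !(P_DLR _ mG) //.
by apply: ge0_integral_le_scale => // eta; rewrite rc_finiteE rc_closed_ge0.
Qed.

Lemma prob_le_finite L F u : measurable F -> 0 < u ->
  (forall eta, rc_finite q beta L eta F <= u) -> prob P F <= u.
Proof.
move=> mF u0 Fu; rewrite -[F]setIT -[u]mulr1 -prob_setT -[in leRHS](setIT setT).
apply: (@prob_DLR_le L) => //; first exact: generated_setT.
by move=> eta; rewrite [X in u * X]rc_finiteE rc_closed_setT // mulr1.
Qed.

Lemma prob_ge_finite L F u : measurable F ->
  (forall eta, u <= rc_finite q beta L eta F) -> u <= prob P F.
Proof.
move=> mF uF; have [u0|u0] := ltP 0 u; last exact: (le_trans u0 (prob_ge0 _)).
rewrite -[F]setIT -[u]mulr1 -ler_pdivlMl // -prob_setT -[in leLHS](setIT setT).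
apply: (@prob_DLR_le L); rewrite ?invr_gt0 //; first exact: generated_setT.
by move=> eta; rewrite [leLHS]rc_finiteE rc_closed_setT // ler_pdivlMl // mulr1.
Qed.

Lemma escapes_box_at x N :
  rc_finite q beta (box_at x N) (fun=> true) (escapes (J := J) (box_at x N) x)
  <= nu0 * expR (- (nu1 * N%:R)).
Proof.
apply: le_trans (decay N); rewrite /escapes /box_at.
rewrite (@rc_finite_shift R d J q J_even beta (box N) true x [set 0]
  (~` [set y | y \in box N])) //.
  by move=> y /=; split=> [/eqP|->]; rewrite ?add0r // -subr_eq0 addrK => /eqP.
by move=> y /=; rewrite mem_shift_set.
Qed.

Lemma prob_escapes x N L : (box_at x N `<=` L)%fset ->
  prob P (escapes L x) <= nu0 * expR (- (nu1 * N%:R)).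
Proof.
move=> /fsubsetP xL; apply: (@le_trans _ _ (prob P (escapes (box_at x N) x))).
  apply: prob_le; try exact: measurable_connects.
  move=> w [_ [z [-> zL xz]]]; exists x, z; split => //.
  by move=> zx; apply: zL; exact: xL.
apply: (@prob_le_finite (box_at x N)); first exact: measurable_connects.
  by rewrite mulr_gt0 ?expR_gt0.
move=> eta; apply: le_trans (escapes_box_at x N); rewrite !rc_finiteE.
by apply: rc_closed_mono => //; exact: connects_increasing.
Qed.

(** A lower approximation of the connection probability under [P], with an exponentially small error
    by the lemmas below. As a finite sum with constant boundary condition it can be translated. *)
Definition free_connects L x y : R :=
  rc_finite q beta L (fun=> false) (connects (J := J) [set x] [set y]).

Lemma free_connects_le L x y eta :
  free_connects L x y <= rc_finite q beta L eta (connects [set x] [set y]).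
Proof.
by rewrite /free_connects !rc_finiteE; apply: rc_closed_mono => //; exact: connects_increasing.
Qed.

Lemma prob_ge_free L x y : free_connects L x y <= prob P (connects [set x] [set y]).
Proof.
by apply: prob_ge_finite => [|eta]; [exact: measurable_connects|exact: free_connects_le].
Qed.

Lemma prob_le_free L x y N : (box_at x N `<=` L)%fset ->
  prob P (connects [set x] [set y]) <= free_connects L x y + nu0 * expR (- (nu1 * N%:R)).
Proof.
move=> xL; have mE := @measurable_connects R d J [set x] (~` [set z | z \in L]).
have mC := @measurable_connects R d J [set x] [set y].
set C := connects _ _ in mC *.
pose D : set (rc_space J) := C `&` ~` escapes L x.
have mD : measurable D by apply: measurableI => //; exact: measurableC.
apply: (@le_trans _ _ (prob P (D `|` escapes L x))).
  apply: prob_le => //; first exact: measurableU.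
  by move=> w Cw; have [|] := pselect (escapes L x w); [right|left].
apply: le_trans (prob_setU mD mE) _; apply: lerD (prob_escapes xL).
have xin : x \in L by apply: (fsubsetP xL); exact: box_at_center.
have le eta : rc_finite q beta L eta D <= free_connects L x y.
  by rewrite /free_connects !rc_finiteE; apply: rc_closed_gap_connects.
(* [prob_le_finite] wants a positive bound, and the free probability may vanish. *)
apply/ler_addgt0Pr => eps eps0; apply: (@prob_le_finite L) => //.
  by rewrite ltr_wpDl // /free_connects rc_finiteE rc_closed_ge0.
by move=> eta; apply: le_trans (le eta) _; rewrite lerDl ltW.
Qed.

Lemma exp_decay_le0 (r c : R) : (forall N : nat, r <= c * expR (- (nu1 * N%:R))) -> r <= 0.
Proof.
move=> h; rewrite leNgt; apply/negP => r0.
have c0 : 0 < c.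
  rewrite ltNge; apply/negP => c0; have := h 0%N; rewrite mulr0 oppr0 expR0 mulr1.
  by move=> /(lt_le_trans r0); rewrite ltNge c0.
have [N hN] : exists N : nat, c / (r * nu1) < N%:R.
  by exists (Num.truncn (c / (r * nu1))).+1; exact: truncnS_gt.
have := h N; rewrite expRN ler_pdivlMr ?expR_gt0 // leNgt => /negP; apply.
have e1 : 1 + nu1 * N%:R <= expR (nu1 * N%:R) by exact: expR_ge1Dx.
rewrite ltr_pdivrMr ?mulr_gt0 // in hN.
apply: lt_le_trans hN _; rewrite mulrC -mulrA ler_wpM2l ?(ltW r0) //.
by apply: le_trans e1; rewrite lerDr.
Qed.

(** Both sides are exponentially close to free connection probabilities in a box around the starting
    site, and these are translates of one another. *)
Lemma prob_connects_shift a x y :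
  prob P (connects [set x + a] [set y + a]) = prob P (connects [set x] [set y]).
Proof.
have fE N : free_connects (box_at (x + a) N) (x + a) (y + a) = free_connects (box_at x N) x y.
  have -> : box_at (x + a) N = shift_set a (box_at x N).
    by apply/fsetP => z; rewrite !mem_shift_setB opprD addrA addrAC.
  by apply: (@rc_finite_shift R d J q J_even _ _ false) => // z /=; split=> [/addIr|->].
apply/eqP; rewrite -subr_eq0 -normr_le0; apply: (@exp_decay_le0 _ nu0) => N.
have := prob_ge_free (box_at (x + a) N) (x + a) (y + a).
have := prob_ge_free (box_at x N) x y.
have := prob_le_free y (fsubset_refl (box_at x N)).
have := prob_le_free (y + a) (fsubset_refl (box_at (x + a) N)).
by rewrite fE ler_norml => *; lra.
Qed.

(* Inside a large box both connections have at least their free probability,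
   which is almost P, and the finite-volume measures satisfy FKG. *)
Lemma prob_connects_add x y :
  prob P (connects [set 0] [set x]) * prob P (connects [set 0] [set y]) <=
  prob P (connects [set 0] [set x + y]).
Proof.
rewrite -subr_le0; apply: (@exp_decay_le0 _ (2 * nu0)) => N.
pose L : {fset site d} := box (N + sup_norm x).
have L0 : (box_at 0 N `<=` L)%fset.
  by rewrite /L -(box_at0 (N + sup_norm x)); apply: box_at_mono; rewrite leq_addr.
have Lx : (box_at x N `<=` L)%fset.
  apply/fsubsetP => z /mem_box_at h; rewrite mem_box => i.
  have : (`|x 0%R i| <= sup_norm x)%N by exact: leq_bigmax.
  by have := h i; lia.
have f1 := prob_le_free x L0; have f2 := prob_le_free (x + y) Lx.
have shiftE : prob P (connects [set x] [set x + y]) = prob P (connects [set 0] [set y]).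
  by have := prob_connects_shift x 0 y; rewrite add0r [y + x]addrC.
rewrite shiftE in f2.
have mC := @measurable_connects R d J.
have le : free_connects L 0 x * free_connects L x (x + y) <=
    prob P (connects [set 0] [set x + y]).
  apply: (@le_trans _ _ (prob P (connects [set 0] [set x] `&` connects [set x] [set x + y]))).
    apply: (@prob_ge_finite L) => [|eta]; first exact: measurableI.
    apply: le_trans (rc_finite_FKG _ _ _ _ _ _ _) => //; try exact: connects_increasing.
    by apply: ler_pM; rewrite ?free_connects_le // /free_connects rc_finiteE rc_closed_ge0.
  apply: prob_le => //; first exact: measurableI.
  move=> w [[_ [_ [-> -> h1]]] [_ [_ [-> -> h2]]]]; exists 0, (x + y); split => //.
  exact: linked_trans h2.
have fge0 a b : 0 <= free_connects L a b by rewrite /free_connects rc_finiteE rc_closed_ge0.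
have p1 : prob P (connects [set 0] [set y]) <= 1 by apply: prob_le1.
have f1le1 : free_connects L 0 x <= 1 by apply: le_trans (prob_ge_free _ _ _) (prob_le1 _).
have p0 := prob_ge0 (connects [set 0] [set y]).
have p0' := prob_ge0 (connects [set 0] [set x]).
have := fge0 0 x; have := fge0 x (x + y).
set eps := nu0 * expR _ in f1 f2 *.
have eps0 : 0 <= eps by rewrite mulr_ge0 ?ltW ?expR_gt0.
rewrite -mulrA -/eps.
move: f1 f2 le p1 f1le1 p0 p0' eps0; clear.
set p := prob P _; set p2 := prob P _; set p3 := prob P _.
move=> f1 f2 le p1 f1le1 p0 p0' eps0 g1 g2.
have := ler_wpM2r p0 f1; rewrite mulrDl => h1.
have := ler_wpM2l g2 f2; rewrite mulrDr => h2.
have h3 : eps * p2 <= eps by rewrite -[leRHS]mulr1 ler_wpM2l.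
have h4 : free_connects L 0 x * eps <= eps by rewrite -[leRHS]mul1r ler_wpM2r.
lra.
Qed.

(** * Exponential mixing for closed bonds *)

Section Mixing.
Context (rad : nat).
Hypothesis J_rad : forall x, 0 < J x -> x \in box rad.

Local Notation closed_on := (closed_on (J := J)).

(** A lower bound for 1 - p_e = exp(-2 beta J_e) uniform in the bond: the sum over the range
    dominates every coupling. *)
Definition closed_lb : R := expR (- (2 * beta * \sum_(x <- box rad) J x)).

Lemma closed_lb_gt0 : 0 < closed_lb. Proof. exact: expR_gt0. Qed.

Lemma closed_lb_le1 : closed_lb <= 1.
Proof. by rewrite -expR0 ler_expR oppr_le0 !mulr_ge0 // sumr_ge0. Qed.

Lemma bond_coupling e : is_bond J e -> exists u v,
  [/\ u != v, e = [fset u; v]%fset & edge_coupling J e = J (v - u)].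
Proof.
move=> /andP[/eqP/cardfs2_ex[u [v [uv eE]]] _]; exists u, v; split => //.
by rewrite eE edge_coupling2.
Qed.

Lemma bond_in_box e x : is_bond J e -> x \in e -> e \in inner_bonds J (box_at x rad).
Proof.
move=> be xe; rewrite mem_inner_bonds be andbT; apply/fsubsetP => y ye.
have [u [v [uv eE Ce]]] := bond_coupling be.
have Juv : 0 < J (v - u) by rewrite -Ce; case/andP: be.
have b1 : v - u \in box rad by exact: J_rad.
have b2 : u - v \in box rad by apply: J_rad; rewrite -opprB J_even.
rewrite mem_shift_setB; move: xe ye; rewrite eE !inE => /orP[]/eqP-> /orP[]/eqP-> //;
  by rewrite subrr; apply/mem_box => i; rewrite mxE normr0.
Qed.

Lemma p_open_le_lb e : is_bond J e -> closed_lb <= 1 - p_open J beta e.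
Proof.
move=> be; rewrite /p_open opprB addrC subrK /closed_lb ler_expR lerN2.
rewrite ler_wpM2l ?mulr_ge0 //; have [u [v [uv _ Ce]]] := bond_coupling be.
have Juv : 0 < J (v - u) by rewrite -Ce; case/andP: be.
rewrite Ce (big_fsetD1 (v - u)) /= ?lerDl ?sumr_ge0 //; exact: J_rad.
Qed.

(** Given everything outside [L], the probability that [e] is closed lies between its wired and its
    free value, and neither depends on [S']. This confines the effect of [S'] to an interval. *)
Lemma prob_edge_closed_bounds L e S S' : e \in inner_bonds J L ->
  (forall f, S' f -> f \notin inner_bonds J L) ->
  (1 - rc_closed beta L (fun=> true) (closed_inside (J := J) L S) (edge_open e))
    * prob P (closed_on (S `|` S')) <=
  prob P (closed_on ([set e] `|` (S `|` S'))) <=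
  (1 - rc_closed beta L (fun=> false) (closed_inside (J := J) L S) (edge_open e))
    * prob P (closed_on (S `|` S')).
Proof.
move=> eL S'L; set I := [set f | f \in inner_bonds J L].
(* [S] need not lie in [L]: its bonds outside [L] join those of [S'] in the event decided outside
   [L]. *)
set G := closed_on ((S `\` I) `|` S').
have mG : <<s cylinders [set f : bond J | val f \notin inner_bonds J L] >> G.
  by apply: measurable_closed_on_gen => f [[_ /negP]//|/S'L].
have SE : S `|` S' = (S `&` I) `|` ((S `\` I) `|` S').
  by rewrite setUA -setIUr setUv setIT.
set F' := closed_on (S `&` I); set F := closed_on [set e] `&` F'.
have -> : closed_on (S `|` S') = F' `&` G by rewrite SE closed_onU.
have -> : closed_on ([set e] `|` (S `|` S')) = F `&` G by rewrite SE closed_onU closed_onU setIA.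
have mF' : measurable (F' : set (rc_space J)) by exact: measurable_closed_on.
have mF : measurable (F : set (rc_space J)).
  by apply: measurableI => //; exact: measurable_closed_on.
have be := inner_bond eL.
have FE eta : rc_finite q beta L eta F =
    (1 - rc_closed beta L eta (closed_inside (J := J) L S) (edge_open e)) *
    rc_finite q beta L eta F'.
  rewrite rc_finite_closed_on //; congr (_ * _).
  by rewrite (edge_closedE (exist _ e be)) rc_closed_setC.
have lb eta B : 0 < 1 - rc_closed beta L eta B (edge_open e).
  apply: lt_le_trans (p_open_lt1 (J := J) beta e) _.
  by rewrite lerD2l lerN2; exact: rc_closed_edge_open.
have F'0 eta : 0 <= rc_finite q beta L eta F' by rewrite rc_finiteE rc_closed_ge0.
apply/andP; split.
  rewrite -ler_pdivlMl // mulrC -[leRHS]mulrC.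
  apply: (prob_DLR_le (L := L)) => //; first by rewrite invr_gt0.
  move=> eta; rewrite ler_pdivlMl // FE ler_wpM2r //.
  by rewrite lerD2l lerN2; apply: rc_closed_mono => //; exact: edge_open_increasing.
apply: (prob_DLR_le (L := L)) => // eta; rewrite FE ler_wpM2r //.
by rewrite lerD2l lerN2; apply: rc_closed_mono => //; exact: edge_open_increasing.
Qed.

Definition ln_closed (s : seq (edge d)) : R := ln (prob P (closed_on [set e | e \in s])).

Lemma closed_on_cons e s :
  closed_on [set f | f \in e :: s] = closed_on ([set e] `|` [set f | f \in s]).
Proof.
congr (closed_on _); apply/seteqP; split => f /=; rewrite inE.
  by move=> /orP[/eqP->|]; [left|right].
by move=> [->|->]; rewrite ?eqxx ?orbT.
Qed.

Lemma closed_on_not_bond e S : ~~ is_bond J e ->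
  closed_on ([set e] `|` S) = closed_on S.
Proof.
move=> ne; rewrite closed_onU [X in X `&` _](_ : _ = setT) ?setTI //.
by apply/seteqP; split=> // w _ f /= fe; move: ne; rewrite -fe (valP f).
Qed.

(** Finite energy, with a constant depending neither on the bond nor on the bonds already closed;
    [ln] is therefore Lipschitz on the conditional probabilities that occur. *)
Lemma prob_edge_closed_lb e S :
  closed_lb * prob P (closed_on S) <= prob P (closed_on ([set e] `|` S)).
Proof.
have [be|ne] := boolP (is_bond J e); last first.
  by rewrite closed_on_not_bond // ler_piMl ?prob_ge0 ?closed_lb_le1.
have [u [v [_ eE _]]] := bond_coupling be.
have eL : e \in inner_bonds J (box_at u rad) by apply: bond_in_box => //; rewrite eE fset21.
have /andP[h _] := prob_edge_closed_bounds S eL (S' := set0) (fun f => False_ind _).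
rewrite setU0 in h; apply: le_trans h; rewrite ler_wpM2r ?prob_ge0 //.
apply: le_trans (p_open_le_lb be) _; rewrite lerD2l lerN2.
exact: rc_closed_edge_open.
Qed.

Lemma prob_closed_gt0 (s : seq (edge d)) : 0 < prob P (closed_on [set e | e \in s]).
Proof.
elim: s => [|e s IH].
  rewrite (_ : closed_on _ = setT) ?prob_setT //.
  by apply/seteqP; split=> // w _ f.
by rewrite closed_on_cons; apply: lt_le_trans (prob_edge_closed_lb _ _); rewrite mulr_gt0 ?closed_lb_gt0.
Qed.

Lemma ln_le_sub (x y c : R) : 0 < c -> c <= x -> c <= y -> `|ln x - ln y| <= `|x - y| / c.
Proof.
move=> c0; wlog xy : x y / x <= y => [H cx cy|cx cy].
  have [xy|/ltW yx] := leP x y; first exact: H.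
  by rewrite distrC [X in _ <= X / _]distrC; exact: H.
have x0 : 0 < x := lt_le_trans c0 cx; have y0 : 0 < y := lt_le_trans c0 cy.
rewrite distrC [X in _ <= X / _]distrC !ger0_norm ?subr_ge0 ?ler_ln ?posrE //.
rewrite -ln_div ?posrE //.
apply: (@le_trans _ _ (y / x - 1)).
  rewrite -[X in ln X <= _](subrK 1 (y / x)) [X in ln X]addrC le_ln1Dx //.
  by rewrite -subr_gt0 opprK subrK divr_gt0.
rewrite -[X in _ - X](divff (lt0r_neq0 x0)) -mulrBl ler_wpM2l ?subr_ge0 //.
by rewrite lef_pV2 ?posrE.
Qed.

(** The first term serves for m > rad + 2: escape probability over the Lipschitz constant of [ln],
    the exponent 2 making up for the rounding of m. The second, positive as ln [closed_lb] <= 0,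
    makes the trivial bound sufficient for smaller m. *)
Definition mix_const : R := nu0 / closed_lb * expR (nu1 * 2)
  - ln closed_lb * expR (nu1 * (rad%:R + 2)).

Lemma mix_const_ge0 : 0 <= mix_const.
Proof.
rewrite subr_ge0; apply: (@le_trans _ _ 0).
  by rewrite mulr_le0_ge0 ?expR_ge0 // ln_le0 // closed_lb_le1.
by rewrite !mulr_ge0 ?expR_ge0 // ?ltW // invr_gt0 closed_lb_gt0.
Qed.

(** With or without [s'], the conditional probability that [e] is closed lies between the wired and
    the free value in a box around [x] of radius just below [m]. These differ by at most the wired
    probability of escaping from the box. *)
Lemma edge_ratio_mixing e x (m : R) (s s' : seq (edge d)) :
  x \in e ->
  (forall (N : nat) f, N%:R < m -> f \in s' -> f \notin inner_bonds J (box_at x N)) ->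
  `|(ln_closed (e :: s ++ s') - ln_closed (s ++ s')) -
    (ln_closed (e :: s) - ln_closed s)| <= mix_const * expR (- (nu1 * m)).
Proof.
move=> xe far; have [be|ne] := boolP (is_bond J e); last first.
  rewrite /ln_closed !closed_on_cons !closed_on_not_bond // !subrr normr0.
  by rewrite mulr_ge0 ?mix_const_ge0 ?expR_ge0.
have p0 := prob_closed_gt0.
pose ratio t := prob P (closed_on [set f | f \in e :: t]) / prob P (closed_on [set f | f \in t]).
have lnE t : ln_closed (e :: t) - ln_closed t = ln (ratio t) by rewrite /ratio ln_div ?posrE.
have r_ge t : closed_lb <= ratio t.
  by rewrite ler_pdivlMr // closed_on_cons; exact: prob_edge_closed_lb.
have r_le t : ratio t <= 1.
  rewrite ler_pdivrMr // mul1r; apply: prob_le; try exact: measurable_closed_on.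
  by rewrite closed_on_cons closed_onU; exact: subIsetr.
have nln : 0 <= - ln closed_lb by rewrite oppr_ge0 ln_le0 // closed_lb_le1.
have c0 := closed_lb_gt0.
have k0 : 0 <= nu0 / closed_lb by rewrite divr_ge0 ?ltW.
have mixE : mix_const * expR (- (nu1 * m)) = nu0 / closed_lb * expR (nu1 * 2 - nu1 * m)
    + - ln closed_lb * expR (nu1 * (rad%:R + 2) - nu1 * m).
  by rewrite /mix_const !expRD; ring.
rewrite !lnE mixE; have [mle|mgt] := leP m (rad%:R + 2).
  apply: (@le_trans _ _ (- ln closed_lb)).
    have l t : ln closed_lb <= ln (ratio t) <= 0.
      by rewrite ler_ln ?posrE ?r_ge ?ln_le0 ?(lt_le_trans c0).
    have /andP[? ?] := l (s ++ s'); have /andP[? ?] := l s.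
    by rewrite ler_norml; apply/andP; split; lra.
  apply: (@le_trans _ _ (- ln closed_lb * expR (nu1 * (rad%:R + 2) - nu1 * m))).
    apply: ler_peMr => //; rewrite -[X in X <= _]expR0 ler_expR -mulrBr.
    by rewrite mulr_ge0 ?subr_ge0 // ltW.
  by rewrite lerDr mulr_ge0 ?expR_ge0.
(* One below the integer part, since N < m is required strictly even for integral m; still m - 2 <=
   N. *)
pose N := (Num.truncn m).-1.
have m0 : 0 <= m by apply: le_trans (ltW mgt); rewrite addr_ge0.
have tm : (Num.truncn m)%:R <= m < (Num.truncn m).+1%:R by exact: truncn_itv.
have radt : (rad + 2 <= Num.truncn m)%N.
  by rewrite -ltnS -(ltr_nat R) natrD; case/andP: tm => _; apply: lt_trans.
have tN : Num.truncn m = N.+1.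
  by rewrite /N prednK //; apply: leq_trans radt; rewrite addn2.
have eL : e \in inner_bonds J (box_at x N).
  have := bond_in_box be xe; rewrite !mem_inner_bonds => /andP[eb ->]; rewrite andbT.
  apply: fsubset_trans eb _; apply: box_at_mono.
  by rewrite -ltnS -tN; apply: leq_trans radt; rewrite addn2 ltnS leqnSn.
have Nm : N%:R < m.
  by case/andP: tm => + _; apply: lt_le_trans; rewrite ltr_nat tN.
have Nm2 : m - 2 <= N%:R.
  by case/andP: tm => _; rewrite tN -addn2 natrD; lra.
pose B := closed_inside (J := J) (box_at x N) [set f | f \in s].
pose lo := 1 - rc_closed beta (box_at x N) (fun=> true) B (edge_open e).
pose hi := 1 - rc_closed beta (box_at x N) (fun=> false) B (edge_open e).
have gap : hi - lo <= nu0 * expR (- (nu1 * N%:R)).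
  rewrite /hi /lo opprB addrC addrA subrK lerBlDl.
  apply: (le_trans (rc_closed_gap_edge J_ge0 q_ge1 _ _ beta_ge0 eL xe)).
  rewrite lerD2l; apply: le_trans (escapes_box_at x N); rewrite rc_finiteE.
  by apply: rc_closed_mono => //; exact: connects_increasing.
(* To be used with [s'] and with the empty list: both ratios fall into the same interval. *)
have bnd s1 : (forall f, f \in s1 -> f \in s') -> lo <= ratio (s ++ s1) <= hi.
  move=> s1s; rewrite ler_pdivlMr // ler_pdivrMr // closed_on_cons.
  have -> : [set f | f \in s ++ s1] = [set f | f \in s] `|` [set f | f \in s1].
    by apply/seteqP; split => f /=; rewrite mem_cat => /orP.
  by apply: prob_edge_closed_bounds => // f /s1s; exact: far.
have /andP[l1 h1] := bnd s' (fun f => id).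
have /andP[l2 h2] := bnd [::] (fun f => False_ind _ \o notF).
rewrite cats0 in l2 h2.
apply: (le_trans (ln_le_sub c0 (r_ge _) (r_ge _))).
apply: (@le_trans _ _ (nu0 * expR (- (nu1 * N%:R)) / closed_lb)).
  rewrite ler_wpM2r ?invr_ge0 ?(ltW c0) //.
  by apply: le_trans gap; rewrite ler_norml; apply/andP; split; lra.
rewrite mulrAC -[leLHS]addr0; apply: lerD; last by rewrite mulr_ge0 ?expR_ge0.
rewrite ler_wpM2l // ler_expR.
have : nu1 * (m - 2) <= nu1 * N%:R by rewrite ler_wpM2l // ltW.
by rewrite mulrBr; lra.
Qed.

(** Telescoping over [A]: the bonds already treated join the list [s], on which the error for a
    single bond does not depend. The site in each pair is the endpoint from which distances are
    measured. *)
Lemma ln_closed_mixing (A : seq (site d * edge d)) (m : site d -> R) (s s' : seq (edge d)) :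
  (forall p, p \in A -> p.1 \in p.2) ->
  (forall p (N : nat) f, p \in A -> N%:R < m p.1 -> f \in s' ->
     f \notin inner_bonds J (box_at p.1 N)) ->
  `|(ln_closed (map snd A ++ s ++ s') - ln_closed (s ++ s')) -
    (ln_closed (map snd A ++ s) - ln_closed s)|
  <= \sum_(p <- A) mix_const * expR (- (nu1 * m p.1)).
Proof.
elim: A => [|p A IH] Ap far; first by rewrite big_nil /= !subrr normr0.
have sub p' : p' \in A -> p' \in p :: A by move=> h; rewrite inE h orbT.
rewrite big_cons; have := IH (fun p' h => Ap p' (sub p' h)) (fun p' N f h => far p' N f (sub p' h)).
have := @edge_ratio_mixing p.2 p.1 (m p.1) (map snd A ++ s) s' (Ap _ (mem_head _ _))
  (fun N f => far p N f (mem_head _ _)).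
rewrite -!catA /= => h1 h2; apply: le_trans (lerD h1 h2).
apply: le_trans (ler_normD _ _); rewrite le_eqVlt; apply/orP; left; apply/eqP.
by congr (`| _ |); ring.
Qed.

End Mixing.

End InfiniteVolume.

(** * The inverse correlation length *)

(** Fekete's lemma, the limit being the infimum of u n / n over n > 0. The value [u 0] appears in
    the bounds because [mulsub] includes k = 0. *)
Lemma cvg_subadditive (R : realType) (u : nat -> R) :
  (forall m n, u (m + n)%N <= u m + u n) -> (forall n, 0 <= u n) ->
  cvgn (fun n => n%:R^-1 * u n).
Proof.
move=> sub u0.
pose S := [set n%:R^-1 * u n | n in [set n | (0 < n)%N]].
have S0 : S !=set0 by exists (1%:R^-1 * u 1%N); exists 1%N.
have lbS : has_lbound S by exists 0 => _ [n _ <-]; rewrite mulr_ge0 ?invr_ge0.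
have infS : has_inf S by split.
have mulsub n k : u (k * n)%N <= k%:R * u n + u 0%N.
  elim: k => [|k IH]; first by rewrite mul0n mul0r add0r.
  by rewrite mulSn (le_trans (sub _ _)) // -natr1 mulrDl mul1r; lra.
apply: (@cvgP _ _ (inf S)); apply/cvgrPdist_le => eps eps0.
have [_ [n0 /= n0_gt0 <-] un0] : exists2 x, S x & x < inf S + eps / 2.
  by apply: inf_adherent => //; rewrite divr_gt0.
have n0R : 0 < n0%:R :> R by rewrite ltr0n.
pose M := u 0%N + \sum_(r < n0) u r.
have M0 : 0 <= M by rewrite addr_ge0 ?sumr_ge0.
have bound n : u n <= n%:R * (n0%:R^-1 * u n0) + M.
  have := sub (n %/ n0 * n0)%N (n %% n0)%N; rewrite -divn_eq => h.
  have h2 := mulsub n0 (n %/ n0)%N.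
  have lt := ltn_pmod n n0_gt0.
  have h3 : u (n %% n0)%N <= \sum_(r < n0) u r.
    by rewrite (bigD1 (Ordinal lt)) //= lerDl sumr_ge0.
  have h4 : (n %/ n0)%N%:R * u n0 <= n%:R * (n0%:R^-1 * u n0).
    rewrite mulrA ler_wpM2r // ler_pdivlMr // -natrM ler_nat.
    exact: leq_trunc_div.
  by rewrite /M; lra.
near=> n.
have n_gt0 : (0 < n)%N by near: n; exact: nbhs_infty_gt.
have nR : 0 < n%:R :> R by rewrite ltr0n.
have lo : inf S <= n%:R^-1 * u n by apply: ge_inf => //; exists n.
have Mn : n%:R^-1 * M <= eps / 2.
  rewrite mulrC ler_pdivrMr // mulrC -ler_pdivrMr ?divr_gt0 //.
  near: n; exact: nbhs_infty_ger.
have hi : n%:R^-1 * u n <= n0%:R^-1 * u n0 + n%:R^-1 * M.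
  by rewrite -(ler_pM2l nR) mulrDr !mulVKf ?gt_eqF.
by rewrite distrC ger0_norm ?subr_ge0 //; lra.
Unshelve. all: by end_near.
Qed.

Section XiLowerBound.
Context {R : realType} {d : nat} {J : site d -> R} {q beta nu0 nu1 : R}.
Context {P : probability (rc_space J) R}.
Hypotheses (J_ge0 : forall x, 0 <= J x) (J_even : forall x, J (- x) = J x).
Hypotheses (q_ge1 : 1 <= q) (beta_ge0 : 0 <= beta).
Hypothesis P_DLR : is_DLR q beta P.
Hypotheses (nu0_gt0 : 0 < nu0) (nu1_gt0 : 0 < nu1).
Hypothesis decay : forall N,
  rc_finite q beta (box N) (fun=> true) (escapes (J := J) (box N) 0)
  <= nu0 * expR (- (nu1 * N%:R)).
Hypothesis J_nn : forall x, enorm (embed x : 'rV[R]_d) = 1 -> 0 < J x.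
Implicit Types (x y : site d).

Definition link x : R := prob P (connects [set 0] [set x]).

Lemma int_part_embed k x : int_part (k%:R *: embed x : 'rV[R]_d) = x *+ k.
Proof.
apply/rowP => i; rewrite !mxE mulmxnE.
have -> : k%:R * (x 0 i)%:~R = (x 0 i * k%:Z)%:~R :> R by rewrite intrM mulrC.
by rewrite intrKfloor mulrC -mulr_natl natz.
Qed.

Lemma dot_delta (t : 'rV[R]_d) i : dot t (delta_mx 0 i) = t 0 i.
Proof.
rewrite /dot (bigD1 i) //= !mxE !eqxx mulr1 big1 ?addr0 // => j ji.
by rewrite !mxE eqxx (negPf ji) mulr0.
Qed.

Lemma dotNr (t y : 'rV[R]_d) : dot t (- y) = - dot t y.
Proof. by rewrite /dot -sumrN; apply: eq_bigr => i _; rewrite mxE mulrN. Qed.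

Lemma dotDr (t y z : 'rV[R]_d) : dot t (y + z) = dot t y + dot t z.
Proof. by rewrite /dot -big_split; apply: eq_bigr => i _; rewrite mxE mulrDr. Qed.

Lemma enorm_delta i : enorm (delta_mx 0 i : 'rV[R]_d) = 1.
Proof. by rewrite /enorm dot_delta mxE !eqxx sqrtr1. Qed.

Lemma enormN (y : 'rV[R]_d) : enorm (- y) = enorm y.
Proof.
congr Num.sqrt; rewrite /dot; apply: eq_bigr => i _; by rewrite !mxE mulrNN.
Qed.

Lemma embed_delta i : embed (delta_mx 0 i) = delta_mx 0 i :> 'rV[R]_d.
Proof. by apply/rowP => j; rewrite !mxE; case: (_ && _). Qed.

Lemma embedN x : embed (- x) = - embed x :> 'rV[R]_d.
Proof. by apply/rowP => j; rewrite !mxE mulrNz. Qed.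

Lemma embedD x y : embed (x + y) = embed x + embed y :> 'rV[R]_d.
Proof. by apply/rowP => j; rewrite !mxE intrD. Qed.

Lemma link0 : link 0 = 1.
Proof.
rewrite /link (_ : connects _ _ = setT) ?prob_setT //.
by apply/seteqP; split=> // w _; exists 0, 0; split => //; exact: linked_refl.
Qed.

Lemma linkD x y : link x * link y <= link (x + y).
Proof. exact: (prob_connects_add J_ge0 J_even q_ge1 beta_ge0 P_DLR nu0_gt0 nu1_gt0 decay). Qed.

(** By supermultiplicativity it suffices to reach the unit vectors, for which a single bond in the
    box of two sites is enough. Positivity is essential before taking logarithms, since [ln] is 0 at
    0 by convention. *)
Lemma link_gt0 x : 0 < beta -> 0 < link x.
Proof.
move=> b0.
have linkDgt y z : 0 < link y -> 0 < link z -> 0 < link (y + z).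
  by move=> py pz; apply: lt_le_trans (linkD y z); rewrite mulr_gt0.
have unit y : enorm (embed y : 'rV[R]_d) = 1 -> 0 < link y.
  move=> y1; have Jy := J_nn y1.
  have y0 : y != 0.
    apply/eqP => y0; move: y1; rewrite y0 /enorm /dot big1; last first.
      by move=> i _; rewrite !mxE mulr0.
    by rewrite sqrtr0 => /esym/eqP; rewrite oner_eq0.
  have e_bond : is_bond J [fset 0; y]%fset.
    have y0' : 0 != y by rewrite eq_sym.
    by rewrite /is_bond cardfs2 y0' edge_coupling2 // subr0 Jy.
  pose L : {fset site d} := [fset 0; y]%fset.
  have eL : [fset 0; y]%fset \in inner_bonds J L by rewrite mem_inner_bonds e_bond fsubset_refl.
  have pos := rc_closed_edge_open_gt0 J_ge0 q_ge1 (fun=> false) b0 eL.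
  apply: lt_le_trans pos (prob_ge_finite J_ge0 q_ge1 beta_ge0 P_DLR (L := L) _ _).
    exact: measurable_connects.
  move=> eta; rewrite rc_finiteE; apply: (@le_trans _ _
    (rc_closed (J := J) (q := q) beta L eta fset0 (edge_open [fset 0; y]%fset))).
    by apply: rc_closed_mono => //; exact: edge_open_increasing.
  apply: rc_closed_le => // w we; exists 0, y; split => //; exact: linked1.
have unitZ y n : 0 < link y -> 0 < link (y *+ n).
  move=> py; elim: n => [|n IH]; first by rewrite mulr0n link0.
  by rewrite mulrS; exact: linkDgt.
have coord (i : 'I_d) (z : int) : 0 < link (z *: delta_mx 0 i).
  have pe : 0 < link (delta_mx 0 i) by apply: unit; rewrite embed_delta enorm_delta.
  have ne : 0 < link (- delta_mx 0 i).
    by apply: unit; rewrite embedN embed_delta enormN enorm_delta.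
  case: z => n.
    by rewrite (_ : _ *: _ = delta_mx 0 i *+ n) ?unitZ // -scaler_nat natz.
  rewrite NegzE (_ : _ *: _ = - delta_mx 0 i *+ n.+1) ?unitZ //.
  by rewrite scaleNr mulNrn -scaler_nat natz.
rewrite [x]row_sum_delta; elim/big_rec: _ => [|i y _]; first by rewrite link0.
exact: linkDgt.
Qed.

Lemma ln_link_le x : 0 < link x -> ln (link x) <= `|ln nu0| + nu1 - nu1 * (sup_norm x)%:R.
Proof.
move=> p0; case: (posnP (sup_norm x)) => [->|x0].
  rewrite mulr0 subr0; apply: (@le_trans _ _ 0); last by rewrite addr_ge0 // ltW.
  by rewrite ln_le0 // prob_le1 //; exact: measurable_connects.
(* [x] lies outside the box of radius |x| - 1; the lost unit is the term nu1 of the bound. *)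
have le : link x <= nu0 * expR (- (nu1 * (sup_norm x).-1%:R)).
  apply: le_trans (prob_escapes (x := 0) J_ge0 J_even q_ge1 beta_ge0 P_DLR nu0_gt0 decay (fsubset_refl _)).
  apply: prob_le; try exact: measurable_connects.
  move=> w [_ [_ [-> -> h]]]; exists 0, x; split => //= .
  by rewrite box_at0 mem_box_sup leqNgt prednK // leqnn.
apply: (@le_trans _ _ (ln (nu0 * expR (- (nu1 * (sup_norm x).-1%:R))))).
  by rewrite ler_ln ?posrE // mulr_gt0 ?expR_gt0.
rewrite lnM ?posrE ?expR_gt0 // expRK -addrA lerD ?ler_norm //.
by rewrite -{2}(prednK x0) -natr1 mulrDr mulr1; lra.
Qed.

Lemma sup_norm_muln y k : sup_norm (y *+ k) = (k * sup_norm y)%N.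
Proof.
rewrite /sup_norm (big_morph (muln k) (maxnMr k) (muln0 k)).
by apply: eq_bigr => i _; rewrite mulmxnE -mulr_natl abszM natz.
Qed.

(** Multiples of a lattice site need no rounding, so subadditivity of -ln P(0 <-> kx) gives the
    limit; after division by k the additive constant of [ln_link_le] disappears. *)
Lemma xi_ge x : 0 < beta -> nu1 * (sup_norm x)%:R <= xi P (embed x).
Proof.
move=> b0; have lgt y := link_gt0 y b0.
pose u k := - ln (link (x *+ k)).
have u0 k : 0 <= u k.
  by rewrite oppr_ge0 ln_le0 // prob_le1 //; exact: measurable_connects.
have sub m n : u (m + n)%N <= u m + u n.
  by rewrite /u -opprD lerN2 -lnM ?posrE // mulrnDr ler_ln ?posrE ?mulr_gt0 // linkD.
have cv := cvg_subadditive sub u0.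
pose v (k : nat) := - (k%:R^-1 * u k).
have cvv : cvgn v by exact: is_cvgN.
have -> : xi P (embed x) = - limn v.
  rewrite /xi; congr (- limn _); apply/funext => k.
  by rewrite int_part_embed /v /u mulrN opprK.
rewrite lerNr; apply/ler_addgt0Pr => eps eps0; apply: limr_le => //.
pose C := `|ln nu0| + nu1.
near=> n.
have n_gt0 : (0 < n)%N by near: n; exact: nbhs_infty_gt.
have nR : 0 < n%:R :> R by rewrite ltr0n.
have Cn : C <= n%:R * eps.
  rewrite -ler_pdivrMr //; near: n; exact: nbhs_infty_ger.
rewrite /v /u mulrN opprK mulrC ler_pdivrMr //.
apply: le_trans (ln_link_le (lgt _)) _; rewrite sup_norm_muln natrM -/C.
by move: Cn; lra.
Unshelve. all: by end_near.
Qed.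

Lemma link_eq0 x : beta = 0 -> x != 0 -> link x = 0.
Proof.
move=> bE x0; apply/eqP; rewrite eq_le prob_ge0 andbT.
apply: (exp_decay_le0 nu1_gt0 (c := nu0)) => N.
have := prob_le_free J_ge0 J_even q_ge1 beta_ge0 P_DLR nu0_gt0 decay x
  (fsubset_refl (box_at 0 N)).
rewrite (_ : free_connects _ _ _ = 0) ?add0r // /free_connects rc_finiteE /rc_closed.
rewrite (_ : rc_sum _ _ _ _ _ = 0) ?mul0r //; apply: big1_fset => A.
rewrite fpowersetE => AL _; have [->|/fset0Pn[e eA]] := eqVneq A fset0.
  rewrite /ind indicE memNset ?mulr0 // => -[_ [_ [-> -> ]]].
  rewrite is_open_glue // add_edges0 outer_open_false => -[[|y s] //=].
  by move=> _ /esym/eqP; rewrite (negPf x0).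
rewrite conf_weightE /edge_weight (big_fsetD1 e) /=; last exact: (fsubsetP AL).
by rewrite eA /p_open bE mulr0 mul0r oppr0 expR0 subrr !mul0r.
Qed.

(** At beta = 0 every logarithm in the definition is ln 1 or, by the convention for [ln], ln 0 =
    0. *)
Lemma xi_eq0 (x : 'rV[R]_d) : beta = 0 -> xi P x = 0.
Proof.
move=> bE; rewrite /xi (_ : (fun k : nat => _) = fun=> 0) ?lim_cst ?oppr0 //.
apply/funext => k; rewrite -/(link _).
have [->|y0] := eqVneq (int_part (k%:R *: x)) 0; first by rewrite link0 ln1 mulr0.
by rewrite link_eq0 // ln0 ?mulr0.
Qed.

(** Testing against the unit vectors and their opposites puts [K_xi] into slabs; these are closed,
    so they contain its boundary as well. The widths vanish with [xi] when beta = 0. *)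
Lemma K_xi_bounded : exists T, 0 <= T /\ forall t, boundary (K_xi P) t ->
  forall i, `|t 0 i| <= T /\ (beta = 0 -> t 0 i = 0).
Proof.
pose T i := Num.max (xi P (delta_mx 0 i)) (xi P (- delta_mx 0 i)).
pose C (i : 'I_d) := [set t : 'rV[R]_d | `|t 0 i| <= T i].
have KC i : K_xi P `<=` C i.
  move=> t tK; rewrite /C /= ler_norml.
  have := tK (delta_mx 0 i) (enorm_delta i).
  have := tK (- delta_mx 0 i); rewrite enormN enorm_delta dotNr dot_delta => /(_ erefl) h1 h2.
  have l1 : xi P (delta_mx 0 i) <= T i by rewrite le_max lexx.
  have l2 : xi P (- delta_mx 0 i) <= T i by rewrite le_max lexx orbT.
  by apply/andP; split; lra.
have clC i : closed (C i).
  have -> : C i = (fun t : 'rV[R]_d => `|t 0 i|) @^-1` [set x | x <= T i] by [].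
  apply: closed_comp; last exact: closed_le.
  move=> t _; apply: (@continuous_comp _ _ _ (fun t : 'rV[R]_d => t 0 i) (fun x : R => `|x|)).
    exact: coord_continuous.
  exact: norm_continuous.
exists (\sum_i `|T i|); split; first by rewrite sumr_ge0.
move=> t [clK _] i; have tC : C i t.
  by have := closure_subset (@KC i) clK; rewrite -(closure_id _).1.
split.
  apply: (le_trans tC); apply: (le_trans (ler_norm _)).
  by rewrite (bigD1 i) //= lerDl sumr_ge0.
move=> bE; apply/eqP; rewrite -normr_le0; apply: (le_trans tC).
by rewrite /T !xi_eq0 // maxxx.
Qed.

End XiLowerBound.

(** * Exponential sums over the lattice *)

Section LatticeSum.
Context {R : realType} {d : nat}.
Implicit Types (rho c : R) (N : nat).

Lemma geometric_le rho n : 0 <= rho < 1 ->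
  \sum_(0 <= k < n) rho ^+ k <= (1 - rho)^-1.
Proof.
move=> /andP[r0 r1]; have r1' : 0 < 1 - rho by rewrite subr_gt0.
rewrite -[leRHS]mul1r ler_pdivlMr //.
suff -> : (\sum_(0 <= k < n) rho ^+ k) * (1 - rho) = 1 - rho ^+ n.
  by rewrite lerBlDr lerDl exprn_ge0.
elim: n => [|n IH]; first by rewrite big_nil mul0r expr0 subrr.
by rewrite big_nat_recr //= mulrDl IH exprS; ring.
Qed.

Lemma two_sided_geometric_le rho N : 0 <= rho < 1 ->
  \sum_(k < (N.*2).+1) rho ^+ `|k%:Z - N%:Z|%N <= 2 / (1 - rho).
Proof.
move=> r01; have r0 : 0 <= rho by case/andP: r01.
rewrite -(big_mkord xpredT (fun k => rho ^+ `|k%:Z - N%:Z|%N)) /=.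
rewrite (@big_cat_nat _ _ _ N) //=; last by rewrite -muln2; lia.
rewrite mulrDl mul1r; apply: lerD.
  rewrite big_nat_rev /=; apply: le_trans (geometric_le N.+1 r01).
  rewrite big_nat_recl //= expr0; apply: (@le_trans _ _ (\sum_(0 <= i < N) rho ^+ i.+1)).
    rewrite big_nat [leRHS]big_nat; apply: ler_sum => k /andP[_ kN].
    by rewrite (_ : absz _ = k.+1) //; lia.
  by rewrite lerDr.
rewrite -{1}[N]add0n big_addn; apply: le_trans (geometric_le ((N.*2).+1 - N) r01).
rewrite big_nat [leRHS]big_nat; apply: ler_sum => k /andP[_ kN].
by rewrite (_ : absz _ = k) //; lia.
Qed.

Lemma box_site_inj N : injective (@box_site d N).
Proof.
move=> v w /rowP vw; apply/ffunP => i; apply/val_inj.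
by have := vw i; rewrite !mxE => /addIr [].
Qed.

Lemma sum_box_le rho N : 0 <= rho < 1 ->
  \sum_(u <- box (d := d) N) \prod_i rho ^+ `|u 0%R i|%N <= (2 / (1 - rho)) ^+ d.
Proof.
move=> r01; have r0 : 0 <= rho by case/andP: r01.
rewrite /box big_imfset /=; last by move=> ? ? _ _; exact: box_site_inj.
rewrite -[d in leRHS]card_ord -prodr_const.
apply: (@le_trans _ _ (\prod_(i < d) \sum_(k < (N.*2).+1) rho ^+ `|k%:Z - N%:Z|%N)).
  rewrite bigA_distr_bigA /= big_enum /=.
  by apply: ler_sum => v _; apply: ler_prod => i _; rewrite exprn_ge0 //= mxE.
apply: ler_prod => i _; rewrite two_sided_geometric_le // andbT.
by apply: sumr_ge0 => k _; exact: exprn_ge0.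
Qed.

(** The sup norm is at least the average of the absolute values of the coordinates, so the summand
    is at most a product over coordinates of powers of exp(-c/d), and the sum over a box factorises
    into geometric series. *)
Lemma lattice_sum c : (0 < d)%N -> 0 < c -> exists S, 0 < S /\
  forall (V : {fset site d}) b,
    \sum_(u <- V) expR (- (c * (sup_norm (b - u))%:R)) <= S.
Proof.
move=> d0 c0; have dR : 0 < d%:R :> R by rewrite ltr0n.
pose rho := expR (- (c / d%:R)).
have r01 : 0 <= rho < 1 by rewrite expR_ge0 /= -expR0 ltr_expR oppr_lt0 divr_gt0.
have r1' : 0 < 1 - rho by rewrite subr_gt0; case/andP: r01.
exists ((2 / (1 - rho)) ^+ d); split; first by rewrite exprn_gt0 // divr_gt0.
move=> V b; pose W := [fset b - u | u in V]%fset.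
pose N := (\max_(w <- W) sup_norm w)%N.
apply: (@le_trans _ _ (\sum_(w <- W) expR (- (c * (sup_norm w)%:R)))).
  by rewrite big_imfset //= => ? ? _ _ /addrI /oppr_inj.
apply: (@le_trans _ _ (\sum_(w <- W) \prod_i rho ^+ `|w 0%R i|%N)).
  apply: ler_sum => w _; rewrite prodrXr /rho -expRM_natr ler_expR.
  rewrite mulNr lerN2 mulrAC ler_pdivrMr // -mulrA ler_wpM2l ?(ltW c0) // -natrM ler_nat.
  apply: (@leq_trans (\sum_(i < d) sup_norm w)%N); last by rewrite sum_nat_const card_ord mulnC.
  by apply: leq_sum => i _; exact: leq_bigmax.
apply: le_trans (sum_box_le N r01).
have WN : (W `<=` box N)%fset.
  by apply/fsubsetP => w wW; rewrite mem_box_sup /N; exact: leq_bigmax_seq.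
rewrite [leRHS](big_fsetID _ (mem W)) /=.
rewrite (_ : [fset x | x in box N & x \in W]%fset = W); last first.
  by apply/fsetP => w; rewrite !inE /= andbC; case: (boolP (w \in W)) => // /(fsubsetP WN).
rewrite lerDl; apply: sumr_ge0 => w _; apply: prodr_ge0 => i _.
by rewrite exprn_ge0 // expR_ge0.
Qed.

End LatticeSum.

(** * Consequences of subcriticality and of finite range *)

Section Subcritical.
Context {R : realType} {d : nat} {J : site d -> R} {q beta rng : R}.
Hypotheses (J_ge0 : forall x, 0 <= J x) (q_ge1 : 1 <= q) (beta_ge0 : 0 <= beta).

(** Below the supremum there is some larger b with decay, and monotonicity in the inverse
    temperature brings it down to beta. *)
Lemma decay_subcritical : (beta%:E < beta_hat J q)%E ->
  exists nu0 nu1, [/\ 0 < nu0, 0 < nu1 & forall N,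
    rc_finite q beta (box N) (fun=> true) (escapes (J := J) (box N) 0)
    <= nu0 * expR (- (nu1 * N%:R))].
Proof.
move=> /ereal_sup_gt[_ [b [b0 [nu0 [nu1 [nu00 nu10 dec]]]] <-]]; rewrite lte_fin => bb.
exists nu0, nu1; split => // N; apply: le_trans (dec N); rewrite !rc_finiteE.
by apply: rc_closed_mono => //; [exact: ltW | exact: connects_increasing].
Qed.

Lemma coupling_radius :
  (forall x, rng < enorm (embed x : 'rV[R]_d) -> J x = 0) ->
  exists rad : nat, forall x, 0 < J x -> x \in box rad.
Proof.
move=> hr; exists (Num.truncn rng) => x Jx.
have le : enorm (embed x : 'rV[R]_d) <= rng.
  by rewrite leNgt; apply/negP => /hr E; rewrite E ltxx in Jx.
have e0 : 0 <= enorm (embed x : 'rV[R]_d) by exact: sqrtr_ge0.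
apply/mem_box => i; have : `|(x 0 i)%:~R : R| <= enorm (embed x : 'rV[R]_d).
  rewrite -sqrtr_sqr /enorm ler_wsqrtr // /dot (bigD1 i) //= !mxE -expr2 lerDl.
  by apply: sumr_ge0 => j _; rewrite -expr2 sqr_ge0.
move=> /le_trans/(_ le); rewrite -intr_norm => h.
have : (`|x 0%R i|%N <= Num.truncn rng)%N.
  by rewrite truncn_ge_nat ?(le_trans e0 le) // natr_absz.
by rewrite -lez_nat abszE.
Qed.

End Subcritical.

(** * Strings of irreducible clusters *)

Section Clusters.
Context {R : realType} {d : nat} {J : site d -> R} (Y : set (site d)).
Hypothesis apex_antisym : forall z, with_apex Y z -> with_apex Y (- z) -> z = 0.
Local Notation shift := Defs.shift.
Implicit Types (g : subgraph d) (a b f x y : site d) (fb : site d * site d).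

(** The ends are the two cone points, and antisymmetry of the cone forbids exchanging them. As
    [ends] is obtained by choice, its behaviour under translation rests on this. *)
Lemma irreducible_at_uniq g fb fb' :
  irreducible_at Y g fb -> irreducible_at Y g fb' -> fb = fb'.
Proof.
case: fb fb' => f b [f' b'] [/= fb fg bg cg cp] [/= fb' fg' bg' cg' cp'].
have f'E : f' = f \/ f' = b by apply/cp/cp'; left.
have b'E : b' = f \/ b' = b by apply/cp/cp'; right.
case: f'E b'E fb' cg' => -> [] -> //; rewrite ?eqxx // => _ cg'.
have [fbY _] := cg' _ fg; have [bfY _] := cg _ bg.
have E : b - f = 0 by apply: apex_antisym => //; rewrite opprB.
by move: fb; rewrite eq_sym -subr_eq0 E eqxx.
Qed.

Lemma endsP g : irreducible J Y g -> irreducible_at Y g (ends Y g).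
Proof. by move=> [_ /xgetPex]; apply. Qed.

Lemma ends_eq g fb : irreducible_at Y g fb -> ends Y g = fb.
Proof.
move=> h; apply: (irreducible_at_uniq _ h).
have hex : exists fb0, irreducible_at Y g fb0 by exists fb.
exact: (xgetPex (0, 0) hex).
Qed.

Lemma b_onlyP g : backward_irreducible J Y g -> backward_at Y g (b_only Y g).
Proof. by move=> [_ /xgetPex]; apply. Qed.

Lemma f_onlyP g : forward_irreducible J Y g -> forward_at Y g (f_only Y g).
Proof. by move=> [_ /xgetPex]; apply. Qed.

Lemma gV_shift a g x : (x \in gV (shift a g)) = (x - a \in gV g).
Proof. exact: mem_shift_setB. Qed.

Lemma shift_shift a a' g : shift a (shift a' g) = shift (a' + a) g.
Proof.
have sE V : shift_set a (shift_set a' V) = shift_set (a' + a) V.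
  by apply/fsetP => x; rewrite !mem_shift_setB opprD addrA [x - a' - a]addrAC.
congr Subgraph; first exact: sE.
apply/fsetP => e; apply/imfsetP/imfsetP => /= [[_ /imfsetP[/= e' e'g ->] ->]|[e' e'g ->]].
  by exists e' => //; rewrite sE.
by exists (shift_set a' e'); [apply/imfsetP; exists e'|rewrite sE].
Qed.

Lemma cone_point_shift a g y : cone_point Y (shift a g) y <-> cone_point Y g (y - a).
Proof.
split=> -[yg h]; split; rewrite ?gV_shift // in yg * => x.
  have -> : y - a - x = y - (x + a) by rewrite opprD addrA addrAC.
  have -> : x - (y - a) = x + a - y by rewrite opprB addrA.
  by move=> xg; apply: h; rewrite gV_shift addrK.
rewrite gV_shift => /h; have -> : y - a - (x - a) = y - x by rewrite opprB addrA subrK.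
by have -> : x - a - (y - a) = x - y by rewrite opprB addrA subrK.
Qed.

Lemma irreducible_at_shift a g fb : irreducible_at Y g fb ->
  irreducible_at Y (shift a g) (fb.1 + a, fb.2 + a).
Proof.
move=> [fb_neq fg bg cg cp]; split; rewrite /= ?gV_shift ?addrK //.
- by rewrite (inj_eq (addIr a)).
- move=> x; rewrite gV_shift => /cg[h1 h2]; split.
    by rewrite opprD addrA addrAC.
  by have -> : fb.2 + a - x = fb.2 - (x - a) by rewrite opprB addrA.
- move=> y; rewrite cone_point_shift cp; split=> -[h|h]; [left|right|left|right].
  + by rewrite -h subrK.
  + by rewrite -h subrK.
  + by rewrite h addrK.
  + by rewrite h addrK.
Qed.

Lemma ends_shift a g : irreducible J Y g ->
  ends Y (shift a g) = ((ends Y g).1 + a, (ends Y g).2 + a).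
Proof. by move=> /endsP/(@irreducible_at_shift a)/ends_eq. Qed.

Section Bonds.
Context (rad : nat).
Hypothesis J_even : forall x, J (- x) = J x.
Hypothesis J_rad : forall x, 0 < J x -> x \in box rad.

(* A bond with both endpoints in g is listed twice; only membership and an upper
   bound on sums over the list matter. *)
Definition closed_pairs g (X : set (edge d)) : seq (site d * edge d) :=
  [seq p <- [seq (u, [fset u; (u + z)%R]%fset) | u <- gV g, z <- box rad]
     | (p.2 \notin gE g) && ~~ `[< X p.2 >]].

Lemma closed_pairs_mem g X p : p \in closed_pairs g X -> p.1 \in gV g /\ p.1 \in p.2.
Proof.
rewrite mem_filter => /andP[_ /allpairsP[[u z] /= [ug _ ->]]] /=.
by rewrite fset21.
Qed.

(** Listed pairs that are not bonds impose nothing on a configuration, and by finite range every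
    bond touching the cluster is listed. *)
Lemma closed_aroundE g X : closed_around (J := J) g X =
  closed_on (J := J) [set e | e \in map snd (closed_pairs g X)].
Proof.
apply/seteqP; split=> w h e.
  move=> /mapP[p /[dup] /closed_pairs_mem[pg pe]].
  rewrite mem_filter => /andP[/andP[eg /asboolPn nX] _] eE.
  by apply: h; rewrite eE //; exists p.1.
move=> [u ug ue] eg nX; apply: h => /=; apply/mapP.
have [x [y [xy eE Ce]]] := bond_coupling J_even (valP e).
have Jyx : 0 < J (y - x) by rewrite -Ce; have /andP[] := valP e.
have [v [eE' b]] : exists v, val e = [fset u; v]%fset /\ v - u \in box rad.
  move: ue; rewrite eE !inE => /orP[]/eqP->.
    by exists y; split => //; exact: J_rad.
  by exists x; split; [exact: fset2C|apply: J_rad; rewrite -opprB J_even].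
exists (u, val e) => //; rewrite mem_filter /= eg; apply/andP; split; first exact/asboolPn.
by apply/allpairsP; exists (u, v - u); split => //=; rewrite eE' addrC subrK.
Qed.

Lemma sum_closed_pairs g X (F : site d -> R) : (forall u, 0 <= F u) ->
  \sum_(p <- closed_pairs g X) F p.1 <= (size (box (d := d) rad))%:R * \sum_(u <- gV g) F u.
Proof.
move=> F0; rewrite /closed_pairs big_filter.
apply: (@le_trans _ _ (\sum_(p <- [seq (u, [fset u; (u + z)%R]%fset) | u <- gV g, z <- box rad]) F p.1)).
  by rewrite big_mkcond; apply: ler_sum => p _; case: ifP.
rewrite big_allpairs_dep /= mulr_sumr; apply: ler_sum => u _.
by rewrite big_const_seq count_predT iter_addr_0 mulr_natl.
Qed.

Definition N_bonds g : seq (edge d) :=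
  map snd (closed_pairs g (edges_minus Y (ends Y g).1 `|` edges_plus Y (ends Y g).2)).

(** Follows the recursion of [string_N], replacing events by lists of bonds, so that intersection
    becomes concatenation and common prefixes can be extracted. *)
Fixpoint string_bonds a (s : seq (subgraph d)) (gf : subgraph d) : seq (edge d) :=
  if s is g :: s' then
    N_bonds (shift (a - (ends Y g).1) g) ++ string_bonds (a + displacement Y g) s' gf
  else let h := shift (a - f_only Y gf) gf in
    map snd (closed_pairs h (edges_minus Y (f_only Y h))).

Lemma closed_on_cat (s s' : seq (edge d)) :
  closed_on (J := J) [set e | e \in s ++ s'] =
  closed_on (J := J) [set e | e \in s] `&` closed_on (J := J) [set e | e \in s'].
Proof.
rewrite -closed_onU; congr (closed_on _); apply/seteqP.
by split=> e /=; rewrite mem_cat => /orP.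
Qed.

Lemma string_NE a s gf :
  string_N (J := J) Y a s gf = closed_on (J := J) [set e | e \in string_bonds a s gf].
Proof.
elim: s a => [|g s IH] a /=; first exact: closed_aroundE.
by rewrite closed_on_cat -IH -closed_aroundE.
Qed.

(** * Growth of a linear height along a string *)

Section Heights.
Context (hgt : site d -> R) (kappa : R).
Hypotheses (kappa_gt0 : 0 < kappa)
  (hgtD : forall x y, hgt (x + y) = hgt x + hgt y).
Hypothesis hgt_apex : forall z, with_apex Y z -> kappa * (sup_norm z)%:R <= hgt z.

Let hgt_ge0 z : with_apex Y z -> 0 <= hgt z.
Proof. by move=> /hgt_apex; apply: le_trans; rewrite mulr_ge0 // ltW. Qed.

Lemma sup_norm_eq0 z : (sup_norm (d := d) z == 0)%N = (z == 0).
Proof.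
apply/eqP/eqP => [z0|->].
  apply/rowP => i; rewrite mxE; apply/eqP; rewrite -absz_eq0 -leqn0.
  have : (`|z 0%R i| <= sup_norm z)%N by exact: leq_bigmax.
  by rewrite z0.
by apply/eqP; rewrite -leqn0; apply/bigmax_leqP => i _; rewrite mxE.
Qed.

(** The two ends are distinct lattice sites, so their difference has sup norm at least 1. *)
Lemma hgt_displacement g : irreducible J Y g -> kappa <= hgt (displacement Y g).
Proof.
move=> /endsP[fb fg _ cg _]; have [_ bfY] := cg _ fg.
apply: le_trans (hgt_apex bfY); rewrite ler_peMr ?(ltW kappa_gt0) // ler1n lt0n.
by rewrite sup_norm_eq0 subr_eq0 eq_sym.
Qed.

(** A listed bond has an endpoint in its cluster, hence in the cone above the starting point of that
    cluster, and starting points rise along the string. The other endpoint may be lower, but one far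
    endpoint is enough to leave a box. *)
Lemma string_bonds_high a s gf :
  (forall i, (i < size s)%N -> irreducible J Y (nth gf s i)) ->
  forward_irreducible J Y gf ->
  forall e, e \in string_bonds a s gf -> exists2 v, v \in e & hgt a <= hgt v.
Proof.
move=> + gfI; elim: s a => [|g s IH] a sI e.
  move=> /mapP[[u e'] /closed_pairs_mem[/= ug ue'] ->]; exists u => //.
  move: ug; rewrite gV_shift => ug; have [_ cg _] := f_onlyP gfI.
  have := hgt_ge0 (cg _ ug).
  have -> : u - (a - f_only Y gf) - f_only Y gf = u - a by rewrite opprB addrA addrAC addrK.
  by move=> h; rewrite -[u](subrK a) hgtD lerDr.
rewrite /= mem_cat => /orP[/mapP[[u e'] /closed_pairs_mem[/= ug ue'] ->]|].
  exists u => //; move: ug; rewrite gV_shift => ug.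
  have [_ _ _ cg _] := endsP (sI 0%N isT : irreducible J Y g).
  have [+ _] := cg _ ug; have -> : u - (a - (ends Y g).1) - (ends Y g).1 = u - a.
    by rewrite opprB addrA addrAC addrK.
  by move=> /hgt_ge0 h; rewrite -[u](subrK a) hgtD lerDr.
move=> /(IH _ (fun i => sI i.+1))[v ve hv]; exists v => //; apply: le_trans hv.
by rewrite hgtD lerDl (le_trans (ltW kappa_gt0)) // hgt_displacement //; exact: (sI 0%N).
Qed.

Lemma first_disagreement_cons g h (s l : seq (subgraph d)) :
  first_disagreement (g :: s) (h :: l) =
  if `[< translates g h >] then (first_disagreement s l).+1 else 1%N.
Proof.
rewrite /first_disagreement /=; case: ifP => [/negPf->|/negbFE->].
  by rewrite !minnSS min0n.
by rewrite !minnSS.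
Qed.

(** Clusters equal up to translation are placed at the same site, so they contribute the same bonds
    and the same displacement. Positions count from 1, so at least one cluster fewer than
    [first_disagreement] is shared, each raising the height by kappa. *)
Lemma string_bonds_common a s l gf gf' :
  (forall i, (i < size s)%N -> irreducible J Y (nth gf s i)) ->
  (forall i, (i < size l)%N -> irreducible J Y (nth gf' l i)) ->
  exists a' (p : seq (edge d)) s' l',
  [/\ string_bonds a s gf = p ++ string_bonds a' s' gf,
      string_bonds a l gf' = p ++ string_bonds a' l' gf',
      hgt a + kappa * (first_disagreement s l).-1%:R <= hgt a',
      (forall i, (i < size s')%N -> irreducible J Y (nth gf s' i)) &
      (forall i, (i < size l')%N -> irreducible J Y (nth gf' l' i))].
Proof.
elim: s l a => [|g s IH] l a sI lI.
  exists a, [::], [::], l; split => //.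
  by rewrite /first_disagreement /= min0n minn0 mulr0 addr0.
case: l lI => [|h l] lI.
  exists a, [::], (g :: s), [::]; split => //.
  by rewrite /first_disagreement /= !minn0 mulr0 addr0.
rewrite first_disagreement_cons; case: asboolP => [[c ghE]|_]; last first.
  by exists a, [::], (g :: s), (h :: l); split => //; rewrite mulr0 addr0.
have gI : irreducible J Y g by exact: (sI 0%N).
have hE := ends_shift c gI; rewrite ghE in hE.
have dE : displacement Y h = displacement Y g.
  by rewrite /displacement hE /= opprD addrACA subrr addr0.
have shE : shift (a - (ends Y h).1) h = shift (a - (ends Y g).1) g.
  by rewrite hE -ghE shift_shift /= [X in Defs.shift X]addrC opprD addrA subrK.
have [a' [p [s' [l' [E1 E2 ha s'I l'I]]]]] :=
  IH l (a + displacement Y g) (fun i => sI i.+1) (fun i => lI i.+1).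
exists a', (N_bonds (shift (a - (ends Y g).1) g) ++ p), s', l'; split => //.
- by rewrite /= E1 catA.
- by rewrite /= shE dE E2 catA.
- apply: le_trans ha; rewrite hgtD -addrA lerD2l.
  have := hgt_displacement gI; case: (first_disagreement s l) => [|k] /= hk.
    by rewrite mulr0 addr0 (le_trans (ltW kappa_gt0)).
  by rewrite -[k.+1%:R]natr1 mulrDr mulr1; move: hk; lra.
Qed.

End Heights.
End Bonds.
End Clusters.

(** * Bounds and forgetting for [g_fun] and [psi] *)

Section Functions.
Context {R : realType} {d : nat} {J : site d -> R} {q beta nu0 nu1 : R}.
Context {P : probability (rc_space J) R}.
Hypotheses (J_ge0 : forall x, 0 <= J x) (J_even : forall x, J (- x) = J x).
Hypotheses (q_ge1 : 1 <= q) (beta_ge0 : 0 <= beta).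
Hypothesis P_DLR : is_DLR q beta P.
Hypotheses (nu0_gt0 : 0 < nu0) (nu1_gt0 : 0 < nu1).
Hypothesis decay : forall N,
  rc_finite q beta (box N) (fun=> true) (escapes (J := J) (box N) 0)
  <= nu0 * expR (- (nu1 * N%:R)).
Context (rad : nat).
Hypothesis J_rad : forall x, 0 < J x -> x \in box rad.
Context (Y : set (site d)) (hgt : site d -> R) (kappa D S : R).
Hypotheses (kappa_gt0 : 0 < kappa) (D_gt0 : 0 < D) (S_gt0 : 0 < S).
Hypothesis hgtD : forall x y, hgt (x + y) = hgt x + hgt y.
Hypothesis hgt_apex : forall z, with_apex Y z -> kappa * (sup_norm z)%:R <= hgt z.
Hypothesis hgt_le : forall z, hgt z <= D * (sup_norm z)%:R.
Hypothesis S_sum : forall (V : {fset site d}) b,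
  \sum_(u <- V) expR (- (nu1 * kappa / D * (sup_norm (b - u))%:R)) <= S.
Implicit Types (g gb gf : subgraph d) (s l : seq (subgraph d)) (b : site d).

Local Notation lnc := (ln_closed (P := P)).
Local Notation M := (mix_const (J := J) (beta := beta) (nu0 := nu0) (nu1 := nu1) rad).

Local Notation bonds_at g X := (map snd (closed_pairs rad g X)).

(** Mixing constant per bond, times a bound on the number of listed bonds per site, times the
    lattice sum. *)
Definition cluster_const : R := M * (size (box (d := d) rad))%:R * S.

Let hgt0 : hgt 0 = 0.
Proof. by apply: (@addrI _ (hgt 0)); rewrite -hgtD !addr0. Qed.

Let hgtN x : hgt (- x) = - hgt x.
Proof. by apply: (@addrI _ (hgt x)); rewrite -hgtD !subrr hgt0. Qed.

Let apex_antisym z : with_apex Y z -> with_apex Y (- z) -> z = 0.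
Proof.
move=> /hgt_apex h1 /hgt_apex; rewrite hgtN => h2.
have k2 : 0 <= kappa * (sup_norm (- z))%:R by rewrite mulr_ge0 // ltW.
apply/eqP; rewrite -sup_norm_eq0 -leqn0 -(ler_nat R) -(ler_pM2l kappa_gt0) mulr0.
by move: h1 h2 k2; lra.
Qed.

Let M_ge0 : 0 <= M. Proof. exact: mix_const_ge0. Qed.

Lemma cluster_const_ge0 : 0 <= cluster_const.
Proof. by rewrite !mulr_ge0 // ltW. Qed.

(** A site [u] of the cluster is at least kappa |b - u| lower than [b], while each bond of [sC]
    reaches height hgt b + h. As [hgt] is D-Lipschitz in the sup norm, these bonds are at distance
    at least [m u] from [u], and the sum over [u] is a lattice sum. *)
Lemma cluster_mixing g (X : set (edge d)) b h (sB sC : seq (edge d)) :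
  (forall u, u \in gV g -> with_apex Y (b - u)) ->
  (forall e, e \in sC -> exists2 v, v \in e & hgt b + h <= hgt v) ->
  `|(lnc (bonds_at g X ++ sB ++ sC) - lnc (sB ++ sC)) -
    (lnc (bonds_at g X ++ sB) - lnc sB)|
  <= cluster_const * expR (- (nu1 / D * h)).
Proof.
move=> gY sCh.
pose m u := (kappa * (sup_norm (b - u))%:R + h) / D.
have mixing := @ln_closed_mixing _ _ _ _ _ _ _ P J_ge0 J_even q_ge1 beta_ge0 P_DLR
  nu0_gt0 nu1_gt0 decay rad J_rad (closed_pairs rad g X) m sB sC.
apply: (le_trans (mixing _ _)); first by move=> p /closed_pairs_mem[].
  move=> p N f /closed_pairs_mem[ug _] Nm /sCh[v vf hv]; apply/negP.
  rewrite mem_inner_bonds => /andP[/fsubsetP/(_ _ vf) + _].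
  rewrite mem_shift_setB mem_box_sup => vN.
  move: Nm; rewrite /m ltr_pdivlMr // ltNge => /negP; apply.
  have h1 := hgt_apex (gY _ ug); have h2 := hgt_le (v - p.1).
  have h3 : D * (sup_norm (v - p.1))%:R <= N%:R * D by rewrite mulrC ler_wpM2r ?ler_nat // ltW.
  move: h1 h2 h3 hv; rewrite !hgtD !hgtN; lra.
rewrite -mulr_sumr.
apply: (le_trans (ler_wpM2l M_ge0 (sum_closed_pairs rad g X
  (F := fun u => expR (- (nu1 * m u))) (fun u => expR_ge0 _)))).
rewrite /cluster_const -[M * _ * S * _]mulrA -[M * _ * (S * _)]mulrA ler_wpM2l // ler_wpM2l //.
have mE u : expR (- (nu1 * m u)) = expR (- (nu1 / D * h)) *
    expR (- (nu1 * kappa / D * (sup_norm (b - u))%:R)).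
  rewrite -expRD; congr expR; rewrite /m; field.
  by rewrite gt_eqF.
under eq_bigr do rewrite mE.
by rewrite -mulr_sumr [leLHS]mulrC ler_wpM2r ?expR_ge0 ?S_sum.
Qed.

(** One more shared cluster raises the height by kappa, hence the distance by kappa / D, against the
    decay rate nu1. *)
Definition rate : R := expR (- (nu1 / D * kappa)).

Lemma rate_itv : 0 < rate < 1.
Proof.
by rewrite /rate expR_gt0 -expR0 ltr_expR oppr_lt0 mulr_gt0 ?divr_gt0.
Qed.

(** The extra factor is 1 / [rate]: agreement up to index i guarantees only i - 1 shared
    clusters. *)
Definition decay_const : R := cluster_const * expR (nu1 / D * kappa).

Lemma decay_const_ge0 : 0 <= decay_const.
Proof. by rewrite mulr_ge0 ?cluster_const_ge0 ?expR_ge0. Qed.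

Lemma cluster_const_rate h (i : nat) : kappa * i.-1%:R <= h ->
  cluster_const * expR (- (nu1 / D * h)) <= decay_const * rate ^+ i.
Proof.
move=> hi; rewrite /decay_const -[leRHS]mulrA ler_wpM2l ?cluster_const_ge0 //.
rewrite /rate -expRM_natr -expRD ler_expR.
have c0 : 0 < nu1 / D by rewrite divr_gt0.
have h1 : nu1 / D * (kappa * i.-1%:R) <= nu1 / D * h by rewrite ler_wpM2l // ltW.
have h2 : nu1 / D * (kappa * i%:R) <= nu1 / D * (kappa * i.-1%:R + kappa).
  have hi1 : i%:R <= i.-1%:R + 1 :> R by rewrite natr1 ler_nat leqSpred.
  have := ler_wpM2l (ltW kappa_gt0) hi1; rewrite mulrDr mulr1.
  exact/ler_wpM2l/ltW.
by move: h1 h2; rewrite mulrDr !mulrA; lra.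
Qed.

Let p_gt0 (t : seq (edge d)) : 0 < prob P (closed_on (J := J) [set e | e \in t]).
Proof. exact: (prob_closed_gt0 J_ge0 J_even q_ge1 beta_ge0 P_DLR J_rad). Qed.

Lemma ln_cond_closed (t t' : seq (edge d)) :
  ln (cond_prob P (closed_on (J := J) [set e | e \in t]) (closed_on (J := J) [set e | e \in t']))
  = lnc (t ++ t') - lnc t'.
Proof. by rewrite /cond_prob -closed_on_cat ln_div ?posrE. Qed.

Lemma cond_closed_gt0 (t t' : seq (edge d)) :
  0 < cond_prob P (closed_on (J := J) [set e | e \in t]) (closed_on (J := J) [set e | e \in t']).
Proof. by rewrite /cond_prob -closed_on_cat divr_gt0. Qed.

Definition Nb_bonds gb : seq (edge d) :=
  map snd (closed_pairs rad gb (edges_plus Y (b_only Y gb))).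

Local Notation bonds := (string_bonds Y rad).

Lemma event_NbE gb : event_Nb Y gb = closed_on (J := J) [set e | e \in Nb_bonds gb].
Proof. exact: closed_aroundE. Qed.

Lemma g_fun_gt0 s gb gf : 0 < g_fun P Y s gb gf.
Proof.
rewrite /g_fun event_NbE (string_NE Y J_even J_rad).
by rewrite divr_gt0 ?cond_closed_gt0.
Qed.

Lemma ln_g_fun s gb gf : ln (g_fun P Y s gb gf) =
  lnc (Nb_bonds gb ++ bonds (b_only Y gb) s gf) - lnc (bonds (b_only Y gb) s gf)
  - lnc (Nb_bonds gb).
Proof.
rewrite /g_fun event_NbE (string_NE Y J_even J_rad).
by rewrite ln_div ?posrE ?cond_closed_gt0 // ln_cond_closed.
Qed.

Lemma ln_closed_nil : lnc [::] = 0.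
Proof.
rewrite /ln_closed (_ : closed_on _ = setT) ?prob_setT ?ln1 //.
by apply/seteqP; split=> // w _ f.
Qed.

Definition all_irreducible s := forall g0 i, (i < size s)%N -> irreducible J Y (nth g0 s i).

(** ln g is the influence of the whole string on the backward cluster, that is [cluster_mixing] with
    nothing in between and h = 0. *)
Lemma ln_g_fun_le s gb gf : all_irreducible s ->
  backward_irreducible J Y gb -> forward_irreducible J Y gf ->
  `|ln (g_fun P Y s gb gf)| <= cluster_const.
Proof.
move=> sI gbI gfI; have [_ gbY _] := b_onlyP gbI.
have high : forall e, e \in bonds (b_only Y gb) s gf ->
    exists2 v, v \in e & hgt (b_only Y gb) + 0 <= hgt v.
  move=> e es; rewrite addr0.
  by apply: (string_bonds_high kappa_gt0 hgtD hgt_apex (sI gf) gfI es).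
have := cluster_mixing (edges_plus Y (b_only Y gb)) [::] gbY high.
by rewrite /= cats0 ln_closed_nil subr0 mulr0 oppr0 expR0 mulr1 -ln_g_fun.
Qed.

Lemma expR_lipschitz (x y c : R) : x <= c -> y <= c ->
  `|expR x - expR y| <= expR c * `|x - y|.
Proof.
wlog xy : x y / y <= x => [H xc yc|xc yc].
  have [yx|/ltW xy] := leP y x; first exact: H.
  by rewrite distrC [X in _ <= _ * X]distrC; exact: H.
rewrite !ger0_norm ?subr_ge0 ?ler_expR //.
apply: (@le_trans _ _ (expR x * (x - y))); last first.
  by rewrite ler_wpM2r ?subr_ge0 // ler_expR.
have -> : expR y = expR x * expR (y - x) by rewrite -expRD addrC subrK.
rewrite -[X in X - _]mulr1 -mulrBr ler_wpM2l ?expR_ge0 //.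
by have := expR_ge1Dx (y - x); lra.
Qed.

(** Both strings are compared with their common prefix alone, which gives the same quantity for
    each; the triangle inequality costs the factor 2. *)
Lemma common_prefix_mixing g (X : set (edge d)) b a (sB : seq (edge d)) s l gf gf' :
  (forall u, u \in gV g -> with_apex Y (b - u)) -> hgt b <= hgt a ->
  all_irreducible s -> all_irreducible l ->
  forward_irreducible J Y gf -> forward_irreducible J Y gf' ->
  `|(lnc (bonds_at g X ++ sB ++ bonds a s gf) - lnc (sB ++ bonds a s gf)) -
    (lnc (bonds_at g X ++ sB ++ bonds a l gf') - lnc (sB ++ bonds a l gf'))|
  <= 2 * decay_const * rate ^+ first_disagreement s l.
Proof.
move=> gY ba sI lI gfI gf'I.
have [a' [p [s' [l' [-> -> ha s'I l'I]]]]] :=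
  string_bonds_common apex_antisym rad kappa_gt0 hgtD hgt_apex a (sI gf) (lI gf').
pose h := hgt a' - hgt b.
have hh : kappa * (first_disagreement s l).-1%:R <= h by rewrite /h; lra.
have high (s1 : seq (subgraph d)) gf1 :
    (forall i, (i < size s1)%N -> irreducible J Y (nth gf1 s1 i)) ->
    forward_irreducible J Y gf1 -> forall e, e \in bonds a' s1 gf1 ->
    exists2 v, v \in e & hgt b + h <= hgt v.
  move=> s1I gf1I e es; rewrite /h addrC subrK.
  by apply: (string_bonds_high kappa_gt0 hgtD hgt_apex s1I gf1I es).
rewrite -[leRHS]mulrA; have m1 := cluster_mixing X (sB ++ p) gY (high _ _ s'I gfI).
have m2 := cluster_mixing X (sB ++ p) gY (high _ _ l'I gf'I).
have := cluster_const_rate hh; move: m1 m2; rewrite -!catA /=.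
set x := lnc _ - lnc _; set y := lnc _ - lnc _; set z := lnc _ - lnc _.
set E := cluster_const * _; set F := decay_const * _; clearbody x y z E F.
move=> m1 m2 m3; have := ler_normB (x - y) (z - y).
have -> : x - y - (z - y) = x - z by rewrite [- (z - y)]opprB addrA subrK.
by move=> m4; move: m1 m2 m3 m4; lra.
Qed.

(** In the difference of ln g the term of the backward cluster alone cancels, and the bonds of the
    shared cluster [g] are part of the conditioning. The a priori bound on ln g then allows
    exponentiating. *)
Lemma g_fun_diff g s l gb gf gf' : irreducible J Y g ->
  all_irreducible s -> all_irreducible l -> backward_irreducible J Y gb ->
  forward_irreducible J Y gf -> forward_irreducible J Y gf' ->
  `|g_fun P Y (g :: s) gb gf - g_fun P Y (g :: l) gb gf'|
  <= expR cluster_const * (2 * decay_const) * rate ^+ first_disagreement s l.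
Proof.
move=> gI sI lI gbI gfI gf'I; have [_ gbY _] := b_onlyP gbI.
have cI s1 : all_irreducible s1 -> all_irreducible (g :: s1).
  by move=> s1I g0 [|i] //= /s1I.
rewrite -[g_fun P Y (g :: s) gb gf]lnK ?posrE ?g_fun_gt0 //.
rewrite -[g_fun P Y (g :: l) gb gf']lnK ?posrE ?g_fun_gt0 //.
have up s1 gf1 : all_irreducible s1 -> forward_irreducible J Y gf1 ->
    ln (g_fun P Y (g :: s1) gb gf1) <= cluster_const.
  by move=> /cI s1I gf1I; apply: le_trans (ln_g_fun_le s1I gbI gf1I); exact: ler_norm.
apply: (le_trans (expR_lipschitz (up _ _ sI gfI) (up _ _ lI gf'I))).
rewrite -mulrA ler_wpM2l ?expR_ge0 // !ln_g_fun.
set a := b_only Y gb + displacement Y g.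
have ha : hgt (b_only Y gb) <= hgt a.
  by rewrite hgtD lerDl (le_trans (ltW kappa_gt0)) // (hgt_displacement kappa_gt0 hgt_apex gI).
have := common_prefix_mixing (edges_plus Y (b_only Y gb)) 
  (N_bonds Y rad (Defs.shift (b_only Y gb - (ends Y g).1) g)) gbY ha sI lI gfI gf'I.
rewrite /= -/a -/(Nb_bonds gb) => h; apply: le_trans h.
by rewrite le_eqVlt; apply/orP; left; apply/eqP; congr (`| _ |); ring.
Qed.

Lemma psi_diff t g s l gf gf' : irreducible J Y g ->
  all_irreducible s -> all_irreducible l ->
  forward_irreducible J Y gf -> forward_irreducible J Y gf' ->
  `|psi P Y q beta t g s gf - psi P Y q beta t g l gf'|
  <= 2 * decay_const * rate ^+ first_disagreement s l.
Proof.
move=> gI sI lI gfI gf'I; rewrite /psi.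
have [_ _ _ cg _] := endsP gI.
have gY u : u \in gV g -> with_apex Y ((ends Y g).2 - u) by move=> /cg[].
rewrite /event_N !(closed_aroundE J_even J_rad) !(string_NE Y J_even J_rad).
set X := _ `|` _; set c := expR _ * _; clearbody c.
(* For c > 0 the term ln c cancels in the difference; otherwise both logarithms are 0 by
   convention. *)
have [c0|c0] := leP c 0.
  rewrite !ln0 ?subrr ?normr0; last by rewrite mulr_le0_ge0 // ltW // cond_closed_gt0.
    by rewrite !mulr_ge0 ?decay_const_ge0 ?exprn_ge0 // ltW // (andP rate_itv).1.
  by rewrite mulr_le0_ge0 // ltW // cond_closed_gt0.
have lnE y : 0 < y -> ln (c * y) = ln c + ln y by move=> y0; rewrite lnM ?posrE.
rewrite !lnE ?cond_closed_gt0 // !ln_cond_closed.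
have := common_prefix_mixing X [::] gY (lexx _) sI lI gfI gf'I.
rewrite /= => h; apply: le_trans h.
by rewrite le_eqVlt; apply/orP; left; apply/eqP; congr (`| _ |); ring.
Qed.

End Functions.

Theorem theorem3p1 (R : realType) (d : nat) (J : site d -> R)
    (rng q beta delta : R) (P : probability (rc_space J) R)
    (hd : (0 < d)%N)
    (J_ge0 : forall x, 0 <= J x)
    (J_even : forall x, J (- x) = J x)
    (rng_gt0 : 0 < rng)
    (J_range : forall x, rng < enorm (embed x : 'rV[R]_d) -> J x = 0)
    (J_nn : forall x, enorm (embed x : 'rV[R]_d) = 1 -> 0 < J x)
    (q_ge1 : 1 <= q)
    (beta_ge0 : 0 <= beta)
    (beta_lt : (beta%:E < beta_hat J q)%E)
    (P_DLR : is_DLR q beta P)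
    (delta_gt0 : 0 < delta)
    (delta_lt : delta < 3^-1)
    (delta_adm : admissible P delta) :
  exists theta nu8 nu9 : R,
    [/\ 0 < theta < 1, 0 < nu8, 0 < nu9 &
    forall t, boundary (K_xi P) t ->
    let Y := cone P (3 * delta) t in
    forall (g : subgraph d) (s l : seq (subgraph d))
      (gb gf gf' : subgraph d),
    irreducible J Y g ->
    s <> [::] -> (forall i, (i < size s)%N -> irreducible J Y (nth g s i)) ->
    l <> [::] -> (forall i, (i < size l)%N -> irreducible J Y (nth g l i)) ->
    backward_irreducible J Y gb ->
    forward_irreducible J Y gf ->
    forward_irreducible J Y gf' ->
    [/\ nu8 <= g_fun P Y s gb gf <= nu8^-1,
        `|g_fun P Y (g :: s) gb gf - g_fun P Y (g :: l) gb gf'|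
          <= nu9 * theta ^+ first_disagreement s l
      & `|psi P Y q beta t g s gf - psi P Y q beta t g l gf'|
          <= nu9 * theta ^+ first_disagreement s l]].
Proof.
have [nu0 [nu1 [nu0_gt0 nu1_gt0 decay]]] := decay_subcritical J_ge0 q_ge1 beta_ge0 beta_lt.
have [rad J_rad] := coupling_radius J_range.
have [T [T_ge0 T_bound]] :=
  K_xi_bounded J_ge0 J_even q_ge1 beta_ge0 P_DLR nu0_gt0 nu1_gt0 decay.
have dotE t z : dot t (embed z) = \sum_i t 0 i * (z 0 i)%:~R.
  by apply: eq_bigr => i _; rewrite mxE.
have [beta_gt0|beta_le0] := ltP 0 beta; last first.
  have betaE : beta = 0 by apply/eqP; rewrite eq_le beta_le0.
  (* Arbitrary values: at beta = 0 both [xi] and t vanish, so [Y] is empty and the two ends of an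
     irreducible cluster could not differ. *)
  exists 2^-1, 1, 1; split=> //.
    by rewrite invr_gt0 ltr0n invf_lt1 ?ltr0n // ltr1n.
  move=> t tK Y g s l gb gf gf' [_ [[f b] [/= fb fg _ cg _]]]; exfalso.
  have [_ [bfY|/= /eqP]] := cg _ fg; last by rewrite subr_eq0 eq_sym (negPf fb).
  move: bfY; rewrite /Y /cone /real_cone /= dotE big1.
    by rewrite (xi_eq0 J_ge0 J_even q_ge1 beta_ge0 P_DLR nu0_gt0 nu1_gt0 decay) // mulr0 subrr ltxx.
  by move=> i _; rewrite (T_bound _ tK i).2 // mul0r.
have delta3 : 0 < 1 - 3 * delta.
  by rewrite subr_gt0 mulrC -ltr_pdivlMr // mul1r.
(* On [Y] one has (t, y) > (1 - 3 delta) xi(y), and xi(y) >= nu1 |y|. *)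
pose kappa := (1 - 3 * delta) * nu1.
(* All coordinates of t are at most T in absolute value; the summand 1 keeps D positive when T =
   0. *)
pose D := d%:R * T + 1.
have kappa_gt0 : 0 < kappa by rewrite mulr_gt0.
have D_gt0 : 0 < D by rewrite ltr_wpDl // mulr_ge0.
have c_gt0 : 0 < nu1 * kappa / D by rewrite divr_gt0 // mulr_gt0.
have [S [S_gt0 S_sum]] := lattice_sum hd c_gt0.
set K := cluster_const (J := J) (beta := beta) (nu0 := nu0) (nu1 := nu1) rad S.
set K' := decay_const (J := J) (beta := beta) (nu0 := nu0) (nu1 := nu1) rad kappa D S.
have K_ge0 : 0 <= K by exact: cluster_const_ge0.
have K'_ge0 : 0 <= K' by exact: decay_const_ge0.
(* All constants are fixed before t. The factor exp(K) comes from passing from ln g to g, and the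
   summand 1 makes the last constant positive. *)
exists (rate (nu1 := nu1) kappa D), (expR (- K)), (expR K * (2 * K') + 1); split.
- exact: rate_itv.
- exact: expR_gt0.
- by apply: ltr_wpDl => //; apply: mulr_ge0; [exact: expR_ge0|exact: mulr_ge0].
have rate_ge0 : 0 <= rate (nu1 := nu1) kappa D by exact: expR_ge0.
move=> t tK Y g s l gb gf gf' gI _ sI _ lI gbI gfI gf'I.
pose hgt z := dot t (embed z).
have hgtD x y : hgt (x + y) = hgt x + hgt y by rewrite /hgt embedD dotDr.
have hgt_apex z : with_apex Y z -> kappa * (sup_norm z)%:R <= hgt z.
  case=> [zY|->]; last first.
    rewrite /hgt dotE big1 => [|i _]; last by rewrite mxE mulr0.
    by rewrite (_ : sup_norm 0 = 0%N) ?mulr0 //; apply/eqP; rewrite sup_norm_eq0.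
  have xz := xi_ge J_ge0 J_even q_ge1 beta_ge0 P_DLR nu0_gt0 nu1_gt0 decay J_nn z beta_gt0.
  have := ler_wpM2l (ltW delta3) xz; rewrite mulrA -/kappa => h.
  by apply: le_trans h _; move: zY; rewrite /Y /cone /real_cone /hgt /=; lra.
have hgt_le z : hgt z <= D * (sup_norm z)%:R.
  apply: (@le_trans _ _ (\sum_(i < d) T * (sup_norm z)%:R)).
    rewrite /hgt dotE; apply: ler_sum => i _; apply: le_trans (ler_norm _) _.
    rewrite normrM ler_pM ?(T_bound _ tK i).1 // -intr_norm -natr_absz ler_nat.
    exact: leq_bigmax.
  rewrite sumr_const card_ord -[leLHS]mulr_natl [leLHS]mulrA; apply: ler_wpM2r => //.
  by rewrite /D lerDl.
have allI (s1 : seq (subgraph d)) :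
    (forall i, (i < size s1)%N -> irreducible J Y (nth g s1 i)) ->
    all_irreducible (J := J) Y s1.
  by move=> h g0 i is1; rewrite (set_nth_default g) //; exact: h.
have {}sI := allI _ sI; have {}lI := allI _ lI.
have gap : 2 * K' * rate (nu1 := nu1) kappa D ^+ first_disagreement s l <=
    (expR K * (2 * K') + 1) * rate (nu1 := nu1) kappa D ^+ first_disagreement s l.
  apply: ler_wpM2r; first exact: exprn_ge0.
  apply: ler_wpDr => //; apply: ler_peMl; first exact: mulr_ge0.
  by rewrite -[X in X <= _]expR0 ler_expR.
split.
- have g_gt0 : 0 < g_fun P Y s gb gf by exact: (g_fun_gt0 J_ge0 J_even q_ge1 beta_ge0 P_DLR J_rad).
  have : `|ln (g_fun P Y s gb gf)| <= K.
    exact: (ln_g_fun_le J_ge0 J_even q_ge1 beta_ge0 P_DLR nu0_gt0 nu1_gt0 decay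
      J_rad kappa_gt0 D_gt0 hgtD hgt_apex hgt_le S_sum sI gbI gfI).
  rewrite ler_norml => /andP[lo hi]; rewrite -expRN opprK -[g_fun _ _ _ _ _]lnK ?posrE //.
  by rewrite !ler_expR lo.
- apply: (@le_trans _ _ (expR K * (2 * K') * rate (nu1 := nu1) kappa D ^+ first_disagreement s l)).
    exact: (g_fun_diff J_ge0 J_even q_ge1 beta_ge0 P_DLR nu0_gt0 nu1_gt0 decay
      J_rad kappa_gt0 D_gt0 S_gt0 hgtD hgt_apex hgt_le S_sum
      gI sI lI gbI gfI gf'I).
  by rewrite ler_wpM2r ?exprn_ge0 // lerDl.
- apply: le_trans gap.
  exact: (psi_diff J_ge0 J_even q_ge1 beta_ge0 P_DLR nu0_gt0 nu1_gt0 decay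
      J_rad kappa_gt0 D_gt0 S_gt0 hgtD hgt_apex hgt_le S_sum
      t gI sI lI gfI gf'I).
Qed.
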